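(* Let $0\le\alpha<1$ and $s\in\mathbb{R}$. There does not exist $T>0$ such that the Cauchy problem $$u_t+\mathcal{H}u_{xx}+|D|^\alpha u+uu_x=0,\quad t>0,\ x\in\mathbb{R},\qquad u(0,\cdot)=u_0\in H^s(\mathbb{R}),$$ admits a unique local solution defined on the interval $[0,T]$ and such that the flow map $u_0\mapsto u$ is of class $\mathcal{C}^2$ in a neighborhood of the origin from $H^s(\mathbb{R})$ to $H^s(\mathbb{R})$.
   Context: The Fourier transform is $\widehat f(\xi)=\int_{\mathbb{R}}e^{-ix\xi}f(x)\,dx$. $\mathcal{H}$ is the Hilbert transform, i.e. the Fourier multiplier with symbol $-i\,\mathrm{sgn}(\xi)$, and $|D|^\alpha$ is the Fourier multiplier with symbol $|\xi|^\alpha$ (both acting in $x$). $H^s(\mathbb{R})$ is the Sobolev space with norm $\|f\|_{H^s}=\big(\int_{\mathbb{R}}(1+|\xi|^2)^s|\widehat f(\xi)|^2\,d\xi\big)^{1/2}$. The flow map is the map sending the initial datum $u_0$ to the corresponding solution $u$. *)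

(* Defs.v *)
From HB Require Import structures.
From mathcomp Require Import all_boot all_order all_algebra.
From mathcomp Require Import all_classical all_reals all_analysis.
From mathcomp Require Import complex.

Set Implicit Arguments.
Unset Strict Implicit.
Unset Printing Implicit Defensive.

Import Order.TTheory GRing.Theory Num.Theory.
Import numFieldNormedType.Exports.

Local Open Scope ring_scope.
Local Open Scope complex_scope.
Local Open Scope classical_set_scope.

(** * Schwartz functions and the Fourier transform *)

Definition smooth (R : realType) (f : R -> R) : Prop :=
  forall (n : nat) (x : R), derivable (derive1n n f) x 1.

Definition is_schwartz (R : realType) (f : R -> R) : Prop :=
  smooth f /\
  forall m n : nat, exists C : R, forall x : R, `|x ^+ m * derive1n n f x| <= C.

Record schwartz (R : realType) := Schwartz {
  schwartz_fun :> R -> R;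
  schwartzP : is_schwartz schwartz_fun }.

(** [f] vanishes outside some compact interval [[c, d]] contained in [A] *)
Definition compactly_supported_in (R : realType) (A : set R) (f : R -> R) :
    Prop :=
  exists c d : R, `[c, d] `<=` A /\ forall x, ~ `[c, d] x -> f x = 0.

Definition expi (R : realType) (y : R) : R[i] := cos y +i* sin y.

Definition sqnorm (R : realType) (z : R[i]) : R := complex.Re z ^+ 2 + complex.Im z ^+ 2.

Definition Cmeasurable (R : realType) (f : R -> R[i]) : Prop :=
  measurable_fun setT (fun x => complex.Re (f x)) /\
  measurable_fun setT (fun x => complex.Im (f x)).

Definition Cintegrable (R : realType) (f : R -> R[i]) : Prop :=
  (@lebesgue_measure R).-integrable setT (fun x => (complex.Re (f x))%:E) /\
  (@lebesgue_measure R).-integrable setT (fun x => (complex.Im (f x))%:E).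

Definition Cintegral (R : realType) (f : R -> R[i]) : R[i] :=
  (\int[@lebesgue_measure R]_x complex.Re (f x)) +i*
  (\int[@lebesgue_measure R]_x complex.Im (f x)).

Definition fourier (R : realType) (f : R -> R) (xi : R) : R[i] :=
  Cintegral (fun x => expi (- (x * xi)) * (f x)%:C).

Definition inv_fourier (R : realType) (f : R -> R) (xi : R) : R[i] :=
  ((2 * pi)^-1)%:C * fourier f (- xi).

(** * Real-valued distributions and Sobolev spaces

  Sobolev spaces of negative order contain distributions that are not
  functions, so the elements of [H^s] are functionals on real Schwartz
  functions.  Only functionals whose Fourier transform is a function are used
  below; the formula in [is_fourier] makes them linear, and continuous for the
  Schwartz seminorms as soon as the transform is in a weighted [L^2]. *)

Definition dist (R : realType) : Type := schwartz R -> R^o.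
HB.instance Definition _ (R : realType) := GRing.Lmodule.copy (dist R) (schwartz R -> R^o).

(** [g] is the Fourier transform of [u]: [u] is the inverse Fourier transform of
  [g], where the inverse Fourier transform of distributions is the transpose of
  that of Schwartz functions.  That the right-hand side is a real number for
  every (real) test function says that [g] is Hermitian. *)
Definition is_fourier (R : realType) (u : dist R) (g : R -> R[i]) : Prop :=
  Cmeasurable g /\
  forall psi : schwartz R,
    Cintegrable (fun xi => g xi * inv_fourier psi xi) /\
    (u psi)%:C = Cintegral (fun xi => g xi * inv_fourier psi xi).

Definition has_fourier (R : realType) (u : dist R) : Prop :=
  exists g, is_fourier u g.

(** The Fourier transform of a distribution is unique up to a null set; [fhat]
  picks a representative. *)
Definition fhat (R : realType) (u : dist R) : R -> R[i] :=
  xget (cst 0) [set g | is_fourier u g].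

Definition sobolev_density (R : realType) (s : R) (u : dist R) (xi : R) : R :=
  (1 + xi ^+ 2) `^ s * sqnorm (fhat u xi).

Definition Hs (R : realType) (s : R) : set (dist R) :=
  [set u | has_fourier u /\
    (\int[@lebesgue_measure R]_xi (sobolev_density s u xi)%:E < +oo)%E].

Definition Hs_norm (R : realType) (s : R) (u : dist R) : R :=
  Num.sqrt (\int[@lebesgue_measure R]_xi sobolev_density s u xi).

(** * Fourier multipliers *)

(** The multiplier with symbol [m].  For the symbols used below, which satisfy
  [m (- xi) = (m xi)^*], the integral is a real number. *)
Definition multiplier (R : realType) (m : R -> R[i]) (u : dist R) : dist R :=
  fun psi => complex.Re (Cintegral (fun xi => m xi * fhat u xi * inv_fourier psi xi)).

Definition hilbert_symbol (R : realType) (xi : R) : R[i] := 0 -i* Num.sg xi.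

Definition dx_symbol (R : realType) (xi : R) : R[i] := 0 +i* xi.

Definition hilbert_dxx (R : realType) : dist R -> dist R :=
  multiplier (fun xi => hilbert_symbol xi * dx_symbol xi ^+ 2).

Definition absD (R : realType) (alpha : R) : dist R -> dist R :=
  multiplier (fun xi => (`|xi| `^ alpha)%:C).

(** * Curves in [H^s] and solutions *)

(** [C([0,T]; H^s)] with its supremum norm; a curve is a function of all real
  times of which only the values on [[0,T]] matter. *)
Definition CHs (R : realType) (s T : R) : set (R -> dist R) :=
  [set u | (forall t : R, 0 <= t <= T -> Hs s (u t)) /\
    forall t : R, 0 <= t <= T -> forall e : R, 0 < e -> exists2 d : R, 0 < d &
      forall t' : R, 0 <= t' <= T -> `|t' - t| < d -> Hs_norm s (u t' - u t) < e].

Definition CHs_norm (R : realType) (s T : R) (u : R -> dist R) : R :=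
  sup [set Hs_norm s (u t) | t in `[0, T]].

(** On [(0,T) x R] the family of distributions [u] is the locally square
  integrable function [v]. *)
Definition represented_by (R : realType) (T : R) (u : R -> dist R)
    (v : R * R -> R) : Prop :=
  [/\ measurable_fun setT v,
      forall a b n : R, 0 < a -> b < T ->
        (\int[@lebesgue_measure R \x @lebesgue_measure R]_(z in
          `[a, b] `*` `[(- n)%R, n]) (v z ^+ 2)%:E < +oo)%E &
      {ae @lebesgue_measure R, forall t : R, 0 < t < T ->
        forall psi : schwartz R, compactly_supported_in setT psi ->
          u t psi = \int[@lebesgue_measure R]_x (v (t, x) * psi x)}].

(** [u] solves
      [u_t + H u_xx + |D|^alpha u + u u_x = 0] on [(0,T) x R], [u(0) = u0].
  The product [u u_x = (u^2 / 2)_x] makes sense when [u] is locally square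
  integrable.  The equation holds in the sense of distributions, which is tested
  on the products [theta(t) psi(x)]: these span a dense subspace of the test
  functions on [(0,T) x R]. *)
Definition solution (R : realType) (alpha s T : R) (u0 : dist R)
    (u : R -> dist R) : Prop :=
  [/\ CHs s T u,
      u 0 = u0 &
      exists2 v : R * R -> R, represented_by T u v &
      forall (theta : R -> R) (psi : schwartz R),
        smooth theta -> compactly_supported_in `]0, T[ theta ->
        compactly_supported_in setT psi ->
        \int[@lebesgue_measure R]_(t in `[0, T])
          (- derive1 theta t * u t psi
           + theta t *
             (hilbert_dxx (u t) psi + absD alpha (u t) psi
              - \int[@lebesgue_measure R]_x
                  (v (t, x) ^+ 2 / 2 * derive1 psi x))) = 0].

Definition unique_solution (R : realType) (alpha s T : R) (u0 : dist R)
    (u : R -> dist R) : Prop :=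
  solution alpha s T u0 u /\
  forall w, solution alpha s T u0 w -> forall t : R, 0 <= t <= T -> w t = u t.

(** * Maps of class C^2

  A normed space is given as a subspace [X] of a vector space together with a
  function [nX] that is a norm on [X]. *)

Definition bounded_linear (R : realType) (V W : lmodType R)
    (X : set V) (nX : V -> R) (Y : set W) (nY : W -> R) (L : V -> W) : Prop :=
  [/\ forall h, X h -> Y (L h),
      forall (a : R) h k, X h -> X k -> L (a *: h + k) = a *: L h + L k &
      exists C : R, forall h, X h -> nY (L h) <= C * nX h].

Definition bounded_bilinear (R : realType) (V W : lmodType R)
    (X : set V) (nX : V -> R) (Y : set W) (nY : W -> R) (B : V -> V -> W) :
    Prop :=
  [/\ forall h k, X h -> X k -> Y (B h k),
      forall k, X k -> forall (a : R) h h', X h -> X h' ->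
        B (a *: h + h') k = a *: B h k + B h' k,
      forall h, X h -> forall (a : R) k k', X k -> X k' ->
        B h (a *: k + k') = a *: B h k + B h k' &
      exists C : R, forall h k, X h -> X k -> nY (B h k) <= C * nX h * nX k].

(** [F] is twice continuously (Frechet) differentiable on the open set [U] of
  [X], with values in [Y]; [DF] and [D2F] are its derivatives. *)
Definition class_C2 (R : realType) (V W : lmodType R)
    (X : set V) (nX : V -> R) (Y : set W) (nY : W -> R)
    (U : set V) (F : V -> W) : Prop :=
  (forall x, U x -> Y (F x)) /\
  exists (DF : V -> V -> W) (D2F : V -> V -> V -> W), forall x, U x ->
    [/\ bounded_linear X nX Y nY (DF x),
        bounded_bilinear X nX Y nY (D2F x),
        forall e : R, 0 < e -> exists2 d : R, 0 < d &
          forall h, X h -> U (x + h) -> nX h < d ->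
          nY (F (x + h) - F x - DF x h) <= e * nX h,
        forall e : R, 0 < e -> exists2 d : R, 0 < d &
          forall h, X h -> U (x + h) -> nX h < d -> forall k, X k ->
          nY (DF (x + h) k - DF x k - D2F x h k) <= e * nX h * nX k &
        forall e : R, 0 < e -> exists2 d : R, 0 < d &
          forall h, X h -> U (x + h) -> nX h < d -> forall k l, X k -> X l ->
          nY (D2F (x + h) k l - D2F x k l) <= e * nX k * nX l].

Definition Hs_ball (R : realType) (s r : R) : set (dist R) :=
  [set u | Hs s u /\ Hs_norm s u < r].

(** For data in a neighbourhood of the origin of [H^s] there is a unique
  solution on [[0,T]], and the flow map, with values in [C([0,T]; H^s)], is of
  class C^2 on that neighbourhood. *)
Definition C2_flow_near_origin (R : realType) (alpha s T : R) : Prop :=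
  exists2 r : R, 0 < r &
  exists2 flow : dist R -> (R -> dist R),
    forall u0, Hs_ball s r u0 -> unique_solution alpha s T u0 (flow u0) &
    class_C2 (Hs s) (Hs_norm s) (CHs s T) (CHs_norm s T) (Hs_ball s r) flow.

(* Main.v *)
Require Import Defs.
From HB Require Import structures.
From mathcomp Require Import all_boot all_order all_algebra.
From mathcomp Require Import all_classical all_reals all_analysis.
From mathcomp Require Import measurable_realfun complex ring lra.

(** The equation balances a dispersion of order two against a nonlinearity that loses
  one derivative, and the dissipation [|D|^alpha] with [alpha < 1] is too weak to
  recover it. A low frequency component of width [gam] and a high frequency component
  near [N] interact resonantly: up to [4 t N gam] the phase of their product is that of
  a free wave near [N], so that in a short time [t] the quadratic term grows like
  [t N], the factor [N] being the derivative in [u u_x]. The dissipation is harmless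
  until [t] is of order [N^(- alpha)]. With [gam] of order [1 / (t N)] the second order
  term of the flow is then larger than the square of the [H^s] norm of the datum by a
  factor of order [(t N) gam^(1/2)], that is [N^((1 - alpha) / 2)], whereas a flow of
  class [C^2] at the origin allows only a bounded factor.

  To speak of the second order term of the flow one must know solutions. Uniqueness is
  part of the assumption, so it is enough to construct one solution for each small
  multiple [x h] of a datum [h] whose transform is bounded with compact support. On the
  Fourier side the equation becomes the integral equation [U = x free + quad U], and
  it is solved by Picard iteration in the space of functions dominated by
  [exp (- (T + 1 - t) |xi|) / (1 + xi^2)]. This space is an algebra under convolution
  ([conv_bnd]); the radius of analyticity shrinks linearly in time, as in the
  Cauchy-Kovalevskaya theorem, and thereby absorbs the derivative ([duhamel_bnd]).
  The solution exists on all of [[0, T]] for small [x], lies in every [H^s]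
  ([curve_CHs]), satisfies the equation in the sense of distributions ([curve_weak]),
  and has the expansion [x free + x^2 quad free + O(x^3)] ([sol_taylor]).

  A distribution is observed through a scalar functional, the integral of its
  transform over a frequency window. Along the ray [x h] the functional of the flow is
  a differentiable function of [x] with derivative Lipschitz at 0, and its expansion
  identifies the quadratic coefficient, which is therefore bounded by a constant
  times the square of the norm of [h] ([quadratic_coefficient], [second_iterate_le]).
  For the resonant datum the same coefficient is bounded from below
  ([second_iterate_ge]), and the two bounds contradict each other for large [N]
  ([resonant_growth_bounded], [resonant_parameters]).

  The Fourier transform of a distribution is determined only up to null sets, by
  pairings with real Schwartz functions. That these pairings determine it
  ([fourier_separates]) follows from the explicit transforms of modulated gaussians. *)

Set Implicit Arguments.
Unset Strict Implicit.
Unset Printing Implicit Defensive.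

Import Order.TTheory GRing.Theory Num.Theory.
Import numFieldNormedType.Exports.

Local Open Scope ring_scope.
Local Open Scope classical_set_scope.
Local Open Scope complex_scope.

(** * Integrals of real functions over the line *)

Section real_integral.
Context {R : realType}.
Notation mu := (@lebesgue_measure R).
Implicit Types f g : R -> R.

Definition intg f : Prop := mu.-integrable setT (EFin \o f).

Lemma intg_meas f : intg f -> measurable_fun setT f.
Proof. by move=> /measurable_int /measurable_EFinP. Qed.

Lemma intg_dom f g : measurable_fun setT f -> intg g ->
  (forall x, `|f x| <= g x) -> intg f.
Proof.
move=> mf ig fg; apply: (le_integrable measurableT _ _ ig).
  exact/measurable_EFinP.
move=> x _ /=; rewrite lee_fin; apply: (le_trans (fg x)); exact: ler_norm.
Qed.

Lemma intgD f g : intg f -> intg g -> intg (fun x => f x + g x).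
Proof. exact: integrableD. Qed.

Lemma intgB f g : intg f -> intg g -> intg (fun x => f x - g x).
Proof. exact: integrableB. Qed.

Lemma intgN f : intg f -> intg (fun x => - f x).
Proof. exact: integrableN. Qed.

Lemma intgZl (c : R) f : intg f -> intg (fun x => c * f x).
Proof. exact: integrableZl. Qed.

Lemma intgZr (c : R) f : intg f -> intg (fun x => f x * c).
Proof. exact: integrableZr. Qed.

Lemma intg_norm f : intg f -> intg (fun x => `|f x|).
Proof. exact: integrable_norm. Qed.

Lemma intg_ext f g : f =1 g -> intg f -> intg g.
Proof. by move=> /funext ->. Qed.

Lemma intg0 : intg (fun=> 0).
Proof. exact: integrable0. Qed.

Lemma intg_indic (a b : R) : intg (\1_(`[a, b]%classic)).
Proof. exact: integrable_indic_itv. Qed.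

Lemma measurable_indic_itv (a b : R) : measurable_fun setT (\1_(`[a, b]) : R -> R).
Proof. by apply: measurable_indic; exact: measurable_itv. Qed.

Lemma eq_Rint f g : f =1 g -> \int[mu]_x f x = \int[mu]_x g x.
Proof. by move=> fg; apply: eq_Rintegral => x _; exact: fg. Qed.

(** Affine substitutions preserve Lebesgue measure up to the modulus of their
  slope; both sides are measures, so half-open intervals suffice. *)
Lemma lebesgue_affine (a c : R) (A : set R) : a != 0 -> measurable A ->
  (`|a|%:E * mu ((fun x => (a * x + c)%R : measurableTypeR R) @^-1` A) = mu A)%E.
Proof.
move=> a0 mA.
have mphi : @measurable_fun _ _ (measurableTypeR R) (measurableTypeR R) setT
    (fun x => (a * x + c)%R).
  by apply: measurable_funD => //; exact: measurable_funM.
pose phi : measurableTypeR R -> measurableTypeR R := fun x => (a * x + c)%R.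
pose nu : {measure set (measurableTypeR R) -> \bar R} := mscale (NngNum (normr_ge0 a)) (pushforward mu phi).
rewrite -[LHS]/(nu mphi A); apply/esym; apply: lebesgue_measure_unique => // X [[u v] _ <-] /=.
rewrite -[RHS]/((`|a|%:E * mu ((fun x => (a * x + c)%R : measurableTypeR R) @^-1` `]u, v]))%E).
have [a_gt0|a_lt0|/eqP] := ltgtP 0 a; last by rewrite eq_sym (negbTE a0).
- have -> : (fun x => (a * x + c)%R : measurableTypeR R) @^-1` `]u, v] = `](u - c) / a, (v - c) / a]%classic.
    apply/seteqP; split=> x /=; rewrite !in_itv /= ltr_pdivrMr// ler_pdivlMr//
      ltrBlDr lerBrDr mulrC//.
  rewrite !lebesgue_measure_itv/= !lte_fin ltr_pM2r ?invr_gt0// ltrD2r.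
  case: ifP => _; last by rewrite mule0.
  rewrite gtr0_norm// -!EFinB -EFinM; congr EFin; field; exact: lt0r_neq0.
- have -> : (fun x => (a * x + c)%R : measurableTypeR R) @^-1` `]u, v] = `[(v - c) / a, (u - c) / a[%classic.
    apply/seteqP; split=> x /=; rewrite !in_itv /= ltr_ndivlMr// ler_ndivrMr//
      ltrBlDr lerBrDr mulrC andbC//.
  rewrite !lebesgue_measure_itv/= !lte_fin ltr_nM2r ?invr_lt0// ltrD2r.
  case: ifP => _; last by rewrite mule0.
  rewrite ltr0_norm// -!EFinB -EFinM; congr EFin; field; exact: ltr0_neq0.
Qed.

Lemma integral_affine (a c : R) (f : R -> \bar R) : a != 0 ->
  measurable_fun setT f -> (forall x, 0 <= f x)%E ->
  (`|a|%:E * \int[mu]_x f (a * x + c)%R = \int[mu]_x f x)%E.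
Proof.
move=> a0 mf f0.
have mphi : @measurable_fun _ _ (measurableTypeR R) (measurableTypeR R) setT
    (fun x => (a * x + c)%R).
  by apply: measurable_funD => //; exact: measurable_funM.
pose phi : measurableTypeR R -> measurableTypeR R := fun x => (a * x + c)%R.
pose nu : {measure set (measurableTypeR R) -> \bar R} := mscale (NngNum (normr_ge0 a)) (pushforward mu phi).
transitivity (\int[nu mphi]_x f x)%E.
  rewrite ge0_integral_mscale//; congr (_ * _)%E.
  by rewrite ge0_integral_pushforward.
by apply: eq_measure_integral => A mA _; exact: lebesgue_affine.
Qed.

Lemma intg_affine (a c : R) f : a != 0 -> intg f -> intg (fun x => f (a * x + c)).
Proof.
move=> a0 /integrableP[mf foo].
have mphi : measurable_fun setT (fun x : R => (a * x + c)%R).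
  by apply: measurable_funD => //; exact: measurable_funM.
have mf' : measurable_fun setT f by exact/measurable_EFinP.
apply/integrableP; split; first by apply/measurable_EFinP; exact: measurableT_comp.
move: foo; rewrite -(integral_affine c a0) //=; last first.
  by apply: measurableT_comp => //; exact: measurableT_comp.
have a0' : 0 < `|a| by rewrite normr_gt0.
have H (I : \bar R) : (0 <= I -> `|a|%:E * I < +oo -> I < +oo)%E.
  by case: I => [r||] //=; rewrite ?ltry ?gt0_muley.
by apply: H; exact: integral_ge0.
Qed.

Lemma Rint_affine (a c : R) f : a != 0 -> intg f ->
  `|a| * \int[mu]_x f (a * x + c) = \int[mu]_x f x.
Proof.
move=> a0 If.
have Ip : intg (f^\+) by exact: integrable_funrpos.
have In : intg (f^\-) by exact: integrable_funrneg.
have E g : \int[mu]_x g x = \int[mu]_x (g^\+ x - g^\- x).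
  by apply: eq_Rint => x; rewrite -{1}[g]funrposBneg.
rewrite [in RHS]E [in LHS](eq_Rint (g := fun x => f^\+ (a * x + c) - f^\- (a * x + c))); last first.
  by move=> x; rewrite -{1}[f]funrposBneg.
rewrite !RintegralB//; try exact: (intg_affine c a0).
rewrite mulrBr; congr (_ - _).
- rewrite /Rintegral -(integral_affine c a0 (f := EFin \o f^\+)) ?fineM//=.
  + exact: integrable_fin_num (intg_affine c a0 Ip).
  + exact: measurable_int Ip.
  + by move=> x; rewrite lee_fin funrpos_ge0.
- rewrite /Rintegral -(integral_affine c a0 (f := EFin \o f^\-)) ?fineM//=.
  + exact: integrable_fin_num (intg_affine c a0 In).
  + exact: measurable_int In.
  + by move=> x; rewrite lee_fin funrneg_ge0.
Qed.

Lemma Rint_shift (c : R) f : intg f -> \int[mu]_x f (x + c) = \int[mu]_x f x.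
Proof.
move=> If; rewrite -(Rint_affine c (oner_neq0 R) If) normr1 mul1r.
by apply: eq_Rint => x; rewrite mul1r.
Qed.

Lemma Rint_reflect (c : R) f : intg f -> \int[mu]_x f (c - x) = \int[mu]_x f x.
Proof.
have n1 : (-1 : R) != 0 by rewrite oppr_eq0 oner_neq0.
move=> If; rewrite -(Rint_affine c n1 If) normrN normr1 mul1r.
by apply: eq_Rint => x; rewrite mulN1r addrC.
Qed.

Lemma intg_shift (c : R) f : intg f -> intg (fun x => f (x + c)).
Proof.
move=> /(intg_affine c (oner_neq0 R)); congr intg; apply/funext => x.
by rewrite mul1r.
Qed.

Lemma intg_reflect (c : R) f : intg f -> intg (fun x => f (c - x)).
Proof.
have n1 : (-1 : R) != 0 by rewrite oppr_eq0 oner_neq0.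
move=> /(intg_affine c n1); congr intg; apply/funext => x.
by rewrite mulN1r addrC.
Qed.

(** The integral is the difference of the integrals of the positive and negative
  parts, and each of these is measurable in the parameter by Tonelli. *)
Lemma measurable_Rint_param d (X : measurableType d) (f : X * R -> R) :
  measurable_fun setT f ->
  measurable_fun setT (fun x => \int[mu]_y f (x, y)).
Proof.
move=> mf.
have mp : measurable_fun setT (fun x => \int[mu]_y (f^\+ (x, y))%:E)%E.
  refine (@measurable_fun_fubini_tonelli_F _ _ X (measurableTypeR R) R mu (EFin \o f^\+) _ _).
    by apply/measurable_EFinP; exact: measurable_funrpos.
  by move=> z; rewrite lee_fin funrpos_ge0.
have mn : measurable_fun setT (fun x => \int[mu]_y (f^\- (x, y))%:E)%E.
  refine (@measurable_fun_fubini_tonelli_F _ _ X (measurableTypeR R) R mu (EFin \o f^\-) _ _).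
    by apply/measurable_EFinP; exact: measurable_funrneg.
  by move=> z; rewrite lee_fin funrneg_ge0.
rewrite (_ : (fun x => _) = fun x => fine (\int[mu]_y (f^\+ (x, y))%:E -
    \int[mu]_y (f^\- (x, y))%:E)%E).
  by apply: measurableT_comp => //; exact: emeasurable_funB.
apply/funext => x; rewrite /Rintegral integralE; congr (fine (_ - _)%E).
  by apply: eq_integral => y _; rewrite funeposE /funrpos/= EFin_max.
by apply: eq_integral => y _; rewrite funenegE /funrneg/= EFin_max.
Qed.

Section fubini.
Variables (h : R * R -> R) (A B : R -> R).
Hypotheses (mh : measurable_fun setT h) (iA : intg A) (iB : intg B).
Hypothesis hAB : forall x y, `|h (x, y)| <= A x * B y.

(** A bound by a product of two integrable functions makes the double integral of
  the absolute value finite. *)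
Let integrable_h : (mu \x mu)%E.-integrable setT (EFin \o h).
Proof.
apply/integrable12ltyP; first exact/measurable_EFinP.
apply: (@le_lt_trans _ _ (\int[mu]_x (`|A x| * \int[mu]_y `|B y|)%:E)%E).
  apply: ge0_le_integral => //.
  - by move=> x _; exact: integral_ge0.
  - refine (@measurable_fun_fubini_tonelli_F _ _ (measurableTypeR R) (measurableTypeR R) R mu (EFin \o (fun z => `|h z|)) _ _) => //=.
    by apply/measurable_EFinP; exact: measurableT_comp.
  - apply/measurable_EFinP; apply: measurable_funM => //.
    by apply: measurableT_comp => //; exact: intg_meas.
  - move=> x _; rewrite EFinM.
    have iB' : intg (fun y => `|B y|) by exact: intg_norm.
    rewrite [X in (_ <= _ * X)%E]fineK; last exact: integrable_fin_num.
    rewrite -integralZl//; apply: ge0_le_integral => //.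
    + apply/measurable_EFinP; apply: measurableT_comp => //.
      by apply: measurableT_comp => //; exact: measurable_pair1.
    + apply/measurable_EFinP; apply: measurable_funM => //.
      exact: intg_meas iB'.
    + move=> y _; rewrite lee_fin; apply: (le_trans (hAB x y)).
      by rewrite -normrM ler_norm.
have : intg (fun x => `|A x| * \int[mu]_y `|B y|).
  by apply: intgZr; exact: intg_norm.
exact: integrable_lty.
Qed.

Lemma intg_fubini1 : intg (fun x => \int[mu]_y h (x, y)).
Proof.
apply: (@intg_dom _ (fun x => `|A x| * \int[mu]_y `|B y|)).
- exact: measurable_Rint_param.
- by apply: intgZr; exact: intg_norm.
- move=> x.
  have iB' : intg (fun y => `|B y|) by exact: intg_norm.
  have ih : intg (fun y => h (x, y)).
    apply: (@intg_dom _ (fun y => A x * B y)) => //; last exact: intgZl.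
    by apply: measurableT_comp => //; exact: measurable_pair1.
  apply: (le_trans (le_normr_Rintegral measurableT ih)).
  rewrite -RintegralZl//; apply: le_Rintegral => //.
  + exact: intg_norm.
  + exact: intgZl.
  + by move=> y _; apply: (le_trans (hAB x y)); rewrite -normrM ler_norm.
Qed.

Lemma Rint_fubini :
  \int[mu]_x \int[mu]_y h (x, y) = \int[mu]_y \int[mu]_x h (x, y).
Proof.
rewrite {1 3}/Rintegral; congr fine.
transitivity (\int[mu]_x \int[mu]_y (h (x, y))%:E)%E.
  apply: eq_integral => x _; rewrite fineK//.
  apply: integrable_fin_num => //.
  apply: (@intg_dom _ (fun y => A x * B y)) => //; last exact: intgZl.
  by apply: measurableT_comp => //; exact: measurable_pair1.
rewrite (Fubini integrable_h).
apply: eq_integral => y _; rewrite fineK//.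
apply: integrable_fin_num => //.
apply: (@intg_dom _ (fun x => A x * B y)) => //; last exact: intgZr.
by apply: measurableT_comp => //; exact: measurable_pair2.
Qed.

End fubini.

Lemma ae_imp (P Q : R -> Prop) : (forall x, P x -> Q x) ->
  {ae mu, forall x, P x} -> {ae mu, forall x, Q x}.
Proof. by move=> PQ; apply: (@filterS _ _ (ae_filter_ringOfSetsType mu)). Qed.

Lemma ae_imp2 (P Q S : R -> Prop) : (forall x, P x -> Q x -> S x) ->
  {ae mu, forall x, P x} -> {ae mu, forall x, Q x} -> {ae mu, forall x, S x}.
Proof. by move=> PQ; apply: (@filterS2 _ _ (ae_filter_ringOfSetsType mu)). Qed.

Lemma Rint_dct_ae (f_ : nat -> R -> R) f g :
  (forall n, measurable_fun setT (f_ n)) -> measurable_fun setT f ->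
  {ae mu, forall x, f_ n x @[n --> \oo] --> f x} -> intg g ->
  (forall n x, `|f_ n x| <= g x) ->
  \int[mu]_x f_ n x @[n --> \oo] --> \int[mu]_x f x.
Proof.
move=> mf_ mf cf ig fg.
have H1 n : measurable_fun setT (EFin \o f_ n) by exact/measurable_EFinP.
have H2 : measurable_fun setT (EFin \o f) by exact/measurable_EFinP.
have H3 : {ae mu, forall x, setT x -> (EFin \o f_ n) x @[n --> \oo] --> (EFin \o f) x}.
  by apply: ae_imp cf => x cfx _; apply: cvg_EFin; [exact: nearW|exact: cfx].
have H4 : {ae mu, forall x n, setT x -> (`|(EFin \o f_ n) x| <= (EFin \o g) x)%E}.
  by apply: aeW => x n _; rewrite lee_fin.
have [If _ c] :=
  @dominated_convergence _ (measurableTypeR R) R mu setT measurableT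
    (fun n => EFin \o f_ n) (EFin \o f) (EFin \o g) H1 H2 H3 ig H4.
apply: fine_cvg; rewrite /Rintegral fineK//; exact: integrable_fin_num.
Qed.

Lemma Rint_dct (f_ : nat -> R -> R) f g :
  (forall n, measurable_fun setT (f_ n)) -> measurable_fun setT f ->
  (forall x, f_ n x @[n --> \oo] --> f x) -> intg g ->
  (forall n x, `|f_ n x| <= g x) ->
  \int[mu]_x f_ n x @[n --> \oo] --> \int[mu]_x f x.
Proof. by move=> mf_ mf cf; apply: Rint_dct_ae => //; exact: aeW. Qed.

Lemma Rint_ae_eq f g : measurable_fun setT f -> measurable_fun setT g ->
  {ae mu, forall x, f x = g x} -> \int[mu]_x f x = \int[mu]_x g x.
Proof.
move=> mf mg fg; congr fine; apply: ae_eq_integral => //.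
- exact/measurable_EFinP.
- exact/measurable_EFinP.
- by apply: ae_imp fg => x /= -> _.
Qed.

Lemma intg_ae_eq f g : measurable_fun setT g ->
  {ae mu, forall x, f x = g x} -> intg f -> intg g.
Proof.
move=> mg fg /integrableP[mf foo]; apply/integrableP; split.
  exact/measurable_EFinP.
suff <- : (\int[mu]_x `|(EFin \o f) x| = \int[mu]_x `|(EFin \o g) x|)%E by [].
apply: ae_eq_integral => //.
- exact: measurableT_comp.
- by apply: measurableT_comp => //; exact/measurable_EFinP.
- by apply: ae_imp fg => x /= -> _.
Qed.

End real_integral.

(** * Complex-valued functions and their integrals *)

Section complex_algebra.
Context {R : realType}.
Implicit Types z w : R[i].
Notation Re := complex.Re.
Notation Im := complex.Im.

Lemma cReD z w : Re (z + w) = Re z + Re w. Proof. by case: z w => [? ?] []. Qed.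
Lemma cImD z w : Im (z + w) = Im z + Im w. Proof. by case: z w => [? ?] []. Qed.
Lemma cReN z : Re (- z) = - Re z. Proof. by case: z. Qed.
Lemma cImN z : Im (- z) = - Im z. Proof. by case: z. Qed.
Lemma cReM z w : Re (z * w) = Re z * Re w - Im z * Im w.
Proof. by case: z w => [? ?] []. Qed.
Lemma cImM z w : Im (z * w) = Re z * Im w + Im z * Re w.
Proof. by case: z w => [? ?] []. Qed.
(** Conjugation in a form whose components compute, for use with [complex_ext]. *)
Definition cj z : R[i] := Re z -i* Im z.
Lemma ReConj z : Re (cj z) = Re z. Proof. by []. Qed.
Lemma ImConj z : Im (cj z) = - Im z. Proof. by []. Qed.
Definition ReImE := (cReD, cImD, cReN, cImN, cReM, cImM, ReConj, ImConj).

Lemma complex_ext z w : Re z = Re w -> Im z = Im w -> z = w.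
Proof. by case: z w => [? ?] [? ?] /= -> ->. Qed.

Lemma complex_extE z w : z = w <-> Re z = Re w /\ Im z = Im w.
Proof. by split=> [->//|[]]; exact: complex_ext. Qed.

(** A norm equivalent to the modulus, which is submultiplicative and passes through
  integrals component by component, without square roots. *)
Definition n1 z : R := `|Re z| + `|Im z|.

Lemma n1_ge0 z : 0 <= n1 z. Proof. by rewrite addr_ge0. Qed.
Lemma Re_n1 z : `|Re z| <= n1 z. Proof. by rewrite lerDl. Qed.
Lemma Im_n1 z : `|Im z| <= n1 z. Proof. by rewrite lerDr. Qed.

Lemma n1D z w : n1 (z + w) <= n1 z + n1 w.
Proof.
rewrite /n1 cReD cImD addrACA; apply: lerD; exact: ler_normD.
Qed.
Lemma n1N z : n1 (- z) = n1 z. Proof. by rewrite /n1 cReN cImN !normrN. Qed.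
Lemma n1B z w : n1 (z - w) <= n1 z + n1 w.
Proof. by rewrite -(n1N w); exact: n1D. Qed.
Lemma n1BC z w : n1 (z - w) = n1 (w - z).
Proof. by rewrite -n1N opprB. Qed.
Lemma n1M z w : n1 (z * w) <= n1 z * n1 w.
Proof.
rewrite /n1 cReM cImM; apply: (le_trans (lerD (ler_normB _ _) (ler_normD _ _))).
rewrite !normrM; lra.
Qed.
Lemma n1_real (x : R) : n1 x%:C = `|x|. Proof. by rewrite /n1 /= normr0 addr0. Qed.
Lemma n10 : n1 0 = 0. Proof. by rewrite /n1 /= normr0 addr0. Qed.
Lemma n1_eq0 z : n1 z = 0 -> z = 0.
Proof.
move=> /eqP; rewrite paddr_eq0// !normr_eq0 => /andP[/eqP ? /eqP ?]; exact: complex_ext.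
Qed.
Lemma n1Zl (x : R) z : n1 (x%:C * z) = `|x| * n1 z.
Proof. by rewrite /n1 cReM cImM /= !mul0r subr0 addr0 !normrM mulrDr. Qed.
Lemma n1M_le z w a b : n1 z <= a -> n1 w <= b -> n1 (z * w) <= a * b.
Proof.
by move=> za wb; apply: (le_trans (n1M z w)); apply: ler_pM => //; exact: n1_ge0.
Qed.

Lemma sqnorm_n1 z : sqnorm z <= n1 z ^+ 2.
Proof.
rewrite /sqnorm /n1 sqrrD !real_normK ?num_real// -addrA addrCA lerDr.
by rewrite mulrn_wge0// mulr_ge0.
Qed.
Lemma n1_sqnorm z : n1 z ^+ 2 <= 2 * sqnorm z.
Proof.
rewrite /sqnorm -[Re z ^+ 2]real_normK ?num_real// -[Im z ^+ 2]real_normK ?num_real//.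
rewrite /n1 -subr_ge0.
have -> : 2 * (`|Re z| ^+ 2 + `|Im z| ^+ 2) - (`|Re z| + `|Im z|) ^+ 2 = (`|Re z| - `|Im z|) ^+ 2 by ring.
exact: sqr_ge0.
Qed.
Lemma sqnorm_ge0 z : 0 <= sqnorm z. Proof. by rewrite addr_ge0 ?sqr_ge0. Qed.
Lemma sqnormM z w : sqnorm (z * w) = sqnorm z * sqnorm w.
Proof. by rewrite /sqnorm cReM cImM; ring. Qed.
Lemma sqnorm_real (x : R) : sqnorm x%:C = x ^+ 2.
Proof. by rewrite /sqnorm /= expr0n addr0. Qed.
Lemma sqnormD z w : sqnorm (z + w) <= 2 * (sqnorm z + sqnorm w).
Proof.
rewrite /sqnorm cReD cImD -subr_ge0.
have -> : 2 * (Re z ^+ 2 + Im z ^+ 2 + (Re w ^+ 2 + Im w ^+ 2)) -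
  ((Re z + Re w) ^+ 2 + (Im z + Im w) ^+ 2) = (Re z - Re w) ^+ 2 + (Im z - Im w) ^+ 2 by ring.
by rewrite addr_ge0 ?sqr_ge0.
Qed.

Lemma expiD (x y : R) : expi (x + y) = expi x * expi y.
Proof. by apply: complex_ext; rewrite ?cReM ?cImM /= ?cosD ?sinD//; ring. Qed.
Lemma expi0 : expi (0 : R) = 1.
Proof. by rewrite /expi cos0 sin0. Qed.
Lemma expiN (x : R) : expi (- x) = cj (expi x).
Proof. by rewrite /expi cosN sinN. Qed.
Lemma n1_expi (x : R) : n1 (expi x) <= 2.
Proof.
have := lerD (cos_max x) (sin_max x); rewrite /n1 /=; lra.
Qed.

Lemma real_complexM (x y : R) : (x * y)%:C = x%:C * y%:C :> R[i].
Proof. by apply: complex_ext; rewrite !ReImE /=; ring. Qed.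
Lemma real_complexD (x y : R) : (x + y)%:C = x%:C + y%:C :> R[i].
Proof. by apply: complex_ext; rewrite !ReImE /=; ring. Qed.
Lemma cjM z w : cj (z * w) = cj z * cj w.
Proof. by apply: complex_ext; rewrite !ReImE; ring. Qed.
Lemma cjD z w : cj (z + w) = cj z + cj w.
Proof. by apply: complex_ext; rewrite !ReImE; ring. Qed.
Lemma cj_real (x : R) : cj x%:C = x%:C.
Proof. by apply: complex_ext; rewrite !ReImE /= ?oppr0. Qed.
Lemma cj_fix z : cj z = z -> (Re z)%:C = z.
Proof.
move=> /complex_extE[_] /= H; apply: complex_ext => //=; lra.
Qed.

End complex_algebra.

Section complex_measurable.
Context {R : realType} d {X : measurableType d}.
Implicit Types f g : X -> R[i].
Notation Re := complex.Re.
Notation Im := complex.Im.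

(** [Cmeasurable] on an arbitrary measurable space: transforms depend on time and
  frequency, and their convolutions on a third variable. *)
Definition cmeas f : Prop := measurable_fun setT (fun x => Re (f x)) /\
  measurable_fun setT (fun x => Im (f x)).

Lemma cmeas_ext f g : f =1 g -> cmeas g -> cmeas f.
Proof. by move=> /funext ->. Qed.
Lemma cmeas_cst (z : R[i]) : cmeas (fun=> z).
Proof. by split; exact: measurable_cst. Qed.
Lemma cmeas_real (f : X -> R) : measurable_fun setT f -> cmeas (fun x => (f x)%:C).
Proof. by move=> mf; split => //=; exact: measurable_cst. Qed.
Lemma cmeasD f g : cmeas f -> cmeas g -> cmeas (fun x => f x + g x).
Proof.
move=> [? ?] [? ?]; split.
  by under eq_fun do rewrite cReD; exact: measurable_funD.
by under eq_fun do rewrite cImD; exact: measurable_funD.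
Qed.
Lemma cmeasN f : cmeas f -> cmeas (fun x => - f x).
Proof.
move=> [? ?]; split.
  by under eq_fun do rewrite cReN; exact: measurableT_comp.
by under eq_fun do rewrite cImN; exact: measurableT_comp.
Qed.
Lemma cmeasB f g : cmeas f -> cmeas g -> cmeas (fun x => f x - g x).
Proof. by move=> mf mg; apply: cmeasD => //; exact: cmeasN. Qed.
Lemma cmeasM f g : cmeas f -> cmeas g -> cmeas (fun x => f x * g x).
Proof.
move=> [? ?] [? ?]; split.
  under eq_fun do rewrite cReM.
  by apply: measurable_funB; exact: measurable_funM.
under eq_fun do rewrite cImM.
by apply: measurable_funD; exact: measurable_funM.
Qed.
Lemma cmeas_expi (f : X -> R) : measurable_fun setT f -> cmeas (fun x => expi (f x)).
Proof.
move=> mf; split => /=; apply: measurableT_comp => //.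
  apply: continuous_measurable_fun; exact: continuous_cos.
apply: continuous_measurable_fun; exact: continuous_sin.
Qed.
Lemma cmeas_if (A : X -> bool) f : measurable [set x | A x] -> cmeas f ->
  cmeas (fun x => if A x then f x else 0).
Proof.
move=> mA [? ?].
have mb : measurable_fun setT A.
  by apply: (@measurable_fun_bool _ _ _ _ true); rewrite setTI.
split.
  rewrite (_ : (fun x => _) = (fun x => if A x then Re (f x) else 0)); last first.
    by apply/funext => x; case: ifP.
  exact: measurable_fun_ifT.
rewrite (_ : (fun x => _) = (fun x => if A x then Im (f x) else 0)); last first.
  by apply/funext => x; case: ifP.
exact: measurable_fun_ifT.
Qed.
Lemma measurable_sqnorm f : cmeas f -> measurable_fun setT (fun x => sqnorm (f x)).
Proof.
by move=> [? ?]; apply: measurable_funD; exact: measurable_funX.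
Qed.
End complex_measurable.

Lemma cmeas_comp (R : realType) d1 d2 (X : measurableType d1) (Y : measurableType d2)
  (f : Y -> R[i]) (g : X -> Y) : cmeas f -> measurable_fun setT g ->
  cmeas (fun x => f (g x)).
Proof. by move=> [mr mi] mg; split; [exact: (measurableT_comp mr mg)|exact: (measurableT_comp mi mg)]. Qed.

Section complex_integral.
Context {R : realType}.
Notation mu := (@lebesgue_measure R).
Implicit Types (f g : R -> R[i]) (A B : R -> R).
Notation Re := complex.Re.
Notation Im := complex.Im.

Lemma Cintegrable_intg f : Cintegrable f <->
  intg (fun x => Re (f x)) /\ intg (fun x => Im (f x)).
Proof. by []. Qed.

Lemma Cintegrable_cmeas f : Cintegrable f -> cmeas f.
Proof. by move=> [/intg_meas ? /intg_meas ?]. Qed.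

Lemma Cintegrable_dom f A : cmeas f -> intg A -> (forall x, n1 (f x) <= A x) ->
  Cintegrable f.
Proof.
move=> [mr mi] iA fA; split; apply: (intg_dom _ iA) => // x.
  by rewrite (le_trans (Re_n1 _)).
by rewrite (le_trans (Im_n1 _)).
Qed.

Lemma intg_n1 f : Cintegrable f -> intg (fun x => n1 (f x)).
Proof. by move=> [? ?]; apply: intgD; exact: intg_norm. Qed.

Lemma eq_CI f g : f =1 g -> Cintegral f = Cintegral g.
Proof. by move=> /funext ->. Qed.

Lemma ReCI f : Re (Cintegral f) = \int[mu]_x Re (f x). Proof. by []. Qed.
Lemma ImCI f : Im (Cintegral f) = \int[mu]_x Im (f x). Proof. by []. Qed.

Lemma CintegrableD f g : Cintegrable f -> Cintegrable g ->
  Cintegrable (fun x => f x + g x).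
Proof.
move=> [? ?] [? ?]; split.
  by under eq_fun do rewrite cReD; exact: intgD.
by under eq_fun do rewrite cImD; exact: intgD.
Qed.
Lemma CintegrableN f : Cintegrable f -> Cintegrable (fun x => - f x).
Proof.
move=> [? ?]; split.
  by under eq_fun do rewrite cReN; exact: intgN.
by under eq_fun do rewrite cImN; exact: intgN.
Qed.
Lemma CintegrableB f g : Cintegrable f -> Cintegrable g ->
  Cintegrable (fun x => f x - g x).
Proof. by move=> mf mg; apply: CintegrableD => //; exact: CintegrableN. Qed.
Lemma CintegrableZ (z : R[i]) f : Cintegrable f -> Cintegrable (fun x => z * f x).
Proof.
move=> [? ?]; split.
  by under eq_fun do rewrite cReM; apply: intgB; exact: intgZl.
by under eq_fun do rewrite cImM; apply: intgD; exact: intgZl.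
Qed.

Lemma CID f g : Cintegrable f -> Cintegrable g ->
  Cintegral (fun x => f x + g x) = Cintegral f + Cintegral g.
Proof.
move=> [? ?] [? ?]; apply: complex_ext; rewrite ?cReD ?cImD !(ReCI, ImCI).
  by rewrite -RintegralD//; apply: eq_Rint => x; rewrite cReD.
by rewrite -RintegralD//; apply: eq_Rint => x; rewrite cImD.
Qed.
Lemma CIZ (z : R[i]) f : Cintegrable f ->
  Cintegral (fun x => z * f x) = z * Cintegral f.
Proof.
move=> [ir ii]; apply: complex_ext; rewrite ?cReM ?cImM !(ReCI, ImCI).
  rewrite -!RintegralZl// -RintegralB//; try exact: intgZl.
  by apply: eq_Rint => x; rewrite cReM.
rewrite -!RintegralZl// -RintegralD//; try exact: intgZl.
by apply: eq_Rint => x; rewrite cImM.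
Qed.
Lemma CIZr (z : R[i]) f : Cintegrable f ->
  Cintegral (fun x => f x * z) = Cintegral f * z.
Proof.
by move=> If; rewrite mulrC -CIZ//; apply: eq_CI => x; rewrite mulrC.
Qed.
Lemma CIN f : Cintegrable f -> Cintegral (fun x => - f x) = - Cintegral f.
Proof.
move=> If; rewrite -[RHS]mulN1r -CIZ//; apply: eq_CI => x; by rewrite mulN1r.
Qed.
Lemma CIB f g : Cintegrable f -> Cintegrable g ->
  Cintegral (fun x => f x - g x) = Cintegral f - Cintegral g.
Proof.
by move=> If Ig; rewrite CID ?CIN//; exact: CintegrableN.
Qed.
Lemma CI0 : Cintegral (fun=> 0 : R[i]) = 0.
Proof. by apply: complex_ext; rewrite ?ReCI ?ImCI /= Rintegral_cst// mul0r. Qed.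

Lemma CI_cj f : Cintegrable f -> Cintegral (fun x => cj (f x)) = cj (Cintegral f).
Proof.
move=> [ir ii]; apply: complex_ext; rewrite ?ReConj ?ImConj !(ReCI, ImCI).
  by apply: eq_Rint => x; rewrite ReConj.
rewrite -mulN1r -RintegralZl//; apply: eq_Rint => x; by rewrite ImConj mulN1r.
Qed.

Lemma n1_CI f : Cintegrable f -> n1 (Cintegral f) <= \int[mu]_x n1 (f x).
Proof.
move=> [ir ii]; rewrite /n1 RintegralD//; try exact: intg_norm.
by apply: lerD; exact: le_normr_Rintegral.
Qed.

Lemma n1_CI_dom f A : cmeas f -> intg A -> (forall x, n1 (f x) <= A x) ->
  n1 (Cintegral f) <= \int[mu]_x A x.
Proof.
move=> mf iA fA; have If := Cintegrable_dom mf iA fA.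
apply: (le_trans (n1_CI If)); apply: le_Rintegral => //; exact: intg_n1.
Qed.

Lemma cmeas_CI_param d (X : measurableType d) (f : X * R -> R[i]) :
  cmeas f -> cmeas (fun x => Cintegral (fun y => f (x, y))).
Proof. by move=> [mr mi]; split; [exact: (measurable_Rint_param mr)|exact: (measurable_Rint_param mi)]. Qed.

Lemma cmeas_pair1 (h : R * R -> R[i]) (x : R) : cmeas h -> cmeas (fun y => h (x, y)).
Proof. by move=> mh; apply: (@cmeas_comp _ _ _ _ _ h (pair x) mh); exact: measurable_pair1. Qed.
Lemma cmeas_pair2 (h : R * R -> R[i]) (y : R) : cmeas h -> cmeas (fun x => h (x, y)).
Proof. by move=> mh; apply: (@cmeas_comp _ _ _ _ _ h (pair^~ y) mh); exact: measurable_pair2. Qed.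

Section fubini.
Variables (h : R * R -> R[i]) (A B : R -> R).
Hypotheses (mh : cmeas h) (iA : intg A) (iB : intg B).
Hypothesis hAB : forall x y, n1 (h (x, y)) <= A x * B y.

Lemma CI_fubini : Cintegral (fun x => Cintegral (fun y => h (x, y))) =
  Cintegral (fun y => Cintegral (fun x => h (x, y))).
Proof.
case: mh => mr mi; apply: complex_ext; rewrite !(ReCI, ImCI).
  rewrite (Rint_fubini mr iA iB)// => x y; exact: le_trans (Re_n1 _) _.
rewrite (Rint_fubini mi iA iB)// => x y; exact: le_trans (Im_n1 _) _.
Qed.

Lemma Cintegrable_fubini : Cintegrable (fun x => Cintegral (fun y => h (x, y))).
Proof.
case: mh => mr mi; split.
  apply: (intg_fubini1 mr iA iB) => x y; exact: le_trans (Re_n1 _) _.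
apply: (intg_fubini1 mi iA iB) => x y; exact: le_trans (Im_n1 _) _.
Qed.
End fubini.

Lemma CI_shift (c : R) f : Cintegrable f ->
  Cintegral (fun x => f (x + c)) = Cintegral f.
Proof.
move=> [ir ii]; apply: complex_ext; rewrite !(ReCI, ImCI).
  exact: (Rint_shift c ir).
exact: (Rint_shift c ii).
Qed.
Lemma CI_reflect (c : R) f : Cintegrable f ->
  Cintegral (fun x => f (c - x)) = Cintegral f.
Proof.
move=> [ir ii]; apply: complex_ext; rewrite !(ReCI, ImCI).
  exact: (Rint_reflect c ir).
exact: (Rint_reflect c ii).
Qed.
Lemma Cintegrable_shift (c : R) f : Cintegrable f -> Cintegrable (fun x => f (x + c)).
Proof. by move=> [ir ii]; split; [exact: (intg_shift c ir)|exact: (intg_shift c ii)]. Qed.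

Lemma CI_ae_eq f g : cmeas f -> cmeas g -> {ae mu, forall x, f x = g x} ->
  Cintegral f = Cintegral g.
Proof.
move=> [mfr mfi] [mgr mgi] fg; apply: complex_ext; rewrite !(ReCI, ImCI).
  by apply: Rint_ae_eq => //; apply: ae_imp fg => x ->.
by apply: Rint_ae_eq => //; apply: ae_imp fg => x ->.
Qed.

End complex_integral.

(** * Calculus on the real line *)

Section real_derivatives.
Context {R : realType}.
Implicit Types (f g : R -> R) (x a b : R).

(** In these rules the derivative is the expression that formal computation yields;
  [deq] replaces it by the wanted one, an identity left to [ring]. *)
Lemma deq f x a b : is_derive x 1 f a -> a = b -> is_derive x 1 f b.
Proof. by move=> ? <-. Qed.
Lemma dcst (c x : R) : is_derive x 1 (fun=> c : R) 0.
Proof. exact: is_derive_cst. Qed.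
Lemma did x : is_derive x 1 (fun y : R => y) 1.
Proof. exact: is_derive_id. Qed.
Lemma dD f g x a b : is_derive x 1 f a -> is_derive x 1 g b ->
  is_derive x 1 (fun y => f y + g y) (a + b).
Proof. exact: is_deriveD. Qed.
Lemma dN f x a : is_derive x 1 f a -> is_derive x 1 (fun y => - f y) (- a).
Proof. exact: is_deriveN. Qed.
Lemma dB f g x a b : is_derive x 1 f a -> is_derive x 1 g b ->
  is_derive x 1 (fun y => f y - g y) (a - b).
Proof. exact: is_deriveB. Qed.
Lemma dM f g x a b : is_derive x 1 f a -> is_derive x 1 g b ->
  is_derive x 1 (fun y => f y * g y) (a * g x + f x * b).
Proof.
move=> df dg; rewrite addrC [a * _]mulrC; exact: is_deriveM.
Qed.
Lemma dZ (c : R) f x a : is_derive x 1 f a ->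
  is_derive x 1 (fun y => c * f y) (c * a).
Proof. by move=> df; have := dM (dcst c x) df; rewrite mul0r add0r. Qed.
Lemma dexp f x a : is_derive x 1 f a ->
  is_derive x 1 (fun y => expR (f y)) (expR (f x) * a).
Proof. by move=> df; apply: is_derive1_comp. Qed.
Lemma dsin f x a : is_derive x 1 f a ->
  is_derive x 1 (fun y => sin (f y)) (cos (f x) * a).
Proof. by move=> df; apply: is_derive1_comp. Qed.
Lemma dcos f x a : is_derive x 1 f a ->
  is_derive x 1 (fun y => cos (f y)) (- sin (f x) * a).
Proof. by move=> df; apply: is_derive1_comp. Qed.
Lemma dX2 x : is_derive x 1 (fun y : R => y ^+ 2) (2 * x).
Proof.
rewrite (_ : (fun y => y ^+ 2) = (fun y => y * y)); last first.
  by apply/funext => y; rewrite expr2.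
apply: (deq (dM (did x) (did x))); ring.
Qed.

Lemma is_derive_derivable f x a : is_derive x 1 f a -> derivable f x 1.
Proof. by case. Qed.
Lemma is_derive_derive1 f x a : is_derive x 1 f a -> f^`() x = a.
Proof. by move=> df; rewrite derive1E derive_val. Qed.
Lemma derivable_is_derive f x : derivable f x 1 -> is_derive x 1 f (f^`() x).
Proof. by move=> df; apply: DeriveDef => //; rewrite derive1E. Qed.
Lemma derive_continuous f f' : (forall x : R, is_derive x 1 f (f' x)) -> continuous f.
Proof.
by move=> df x; apply/differentiable_continuous/derivable1_diffP; case: (df x).
Qed.

End real_derivatives.

Section integral_tools.
Context {R : realType}.
Notation mu := (@lebesgue_measure R).
Implicit Types f g F : R -> R.

Lemma continuous_meas f : continuous f -> measurable_fun setT f.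
Proof. exact: continuous_measurable_fun. Qed.

Lemma intg_itv f (a b : R) : continuous f -> mu.-integrable `[a, b] (EFin \o f).
Proof.
move=> cf; apply: continuous_compact_integrable; first exact: segment_compact.
exact: continuous_subspaceT.
Qed.

Lemma FTC2 F f (a b : R) : a <= b -> (forall x : R, is_derive x 1 F (f x)) ->
  continuous f -> \int[mu]_(x in `[a, b]) f x = F b - F a.
Proof.
rewrite le_eqVlt => /predU1P[->|ab] dF cf.
  by rewrite set_itv1 Rintegral_set1 subrr.
have cF := derive_continuous dF.
rewrite /Rintegral (continuous_FTC2 (F := F))//.
- exact: continuous_subspaceT.
- split; first by move=> x _; exact: is_derive_derivable (dF x).
  + by apply: cvg_at_right_filter; exact: cF.
  + by apply: cvg_at_left_filter; exact: cF.
- by move=> x _; exact: is_derive_derive1 (dF x).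
Qed.

(** Dominated convergence from the fundamental theorem of calculus on [[-n, n]]. *)
Lemma Rint_derive0 F f : (forall x : R, is_derive x 1 F (f x)) -> continuous f ->
  intg f -> F n%:R @[n --> \oo] --> (0 : R) -> F (- n%:R) @[n --> \oo] --> (0 : R) ->
  \int[mu]_x f x = 0.
Proof.
move=> dF cf If F1 F2.
have mf := continuous_meas cf.
have H : \int[mu]_x (f \_ `[(- (n%:R : R))%R, n%:R]) x @[n --> \oo] --> \int[mu]_x f x.
  apply: (@Rint_dct _ _ _ (fun x => `|f x|)) => //.
  - move=> n; apply/(measurable_restrictT f) => //.
    exact: measurable_funTS.
  - move=> x; apply: cvg_near_cst; near=> n.
    rewrite /= patchE ifT// inE /= in_itv /= -ler_norml.
    by near: n; exact: nbhs_infty_ger.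
  - exact: intg_norm.
  - by move=> n x; rewrite patchE; case: ifP => // _; rewrite normr0.
have E n : \int[mu]_x (f \_ `[(- (n%:R : R))%R, n%:R]) x = F n%:R - F (- n%:R).
  rewrite -Rintegral_mkcond; apply: FTC2 => //.
  by rewrite -subr_ge0 opprK addr_ge0.
rewrite -(cvg_lim (@Rhausdorff R) H); apply: cvg_lim; first exact: Rhausdorff.
rewrite (_ : (fun n => _) = (fun n : nat => F n%:R - F (- n%:R))); last exact/funext.
have H0 := cvgB F1 F2; rewrite subr0 in H0; exact: H0.
Unshelve. all: by end_near. Qed.

Definition lorentz (x : R) : R := (1 + x ^+ 2)^-1.

Lemma oneD_sqr_gt0 (x : R) : 0 < 1 + x ^+ 2.
Proof. by rewrite ltr_wpDr// sqr_ge0. Qed.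
Lemma lorentz_gt0 x : 0 < lorentz x.
Proof. by rewrite invr_gt0 oneD_sqr_gt0. Qed.
Lemma lorentz_le1 x : lorentz x <= 1.
Proof. by rewrite invf_le1 ?oneD_sqr_gt0// lerDl sqr_ge0. Qed.
Lemma continuous_lorentz : continuous lorentz.
Proof. exact: continuous_oneDsqrV. Qed.

(** The primitive is the arctangent. This function dominates nearly every integrand
  below. *)
Lemma intg_lorentz : intg lorentz.
Proof.
apply/integrableP; split; first by apply/measurable_EFinP; apply: continuous_meas; exact: continuous_lorentz.
under eq_integral do rewrite /= gtr0_norm ?lorentz_gt0//.
rewrite ge0_symfun_integralT//; last 3 first.
- by move=> x; exact/ltW/lorentz_gt0.
- exact: continuous_lorentz.
- by move=> x; rewrite /lorentz /= sqrrN.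
rewrite (_ : [set x | _] = `[0, +oo[%classic); last first.
  by apply/seteqP; split => x/=; rewrite in_itv/= andbT.
by rewrite integral0y_oneDsqr -EFinM ltry.
Qed.

End integral_tools.

(** * Inverse Fourier transforms of Schwartz functions *)

Section schwartz_functions.
Context {R : realType}.
Notation mu := (@lebesgue_measure R).
Notation Re := complex.Re.
Notation Im := complex.Im.
Implicit Types (psi : schwartz R) (f : R -> R).

Lemma schwartz_derive psi (x : R) : is_derive x 1 psi (derive1 psi x).
Proof. exact: derivable_is_derive ((schwartzP psi).1 0%N x). Qed.

Lemma schwartz_continuous psi : continuous psi.
Proof. exact: derive_continuous (@schwartz_derive psi). Qed.

Lemma schwartz_derive_continuous psi : continuous (derive1 psi).
Proof.
apply: (@derive_continuous _ _ (derive1 (derive1 psi))) => x.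
exact: derivable_is_derive ((schwartzP psi).1 1%N x).
Qed.

(** The seminorms of weight 0 and 2 add up to decay of order two. *)
Lemma schwartz_lorentz psi (n : nat) :
  exists C : R, forall x, `|derive1n n psi x| <= C * lorentz x.
Proof.
have [C0 H0] := (schwartzP psi).2 0%N n.
have [C2 H2] := (schwartzP psi).2 2%N n.
exists (C0 + C2) => x; rewrite ler_pdivlMr ?oneD_sqr_gt0// mulrDr mulr1.
apply: lerD; first by have := H0 x; rewrite expr0 mul1r.
by have := H2 x; rewrite normrM ger0_norm ?sqr_ge0// mulrC.
Qed.

Lemma intg_schwartz psi : intg psi.
Proof.
have [C H] := schwartz_lorentz psi 0.
apply: intg_dom (intgZl C intg_lorentz) H.
by apply: continuous_meas; exact: schwartz_continuous.
Qed.

Lemma intg_schwartz_derive psi : intg (derive1 psi).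
Proof.
have [C H] := schwartz_lorentz psi 1.
apply: intg_dom (intgZl C intg_lorentz) H.
by apply: continuous_meas; exact: schwartz_derive_continuous.
Qed.

(** The Fourier integral with the opposite sign in the exponent, and without the
  normalising constant of [inv_fourier]. *)
Definition osc f (xi : R) : R[i] := Cintegral (fun x => expi (x * xi) * (f x)%:C).

Lemma inv_fourierE f (xi : R) : inv_fourier f xi = ((2 * pi)^-1)%:C * osc f xi.
Proof.
congr (_ * _); apply: eq_CI => x; by rewrite mulrN opprK.
Qed.

Lemma measurable_mulxy : measurable_fun setT (fun z : R * R => z.1 * z.2).
Proof. by apply: measurable_funM; [exact: measurable_fst|exact: measurable_snd]. Qed.

Lemma cmeas_osc_integrand f : measurable_fun setT f ->
  cmeas (fun z : R * R => expi (z.2 * z.1) * (f z.2)%:C).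
Proof.
move=> mf; apply: cmeasM.
  apply: cmeas_expi.
  by apply: measurable_funM; [exact: measurable_snd|exact: measurable_fst].
by apply: cmeas_real; exact: (measurableT_comp mf measurable_snd).
Qed.

Lemma cmeas_osc f : measurable_fun setT f -> cmeas (osc f).
Proof.
by move=> mf; exact: (@cmeas_CI_param _ _ _ (fun z => expi (z.2 * z.1) * (f z.2)%:C))
  (cmeas_osc_integrand mf).
Qed.

Lemma cmeas_osc1 f (xi : R) : measurable_fun setT f ->
  cmeas (fun x : R => expi (x * xi) * (f x)%:C).
Proof. by move=> mf; exact: cmeas_pair1 (cmeas_osc_integrand mf). Qed.

Lemma n1_osc1 f (xi x : R) : n1 (expi (x * xi) * (f x)%:C) <= 2 * `|f x|.
Proof. by rewrite mulrC n1Zl mulrC ler_wpM2r// n1_expi. Qed.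

Lemma Cintegrable_osc1 f (xi : R) : intg f ->
  Cintegrable (fun x => expi (x * xi) * (f x)%:C).
Proof.
move=> If; apply: (Cintegrable_dom _ (intgZl 2 (intg_norm If))).
  by apply: cmeas_osc1; exact: intg_meas.
exact: n1_osc1.
Qed.

Lemma osc_bounded f : intg f -> exists2 C : R, 0 <= C & forall xi, n1 (osc f xi) <= C.
Proof.
move=> If; exists (\int[mu]_x (2 * `|f x|)).
  by apply: Rintegral_ge0 => x _; rewrite mulr_ge0.
move=> xi; apply: n1_CI_dom.
- by apply: cmeas_osc1; exact: intg_meas.
- exact: (intgZl 2 (intg_norm If)).
- exact: n1_osc1.
Qed.

Lemma osc_cj f (xi : R) : intg f -> osc f (- xi) = cj (osc f xi).
Proof.
move=> If; rewrite /osc -CI_cj; last exact: Cintegrable_osc1.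
by apply: eq_CI => x; rewrite cjM cj_real mulrN expiN; reflexivity.
Qed.

Lemma inv_fourier_bounded f : intg f ->
  exists2 C : R, 0 <= C & forall xi, n1 (inv_fourier f xi) <= C.
Proof.
move=> /osc_bounded[C C0 H]; exists (`|(2 * pi)^-1| * C); first by rewrite mulr_ge0.
by move=> xi; rewrite inv_fourierE n1Zl ler_wpM2l.
Qed.

Lemma cmeas_inv_fourier f : measurable_fun setT f -> cmeas (inv_fourier f).
Proof.
move=> mf; apply: (cmeas_ext (inv_fourierE f)).
by apply: cmeasM; [exact: cmeas_cst|exact: cmeas_osc].
Qed.

Lemma inv_fourier_cj f (xi : R) : intg f -> inv_fourier f (- xi) = cj (inv_fourier f xi).
Proof. by move=> If; rewrite !inv_fourierE osc_cj// cjM cj_real. Qed.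

(** Fubini moves the exponential from [f] to [k]; Parseval's identity is an instance. *)
Lemma pairing_fubini (f : R -> R[i]) (k : R -> R) : Cintegrable f -> intg k ->
  Cintegral (fun x => Cintegral (fun xi => f xi * expi (x * xi)) * (k x)%:C) =
  Cintegral (fun xi => f xi * osc k xi).
Proof.
move=> If Ik; have mf := Cintegrable_cmeas If; have mk := intg_meas Ik.
have Ife x : Cintegrable (fun xi => f xi * expi (x * xi)).
  apply: (Cintegrable_dom _ (intgZr 2 (intg_n1 If))).
    by apply: cmeasM => //; apply: cmeas_expi; exact: measurable_funM.
  by move=> xi; apply: n1M_le => //; exact: n1_expi.
transitivity (Cintegral (fun x => Cintegral (fun xi =>
    f xi * expi (x * xi) * (k x)%:C))).
  by apply: eq_CI => x; rewrite CIZr.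
have -> := @CI_fubini _ (fun z => f z.2 * expi (z.1 * z.2) * (k z.1)%:C)
  (fun x => `|k x|) (fun xi => 2 * n1 (f xi)).
- apply: eq_CI => xi; rewrite -CIZ; last exact: Cintegrable_osc1.
  by apply: eq_CI => x /=; rewrite mulrA.
- apply: cmeasM; first apply: cmeasM.
  + exact: (cmeas_comp mf measurable_snd).
  + by apply: cmeas_expi; exact: measurable_mulxy.
  + by apply: cmeas_real; exact: (measurableT_comp mk measurable_fst).
- exact: intg_norm.
- by apply: intgZl; exact: intg_n1.
- move=> x xi /=; rewrite mulrC n1Zl ler_wpM2l// mulrC.
  by apply: n1M_le => //; exact: n1_expi.
Qed.

(** Integration by parts in the real and imaginary components; the boundary terms
  vanish because the support is compact. *)
Lemma osc_derive psi (xi : R) : compactly_supported_in setT psi ->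
  osc (derive1 psi) xi = (0 -i* xi) * osc psi xi.
Proof.
move=> [c [d [_ psi0]]].
have cvg0 (F : R -> R) : (forall x, psi x = 0 -> F x = 0) ->
    F n%:R @[n --> \oo] --> (0 : R) /\ F (- n%:R) @[n --> \oo] --> (0 : R).
  move=> F0; split; apply: cvg_near_cst; near=> n; apply: F0; apply: psi0;
    rewrite /= in_itv /=; apply/negP; rewrite negb_and -!ltNge.
    by apply/orP; right; near: n; exact: nbhs_infty_gtr.
  by apply/orP; left; rewrite ltrNl; near: n; exact: nbhs_infty_gtr.
have Ip := intg_schwartz psi; have Id := intg_schwartz_derive psi.
have /Cintegrable_intg[ir ii] := Cintegrable_osc1 xi Ip.
have /Cintegrable_intg[dr di] := Cintegrable_osc1 xi Id.
have E1 : \int[mu]_x (cos (x * xi) * derive1 psi x - xi * (sin (x * xi) * psi x)) = 0.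
  have [|c1 c2] := cvg0 (fun x => cos (x * xi) * psi x).
    by move=> x ->; rewrite mulr0.
  apply: (Rint_derive0 _ _ _ c1 c2).
  - move=> x; apply: (deq (dM (dcos (dM (did x) (dcst xi x))) (schwartz_derive psi x))).
    ring.
  - move=> x; apply: cvgB.
      apply: cvgM; last exact: schwartz_derive_continuous.
      by apply: continuous_comp; [apply: cvgM => //; exact: cvg_cst|exact: continuous_cos].
    apply: cvgM; first exact: cvg_cst.
    apply: cvgM; last exact: schwartz_continuous.
    by apply: continuous_comp; [apply: cvgM => //; exact: cvg_cst|exact: continuous_sin].
  - apply: intgB.
      by apply: (intg_ext _ dr) => x; rewrite cReM /= mulr0 subr0.
    by apply: intgZl; apply: (intg_ext _ ii) => x; rewrite cImM /= mulr0 add0r.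
have E2 : \int[mu]_x (sin (x * xi) * derive1 psi x + xi * (cos (x * xi) * psi x)) = 0.
  have [|c1 c2] := cvg0 (fun x => sin (x * xi) * psi x).
    by move=> x ->; rewrite mulr0.
  apply: (Rint_derive0 _ _ _ c1 c2).
  - move=> x; apply: (deq (dM (dsin (dM (did x) (dcst xi x))) (schwartz_derive psi x))).
    ring.
  - move=> x; apply: cvgD.
      apply: cvgM; last exact: schwartz_derive_continuous.
      by apply: continuous_comp; [apply: cvgM => //; exact: cvg_cst|exact: continuous_sin].
    apply: cvgM; first exact: cvg_cst.
    apply: cvgM; last exact: schwartz_continuous.
    by apply: continuous_comp; [apply: cvgM => //; exact: cvg_cst|exact: continuous_cos].
  - apply: intgD.
      by apply: (intg_ext _ di) => x; rewrite cImM /= mulr0 add0r.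
    by apply: intgZl; apply: (intg_ext _ ir) => x; rewrite cReM /= mulr0 subr0.
apply: complex_ext.
- rewrite cReM /= mul0r sub0r mulNr opprK -RintegralZl//.
  apply/eqP; rewrite -subr_eq0 -RintegralB//; last exact: intgZl.
  by rewrite -[X in _ == X]E1; apply/eqP/eq_Rint => x /=; rewrite !mulr0 subr0 add0r.
- rewrite cImM /= mul0r add0r mulNr -RintegralZl//.
  apply/eqP; rewrite -addr_eq0 -RintegralD//; last exact: intgZl.
  by rewrite -[X in _ == X]E2; apply/eqP/eq_Rint => x /=; rewrite !mulr0 subr0 add0r.
Unshelve. all: by end_near. Qed.

End schwartz_functions.

(** * The Fourier transform of the gaussian *)

Section gaussian_transform.
Context {R : realType}.
Notation mu := (@lebesgue_measure R).
Notation gf := (@gauss_fun R).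
Implicit Types x xi : R.

Lemma dgauss x : is_derive x 1 gf (- (2 * x) * gf x).
Proof. by apply: (deq (dexp (dN (dX2 x)))); rewrite mulrC. Qed.

Lemma oneD_sqr_le_gauss x : (1 + x ^+ 2) ^+ 2 * gf x <= 4.
Proof.
have H : (1 + x ^+ 2) <= 2 * expR (x ^+ 2 / 2).
  by have := expR_ge1Dx (x ^+ 2 / 2); have := sqr_ge0 x; lra.
rewrite /gauss_fun expRN ler_pdivrMr ?expR_gt0//.
have -> : expR (x ^+ 2) = expR (x ^+ 2 / 2) ^+ 2.
  by rewrite -expRM_natl; congr expR; rewrite mulrC divfK.
have -> : 4 * expR (x ^+ 2 / 2) ^+ 2 = (2 * expR (x ^+ 2 / 2)) ^+ 2 by ring.
by rewrite ler_pXn2r ?nnegrE ?mulr_ge0 ?expR_ge0// ltW// oneD_sqr_gt0.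
Qed.

Lemma norm_gauss_lorentz x : `|x| * gf x <= 2 * lorentz x.
Proof.
have H := oneD_sqr_le_gauss x; have p := oneD_sqr_gt0 x.
rewrite ler_pdivlMr//; have g0 := gauss_fun_ge0 x.
have H2 : `|x| <= (1 + x ^+ 2) / 2.
  have : 0 <= (1 - `|x|) ^+ 2 by exact: sqr_ge0.
  rewrite -[x ^+ 2]real_normK ?num_real//; nra.
apply: (@le_trans _ _ ((1 + x ^+ 2) / 2 * gf x * (1 + x ^+ 2))); last by nra.
by rewrite ler_wpM2r ?(ltW p)// ler_wpM2r.
Qed.

Lemma intg_gauss : intg gf.
Proof. exact: integrableT_gauss. Qed.

Lemma measurable_mulr_const xi : measurable_fun setT (fun x : R => x * xi).
Proof. exact: measurable_funM. Qed.

Lemma measurable_cosM xi : measurable_fun setT (fun x : R => cos (x * xi)).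
Proof.
apply: measurableT_comp; last exact: measurable_mulr_const.
by apply: continuous_meas; exact: continuous_cos.
Qed.
Lemma measurable_sinM xi : measurable_fun setT (fun x : R => sin (x * xi)).
Proof.
apply: measurableT_comp; last exact: measurable_mulr_const.
by apply: continuous_meas; exact: continuous_sin.
Qed.

Lemma norm_cos x : `|cos x| <= 1. Proof. exact: cos_max. Qed.
Lemma norm_sin x : `|sin x| <= 1. Proof. exact: sin_max. Qed.

Lemma intg_cos_gauss xi : intg (fun x => cos (x * xi) * gf x).
Proof.
apply: (intg_dom _ intg_gauss).
  by apply: measurable_funM; [exact: measurable_cosM|exact: measurable_gauss_fun].
by move=> x; rewrite normrM [`|gf x|]ger0_norm ?gauss_fun_ge0// ler_piMl ?gauss_fun_ge0 ?norm_cos.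
Qed.

Lemma intg_sin_gauss xi : intg (fun x => sin (x * xi) * gf x).
Proof.
apply: (intg_dom _ intg_gauss).
  by apply: measurable_funM; [exact: measurable_sinM|exact: measurable_gauss_fun].
by move=> x; rewrite normrM [`|gf x|]ger0_norm ?gauss_fun_ge0// ler_piMl ?gauss_fun_ge0 ?norm_sin.
Qed.

Lemma norm_xsin_gauss xi x : `|x * sin (x * xi) * gf x| <= 2 * lorentz x.
Proof.
apply: le_trans (norm_gauss_lorentz x).
rewrite 2!normrM [`|gf x|]ger0_norm ?gauss_fun_ge0// ler_wpM2r ?gauss_fun_ge0//.
by rewrite ler_piMr// norm_sin.
Qed.

Lemma intg_xsin_gauss xi : intg (fun x => x * sin (x * xi) * gf x).
Proof.
apply: (intg_dom _ (intgZl 2 intg_lorentz)); last exact: norm_xsin_gauss.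
apply: measurable_funM; last exact: measurable_gauss_fun.
by apply: measurable_funM => //; exact: measurable_sinM.
Qed.

Lemma cvgn_gauss : gf n%:R @[n --> \oo] --> (0 : R).
Proof.
apply: (cvg_comp (fun n : nat => n%:R) gf); last exact: cvg_gauss_fun.
exact: cvgr_idn.
Qed.

Lemma gaussN x : gf (- x) = gf x. Proof. by rewrite /gauss_fun sqrrN. Qed.

Lemma cvg_sin_gauss xi (u : nat -> R) :
  (gf (u n) @[n --> \oo] --> (0 : R)) ->
  sin (u n * xi) * gf (u n) @[n --> \oo] --> (0 : R).
Proof.
move=> c; apply: norm_cvg0; apply: (squeeze_cvgr _ (cvg_cst (0 : R)) c).
apply: nearW => n; rewrite normr_ge0 /= normrM.
by rewrite [X in _ * X]ger0_norm ?gauss_fun_ge0// ler_piMl ?gauss_fun_ge0 ?norm_sin.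
Qed.

(** Integrating the derivative of [sin (x xi) exp (- x^2)] turns the
  differentiated cosine transform back into the transform itself. *)
Lemma xsin_gauss_cos xi :
  \int[mu]_x (x * sin (x * xi) * gf x) = xi / 2 * \int[mu]_x (cos (x * xi) * gf x).
Proof.
have E : \int[mu]_x (xi * (cos (x * xi) * gf x) - 2 * (x * sin (x * xi) * gf x)) = 0.
  apply: (@Rint_derive0 _ (fun x => sin (x * xi) * gf x)).
  - move=> x; apply: (deq (dM (dsin (dM (did x) (dcst xi x))) (dgauss x))); ring.
  - have cl : continuous (fun x : R => x * xi).
      by move=> x; apply: cvgM => //; exact: cvg_cst.
    have cc : continuous (fun x => cos (x * xi)).
      by move=> x; apply: continuous_comp; [exact: cl|exact: continuous_cos].
    have cs : continuous (fun x => sin (x * xi)).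
      by move=> x; apply: continuous_comp; [exact: cl|exact: continuous_sin].
    move=> x; apply: cvgB; (apply: cvgM; first exact: cvg_cst).
      by apply: cvgM; [exact: cc|exact: continuous_gauss_fun].
    apply: cvgM; last exact: continuous_gauss_fun.
    by apply: cvgM; [exact: cvg_id|exact: cs].
  - by apply: intgB; apply: intgZl; [exact: intg_cos_gauss|exact: intg_xsin_gauss].
  - exact: cvg_sin_gauss cvgn_gauss.
  - apply: cvg_sin_gauss; under eq_fun do rewrite gaussN; exact: cvgn_gauss.
move: E; rewrite RintegralB//; last 2 first.
- by apply: intgZl; exact: intg_cos_gauss.
- by apply: intgZl; exact: intg_xsin_gauss.
rewrite !RintegralZl//; [|exact: intg_xsin_gauss|exact: intg_cos_gauss].
lra.
Qed.

(** Differentiation under the integral gives [phi' = - (xi / 2) phi] for the cosine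
  transform [phi], an equation that determines it up to its value at the origin. *)
Lemma dcos_gauss xi : is_derive xi 1 (fun z => \int[mu]_x (cos (x * z) * gf x))
  (- (xi / 2) * \int[mu]_x (cos (x * xi) * gf x)).
Proof.
pose f (z x : R) : R := cos (x * z) * gf x.
have d1 (z x : R) : is_derive z 1 (f ^~ x) (- (x * sin (x * z) * gf x)).
  apply: (deq (dM (dcos (dM (dcst x z) (did z))) (dcst (gf x) z))); ring.
have Ixi : (`]xi - 1, xi + 1[%classic : set R) xi by rewrite /= in_itv /=; lra.
have h1 z : `]xi - 1, xi + 1[ z -> mu.-integrable setT (EFin \o f z).
  by move=> _; exact: intg_cos_gauss.
have h2 z x : `]xi - 1, xi + 1[ z -> setT x -> derivable (f ^~ x) z 1.
  by move=> _ _; exact: is_derive_derivable (d1 z x).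
have h3 x : 0 <= 2 * lorentz x by rewrite mulr_ge0// ltW// lorentz_gt0.
have h4 : mu.-integrable setT (EFin \o (fun x => 2 * lorentz x)).
  exact: (intgZl 2 intg_lorentz).
have h5 z x : `]xi - 1, xi + 1[ z -> setT x -> `|partial1of2 f z x| <= 2 * lorentz x.
  by move=> _ _; rewrite /partial1of2 (is_derive_derive1 (d1 z x)) normrN norm_xsin_gauss.
have D := @derivable_under_integral R _ _ mu f setT measurableT xi _ _ Ixi h1 h2 _ h3 h4 h5.
have E := @differentiation_under_integral R _ _ mu f setT measurableT xi _ _ Ixi h1 h2 _ h3 h4 h5.
apply: (deq (derivable_is_derive D)); rewrite E.
rewrite (_ : (fun y => _) = (fun x => -1 * (x * sin (x * xi) * gf x))); last first.
  by apply/funext => x; rewrite /partial1of2 (is_derive_derive1 (d1 xi x)) mulN1r.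
rewrite RintegralZl//; last exact: intg_xsin_gauss.
by rewrite xsin_gauss_cos; ring.
Qed.

Lemma cos_gauss xi : \int[mu]_x (cos (x * xi) * gf x) = Num.sqrt pi * expR (- (xi ^+ 2 / 4)).
Proof.
pose phi z := \int[mu]_x (cos (x * z) * gf x).
have H : phi xi * expR (xi ^+ 2 / 4) = phi 0 * expR ((0 : R) ^+ 2 / 4).
  apply: (is_derive_0_is_cst (f := fun z => phi z * expR (z ^+ 2 / 4))) => z.
  apply: (deq (dM (dcos_gauss z) (dexp (dM (dX2 z) (dcst (4^-1) z))))).
  by rewrite -/(phi z); field.
have p0 : phi 0 = Num.sqrt pi.
  rewrite /phi (eq_Rint (g := gf)); last by move=> x; rewrite mulr0 cos0 mul1r.
  by rewrite /Rintegral integralT_gauss.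
move: H; rewrite p0 expr0n /= mul0r expR0 mulr1 => <-.
by rewrite -mulrA -expRD subrr expR0 mulr1.
Qed.

Lemma sin_gauss xi : \int[mu]_x (sin (x * xi) * gf x) = 0.
Proof.
have H : \int[mu]_x (sin (x * xi) * gf x) = - \int[mu]_x (sin (x * xi) * gf x).
  rewrite -{1}(Rint_reflect 0 (intg_sin_gauss xi)) -mulN1r -RintegralZl//; last first.
    exact: intg_sin_gauss.
  by apply: eq_Rint => x; rewrite sub0r gaussN mulNr sinN mulN1r mulNr.
lra.
Qed.

Lemma osc_gauss (k xi : R) : 0 < k ->
  osc (fun x => gf (k * x)) xi = (Num.sqrt pi / k * expR (- ((xi / k) ^+ 2 / 4)))%:C.
Proof.
move=> k0; have k0' : k != 0 by rewrite gt_eqF.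
have kabs : `|k| = k by rewrite gtr0_norm.
apply: complex_ext; rewrite /osc !(ReCI, ImCI) /=.
- have := Rint_affine 0 k0' (intg_cos_gauss (xi / k)).
  rewrite cos_gauss kabs => H.
  rewrite mulrAC -H mulrC mulKf//; apply: eq_Rint => x.
  by rewrite mulr0 subr0 addr0; congr (cos _ * _); field.
- have := Rint_affine 0 k0' (intg_sin_gauss (xi / k)).
  rewrite sin_gauss kabs => /eqP; rewrite mulf_eq0 (negbTE k0')/= => /eqP H.
  rewrite -[RHS]H; apply: eq_Rint => x.
  by rewrite mulr0 add0r addr0; congr (sin _ * _); field.
Qed.

End gaussian_transform.

(** * Uniqueness of the Fourier transform of a distribution *)

Section gaussian_schwartz.
Context {R : realType}.
Notation mu := (@lebesgue_measure R).
Notation gf := (@gauss_fun R).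
Implicit Types (x b k : R) (p q : {poly R}).

(** A family closed under differentiation that contains the modulated gaussians;
  closure reduces the Schwartz seminorms to bounds on polynomials times gaussians. *)
Definition polygauss k b p q x : R :=
  (p.[x] * cos (x * b) + q.[x] * sin (x * b)) * gf (k * x).

Lemma dpolygauss k b p q x : is_derive x 1 (polygauss k b p q)
  (polygauss k b (p^`() + b *: q - (2 * k ^+ 2) *: ('X * p))
                 (q^`() - b *: p - (2 * k ^+ 2) *: ('X * q)) x).
Proof.
have dc := dcos (dM (did x) (dcst b x)).
have ds := dsin (dM (did x) (dcst b x)).
have dg : is_derive x 1 (fun x => gf (k * x)) (- (2 * (k * x)) * gf (k * x) * k).
  by apply: is_derive1_comp; [exact: dgauss|apply: (deq (dZ k (did x))); rewrite mulr1].
apply: (deq (dM (dD (dM (is_derive_poly p x) dc) (dM (is_derive_poly q x) ds)) dg)).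
by rewrite /polygauss !(hornerD, hornerN, hornerZ, hornerM, hornerX); ring.
Qed.

Lemma derive1n_polygauss k b p q n : exists p' q' : {poly R},
  derive1n n (polygauss k b p q) = polygauss k b p' q'.
Proof.
elim: n => [|n [p' [q' IH]]]; first by exists p, q.
rewrite derive1nS IH; do 2 eexists; apply/funext => x.
exact: is_derive_derive1 (dpolygauss _ _ _ _ _).
Qed.

Lemma exprn_gauss_bounded k (n : nat) : 0 < k -> forall x,
  `|x ^+ n| * gf (k * x) <= 1 + (n.+1)`!%:R / k ^+ (2 * n.+1).
Proof.
move=> k0 x; have g1 := gauss_fun_le1 (k * x); have g0 := gauss_fun_ge0 (k * x).
have K0 : 0 < k ^+ (2 * n.+1) by rewrite exprn_gt0.
have H1 : `|x ^+ n| <= 1 + (x ^+ 2) ^+ n.+1.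
  rewrite normrX -[x ^+ 2]real_normK ?num_real// -exprM.
  have [x1|x1] := leP `|x| 1.
    by apply: (le_trans (exprn_ile1 n (normr_ge0 x) x1)); rewrite lerDl exprn_ge0.
  apply: ler_wpDl => //; apply: ler_weXn2l; first exact: ltW.
  by rewrite mul2n -addnn; exact: leq_trans (leqnSn n) (leq_addr _ _).
have H2 : (x ^+ 2) ^+ n.+1 * gf (k * x) <= (n.+1)`!%:R / k ^+ (2 * n.+1).
  have h : ((k * x) ^+ 2) ^+ n.+1 / n.+1`!%:R <= expR ((k * x) ^+ 2).
    have := expR_ge1Dxn n (sqr_ge0 (k * x)).
    by apply: le_trans; rewrite lerDr.
  rewrite /gauss_fun expRN ler_pdivrMr ?expR_gt0// mulrAC ler_pdivlMr//.
  move: h; rewrite ler_pdivrMr ?ltr0n ?fact_gt0//.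
  by rewrite [X in _ <= X -> _]mulrC; apply: le_trans; rewrite -exprM -exprM exprMn mulrC.
apply: (le_trans (ler_wpM2r g0 H1)); rewrite mulrDl mul1r; exact: lerD.
Qed.

Lemma poly_gauss_bounded k p : 0 < k ->
  exists C : R, forall x, `|p.[x]| * gf (k * x) <= C.
Proof.
move=> k0.
exists (\sum_(i < size p) `|p`_i| * (1 + (i.+1)`!%:R / k ^+ (2 * i.+1))) => x.
rewrite horner_coef; apply: (le_trans (ler_wpM2r (gauss_fun_ge0 _) (ler_norm_sum _ _ _))).
rewrite mulr_suml; apply: ler_sum => i _.
by rewrite normrM -mulrA ler_wpM2l// exprn_gauss_bounded.
Qed.

Lemma polygauss_schwartz k b p q : 0 < k -> is_schwartz (polygauss k b p q).
Proof.
move=> k0; split.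
  move=> n x; have [p' [q' ->]] := derive1n_polygauss k b p q n.
  exact: is_derive_derivable (dpolygauss _ _ _ _ _).
move=> m n; have [p' [q' ->]] := derive1n_polygauss k b p q n.
have [C1 H1] := poly_gauss_bounded ('X^m * p') k0.
have [C2 H2] := poly_gauss_bounded ('X^m * q') k0.
exists (C1 + C2) => x; have g0 := gauss_fun_ge0 (k * x).
rewrite /polygauss mulrA normrM [`|gf _|]ger0_norm// mulrDr !mulrA.
apply: (@le_trans _ _ ((`|('X^m * p').[x]| + `|('X^m * q').[x]|) * gf (k * x))).
  rewrite ler_wpM2r//; apply: (le_trans (ler_normD _ _)).
  rewrite !hornerM !hornerXn [`|_ * cos _|]normrM [`|_ * sin _|]normrM.
  by apply: lerD; rewrite ler_piMr ?norm_cos ?norm_sin.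
by rewrite mulrDl; exact: lerD.
Qed.

Definition gauss_cos k b (k0 : 0 < k) : schwartz R :=
  Schwartz (polygauss_schwartz b 1 0 k0).
Definition gauss_sin k b (k0 : 0 < k) : schwartz R :=
  Schwartz (polygauss_schwartz b 0 1 k0).

Lemma gauss_cosE k b (k0 : 0 < k) x : gauss_cos b k0 x = cos (x * b) * gf (k * x).
Proof. by rewrite /= /polygauss !hornerE. Qed.
Lemma gauss_sinE k b (k0 : 0 < k) x : gauss_sin b k0 x = sin (x * b) * gf (k * x).
Proof. by rewrite /= /polygauss !hornerE. Qed.

(** Test functions are real, so the modulation [exp (- i x b)] is split into a cosine
  and a sine, and their transforms are recombined into one gaussian centred at [b]. *)
Lemma osc_gauss_trig k b (k0 : 0 < k) (xi : R) :
  osc (gauss_cos b k0) xi + (0 -i* 1) * osc (gauss_sin b k0) xi =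
  (Num.sqrt pi / k * expR (- (((xi - b) / k) ^+ 2 / 4)))%:C.
Proof.
rewrite -osc_gauss// /osc -CIZ; last by apply: Cintegrable_osc1; exact: intg_schwartz.
rewrite -CID; last 2 first.
- by apply: Cintegrable_osc1; exact: intg_schwartz.
- by apply: CintegrableZ; apply: Cintegrable_osc1; exact: intg_schwartz.
apply: eq_CI => x; rewrite gauss_cosE gauss_sinE mulrBr expiD.
by apply: complex_ext; rewrite !ReImE /= cosN sinN; ring.
Qed.

End gaussian_schwartz.

Lemma ae_neq (R : realType) (c : R) : {ae (@lebesgue_measure R), forall x : R, x != c}.
Proof.
exists [set c]; split; [exact: measurable_set1|exact: lebesgue_measure_set1|].
by move=> x /= /negP; rewrite negbK => /eqP.
Qed.

Section gaussian_annihilator.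
Context {R : realType}.
Notation mu := (@lebesgue_measure R).
Notation gf := (@gauss_fun R).
Variable f : R -> R.
Hypothesis mf : measurable_fun setT f.
Hypothesis If : forall a b : R, 0 < a ->
  intg (fun x => f x * expR (- (a * (x - b) ^+ 2))).
Hypothesis f0 : forall a b : R, 0 < a ->
  \int[mu]_x (f x * expR (- (a * (x - b) ^+ 2))) = 0.

(** The gaussian weight makes [F] integrable. *)
Let F x := f x * expR (- (x ^+ 2)).

Let IF : intg F.
Proof.
apply: intg_ext (If 0 ltr01) => x; by rewrite /F subr0 mul1r.
Qed.

(* completing the square absorbs the weight of [F] into the gaussian *)
Let F0 (a b : R) : 0 < a -> \int[mu]_x (F x * expR (- (a * (x - b) ^+ 2))) = 0.
Proof.
move=> a0; have a1 : 0 < 1 + a by rewrite addr_gt0.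
have a1' : 1 + a != 0 by rewrite gt_eqF.
rewrite (eq_Rint (g := fun x => expR (- (a * b ^+ 2 / (1 + a))) *
   (f x * expR (- ((1 + a) * (x - a * b / (1 + a)) ^+ 2))))).
  by rewrite RintegralZl ?f0 ?mulr0//; exact: If.
move=> x; rewrite /F -mulrA -expRD [RHS]mulrCA -expRD; congr (_ * expR _); field; exact: a1'.
Qed.

(** The mollification of an indicator by a gaussian of width [1 / n.+1], up to the
  factor that normalises the gaussian. *)
Let kern (n : nat) (c d x : R) : R :=
  \int[mu]_y (\1_(`[c, d]) y * expR (- (n.+1%:R ^+ 2 * (x - y) ^+ 2))).

Let kernF (n : nat) (c d : R) : \int[mu]_x (F x * kern n c d x) = 0.
Proof.
have mF := intg_meas IF.
pose h (z : R * R) := F z.1 * (\1_(`[c, d]) z.2 * expR (- (n.+1%:R ^+ 2 * (z.1 - z.2) ^+ 2))) : R.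
have e1 (x y : R) : expR (- (n.+1%:R ^+ 2 * (x - y) ^+ 2)) <= 1.
  by rewrite -expR0 ler_expR oppr_le0 mulr_ge0 ?sqr_ge0.
have i1 (y : R) : 0 <= \1_(`[c, d]) y :> R by [].
have mh : measurable_fun setT h.
  apply: measurable_funM; first exact: (measurableT_comp mF measurable_fst).
  apply: measurable_funM.
    have mI := measurable_indic_itv c d.
    exact: (measurableT_comp mI measurable_snd).
  apply: measurableT_comp => //; apply: measurableT_comp => //.
  apply: measurable_funM => //; apply: measurable_funX.
  by apply: measurable_funB; [exact: measurable_fst|exact: measurable_snd].
have hAB x y : `|h (x, y)| <= `|F x| * \1_(`[c, d]) y.
  rewrite /h /= normrM ler_wpM2l// ger0_norm ?mulr_ge0 ?expR_ge0//.
  by rewrite ler_piMr.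
have := Rint_fubini mh (intg_norm IF) (@intg_indic _ c d) hAB.
rewrite [X in _ = X](eq_Rint (g := fun=> 0)); last first.
  move=> y; rewrite /h /= (eq_Rint (g := fun x =>
    \1_(`[c, d]) y * (F x * expR (- (n.+1%:R ^+ 2 * (x - y) ^+ 2))))); last first.
    by move=> x; rewrite mulrCA.
  have n0 : 0 < (n.+1%:R : R) ^+ 2 by rewrite exprn_gt0.
  rewrite RintegralZl ?F0 ?mulr0//.
  apply: (intg_dom _ (intg_norm IF)).
    apply: measurable_funM => //; apply: measurableT_comp => //; apply: measurableT_comp => //.
    by apply: measurable_funM => //; apply: measurable_funX; exact: measurable_funB.
  by move=> x; rewrite normrM [`|expR _|]ger0_norm ?expR_ge0// ler_piMr.
rewrite Rintegral_cst// mul0r => <-; apply: eq_Rint => x.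
rewrite /kern -RintegralZl//.
apply: (intg_dom _ (@intg_indic _ c d)).
  apply: measurable_funM; first exact: measurable_indic_itv.
  apply: measurableT_comp => //; apply: measurableT_comp => //.
  by apply: measurable_funM => //; apply: measurable_funX; exact: measurable_funB.
by move=> y; rewrite normrM ger0_norm// [`|expR _|]ger0_norm ?expR_ge0// ler_piMr.
Qed.

Let kernE (n : nat) (c d x : R) : n.+1%:R * kern n c d x =
  \int[mu]_y (\1_(`[c, d]) (n.+1%:R^-1 * y + x) * gf y).
Proof.
have n0 : (n.+1%:R : R) != 0 by [].
have I : intg (fun y => \1_(`[c, d]) y * expR (- (n.+1%:R ^+ 2 * (x - y) ^+ 2))).
  apply: (intg_dom _ (@intg_indic _ c d)).
    apply: measurable_funM; first exact: measurable_indic_itv.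
    apply: measurableT_comp => //; apply: measurableT_comp => //.
    by apply: measurable_funM => //; apply: measurable_funX; exact: measurable_funB.
  move=> y; rewrite normrM ger0_norm// [`|expR _|]ger0_norm ?expR_ge0// ler_piMr//.
  by rewrite -expR0 ler_expR oppr_le0 mulr_ge0 ?sqr_ge0.
rewrite /kern -(Rint_affine x (invr_neq0 n0) I) normrV ?unitfE// normr_nat mulVKf//.
apply: eq_Rint => y; congr (_ * expR _); rewrite /=; congr (- _).
rewrite -exprMn; move: (n.+1%:R : R) n0 => N n0; field; exact: n0.
Qed.

Let measurable_kern (n : nat) (c d : R) : measurable_fun setT (kern n c d).
Proof.
refine (@measurable_Rint_param R _ (measurableTypeR R)
  (fun z => \1_(`[c, d]) z.2 * expR (- (n.+1%:R ^+ 2 * (z.1 - z.2) ^+ 2))) _).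
apply: measurable_funM.
  have mI := measurable_indic_itv c d.
  exact: (measurableT_comp mI measurable_snd).
apply: measurableT_comp => //; apply: measurableT_comp => //.
apply: measurable_funM => //; apply: measurable_funX.
by apply: measurable_funB; [exact: measurable_fst|exact: measurable_snd].
Qed.

Let kern_integrand (n : nat) (c d x : R) :
  measurable_fun setT (fun y : R => \1_(`[c, d]) (n.+1%:R^-1 * y + x) * gf y) /\
  forall y, `|\1_(`[c, d]) (n.+1%:R^-1 * y + x) * gf y| <= gf y.
Proof.
split; last first.
  move=> y; rewrite normrM ger0_norm// [`|gf _|]ger0_norm ?gauss_fun_ge0//.
  by rewrite ler_piMl ?gauss_fun_ge0.
apply: measurable_funM; last exact: measurable_gauss_fun.
have mI := measurable_indic_itv c d.
apply: (measurableT_comp mI); apply: measurable_funD => //; exact: measurable_funM.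
Qed.

Let kern_bounded (n : nat) (c d x : R) : `|n.+1%:R * kern n c d x| <= Num.sqrt pi.
Proof.
have [m b] := kern_integrand n c d x; have ig := @intg_gauss R.
rewrite kernE; apply: (le_trans (le_normr_Rintegral measurableT (intg_dom m ig b))).
have -> : Num.sqrt pi = \int[mu]_y gf y by rewrite /Rintegral integralT_gauss.
apply: le_Rintegral => //; exact: (intg_norm (intg_dom m ig b)).
Qed.

Let kern_cvg (c d x : R) : x != c -> x != d ->
  n.+1%:R * kern n c d x @[n --> \oo] --> \1_(`[c, d]) x * Num.sqrt pi.
Proof.
move=> xc xd.
have -> : \1_(`[c, d]) x * Num.sqrt pi = \int[mu]_y (\1_(`[c, d]) x * gf y).
  rewrite RintegralZl; [|by []|exact: intg_gauss].
  by rewrite /Rintegral integralT_gauss.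
rewrite (_ : (fun n => _) = fun n => \int[mu]_y (\1_(`[c, d]) (n.+1%:R^-1 * y + x) * gf y)); last first.
  by apply/funext => n; exact: kernE.
apply: (@Rint_dct _ _ _ gf).
- by move=> n; have [] := kern_integrand n c d x.
- by apply: measurable_funM => //; exact: measurable_gauss_fun.
- move=> y.
  have cu : n.+1%:R^-1 * y + x @[n --> \oo] --> x.
    rewrite -[X in _ --> X]add0r -[X in _ --> X + _](mul0r y).
    apply: cvgD; last exact: cvg_cst.
    by apply: cvgM; [exact: cvg_harmonic|exact: cvg_cst].
  apply: cvgM; last exact: cvg_cst.
  apply: cvg_near_cst.
  have [xltc|cltx|xeqc] := ltgtP x c; last by rewrite xeqc eqxx in xc.
    near=> n; rewrite !indicE !memNset//= in_itv /=; apply/negP; rewrite negb_and -!ltNge.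
      by rewrite xltc.
    by apply/orP; left; near: n; exact: (cvgr_lt _ cu).
  have [xltd|dltx|xeqd] := ltgtP x d; last by rewrite xeqd eqxx in xd.
    near=> n; rewrite !indicE !mem_set//= in_itv /=; first by rewrite (ltW cltx) ltW.
    by apply/andP; split; apply: ltW; near: n; [exact: (cvgr_gt _ cu)|exact: (cvgr_lt _ cu)].
  near=> n; rewrite !indicE !memNset//= in_itv /=; apply/negP; rewrite negb_and -!ltNge.
    by rewrite dltx orbT.
  by apply/orP; right; near: n; exact: (cvgr_gt _ cu).
- exact: intg_gauss.
- by move=> n y; have [_] := kern_integrand n c d x.
Unshelve. all: by end_near. Qed.

Let F_itv (c d : R) : \int[mu]_x (F x * (\1_(`[c, d]) x * Num.sqrt pi)) = 0.
Proof.
have mF := intg_meas IF.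
have mI := measurable_indic_itv c d.
have H : \int[mu]_x (F x * (n.+1%:R * kern n c d x)) @[n --> \oo] -->
    \int[mu]_x (F x * (\1_(`[c, d]) x * Num.sqrt pi)).
  apply: (@Rint_dct_ae _ _ _ (fun x => `|F x| * Num.sqrt pi)).
  - move=> n; apply: measurable_funM => //; apply: (measurable_funM (measurable_cst _) (measurable_kern n c d)).
  - by apply: measurable_funM => //; apply: measurable_funM.
  - apply: ae_imp2 (ae_neq c) (ae_neq d) => x xc xd.
    by apply: cvgM; [exact: cvg_cst|exact: kern_cvg].
  - by apply: intgZr; exact: intg_norm.
  - by move=> n x; rewrite normrM ler_wpM2l.
rewrite -(cvg_lim (@Rhausdorff R) H); apply: lim_near_cst; first exact: Rhausdorff.
apply: nearW => n.
rewrite (eq_Rint (g := fun x => n.+1%:R * (F x * kern n c d x))); last first.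
  by move=> x; rewrite mulrCA.
rewrite RintegralZl//; first by rewrite kernF mulr0.
apply: (intg_dom _ (intg_norm (intgZr (Num.sqrt pi) IF))).
  by apply: measurable_funM => //; exact: (measurable_kern n c d).
move=> x; rewrite !normrM ler_wpM2l// [leRHS]ger0_norm//.
apply: le_trans (kern_bounded n c d x); rewrite normrM ler_peMl// normr_nat.
by rewrite ler1n.
Qed.

(** Convolving an indicator with gaussians of vanishing width recovers the indicator, so
  the integrals of [F] over intervals vanish. *)
Lemma gaussian_annihilator : {ae mu, forall x, f x = 0}.
Proof.
have mF := intg_meas IF.
have sp : Num.sqrt pi != 0 :> R by rewrite gt_eqF// sqrtr_gt0 pi_gt0.
have itv0 (c d : R) : \int[mu]_(x in `[c, d]) F x = 0.
  have := F_itv c d.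
  rewrite (eq_Rint (g := fun x => (F x * \1_(`[c, d]) x) * Num.sqrt pi)); last first.
    by move=> x; rewrite mulrA.
  have I : intg (fun x => F x * \1_(`[c, d]) x).
    apply: (intg_dom _ (intg_norm IF)).
      by apply: measurable_funM => //; exact: measurable_indic_itv.
    by move=> x; rewrite normrM ler_piMr// indicE; case: (_ \in _); rewrite ?normr0 ?normr1.
  rewrite RintegralZr// => /eqP; rewrite mulf_eq0 (negbTE sp) orbF => /eqP <-.
  rewrite Rintegral_mkcond; apply: eq_Rint => x.
  by rewrite patchE indicE; case: ifP => _; rewrite ?mulr1 ?mulr0.
have IFy (y : R) : mu.-integrable `]-oo, y] (EFin \o F).
  by apply: (integrableS measurableT) => //; exact: measurable_itv.
have lF : locally_integrable [set: R] F.
  apply: open_integrable_locally => //; exact: openT.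
have D := FTC1Ny IFy lF.
have mono (x y : R) : x <= y ->
    \int[mu]_(t in `]-oo, y]) F t = \int[mu]_(t in `]-oo, x]) F t.
  move=> xy; apply/eqP; rewrite -subr_eq0; apply/eqP.
  rewrite Rintegral_itvB// ?bnd_simp//.
  rewrite -[RHS](itv0 x y) Rintegral_itv_obnd_cbnd//.
  by apply: (integrableS measurableT) => //; exact: measurable_itv.
have cst_F (x y : R) : \int[mu]_(t in `]-oo, y]) F t = \int[mu]_(t in `]-oo, x]) F t.
  by have [/mono|/ltW/mono] := leP x y.
(* by Lebesgue differentiation [F] is a.e. the derivative of its primitive, which
  is constant *)
apply: ae_imp D => x [_].
rewrite (_ : (fun y => _) = cst (\int[mu]_(t in `]-oo, x]) F t)); last first.
  by apply/funext => y; exact: cst_F.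
rewrite derive1_cst => /esym/eqP; rewrite mulf_eq0 => /orP[/eqP//|].
by rewrite expR_eq0.
Qed.

End gaussian_annihilator.

Section fourier_uniqueness.
Context {R : realType}.
Notation mu := (@lebesgue_measure R).
Notation gf := (@gauss_fun R).
Notation Re := complex.Re.
Notation Im := complex.Im.

(** The transforms of real Schwartz functions include all gaussians, up to the
  combination of a cosine and a sine modulation, and [gaussian_annihilator] applies to
  the components of [g]. *)
Lemma fourier_separates (g : R -> R[i]) : cmeas g ->
  (forall psi : schwartz R, Cintegrable (fun xi => g xi * inv_fourier psi xi) /\
     Cintegral (fun xi => g xi * inv_fourier psi xi) = 0) ->
  {ae mu, forall x, g x = 0}.
Proof.
move=> mg H.
have twopi : ((2 * pi)%:C : R[i]) * ((2 * pi)^-1)%:C = 1.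
  rewrite -rmorphM /= divff; first exact: rmorph1.
  by rewrite gt_eqF// mulr_gt0// pi_gt0.
have H' (psi : schwartz R) : Cintegrable (fun xi => g xi * osc psi xi) /\
    Cintegral (fun xi => g xi * osc psi xi) = 0.
  have [I E] := H psi.
  have e xi : g xi * osc psi xi = (2 * pi)%:C * (g xi * inv_fourier psi xi).
    rewrite inv_fourierE mulrCA; congr (_ * _); by rewrite mulrA twopi mul1r.
  split; first by under eq_fun do rewrite e; exact: CintegrableZ.
  by under eq_CI => xi do rewrite e; rewrite CIZ// E mulr0.
have G (a b : R) : 0 < a ->
   Cintegrable (fun xi => g xi * (expR (- (a * (xi - b) ^+ 2)))%:C) /\
   Cintegral (fun xi => g xi * (expR (- (a * (xi - b) ^+ 2)))%:C) = 0.
  move=> a0; pose k : R := (2 * Num.sqrt a)^-1.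
  have sa : 0 < Num.sqrt a by rewrite sqrtr_gt0.
  have k0 : 0 < k by rewrite invr_gt0 mulr_gt0.
  have s0 : Num.sqrt pi / k != 0 :> R.
    apply: mulf_neq0; last by rewrite invr_neq0// gt_eqF.
    by rewrite gt_eqF// sqrtr_gt0 pi_gt0.
  have e xi : g xi * (expR (- (a * (xi - b) ^+ 2)))%:C =
     ((Num.sqrt pi / k)^-1)%:C * (g xi * osc (gauss_cos b k0) xi +
       (0 -i* 1) * (g xi * osc (gauss_sin b k0) xi)).
    rewrite [(0 -i* 1) * (_ * _)]mulrCA -mulrDr osc_gauss_trig [RHS]mulrCA -real_complexM mulKf//.
    congr (_ * (expR (- _))%:C).
    by rewrite /k invrK -[in LHS](sqr_sqrtr (ltW a0)); field.
  have [Ic Ec] := H' (gauss_cos b k0); have [Is Es] := H' (gauss_sin b k0).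
  have Is' := CintegrableZ (0 -i* 1) Is.
  rewrite (funext e); split; first exact: (CintegrableZ _ (CintegrableD Ic Is')).
  by rewrite (CIZ _ (CintegrableD Ic Is')) (CID Ic Is') (CIZ _ Is) Ec Es mulr0 addr0 mulr0.
case: (mg) => mr mi.
have R0 : {ae mu, forall x, Re (g x) = 0}.
  apply: gaussian_annihilator => // a b a0; have [/Cintegrable_intg[I _] E] := G a b a0.
    by apply: (intg_ext _ I) => x; rewrite cReM /= mulr0 subr0.
  rewrite -[RHS]/(Re (0 : R[i])) -E ReCI; apply: eq_Rint => x.
  by rewrite cReM /= mulr0 subr0.
have I0 : {ae mu, forall x, Im (g x) = 0}.
  apply: gaussian_annihilator => // a b a0; have [/Cintegrable_intg[_ I] E] := G a b a0.
    by apply: (intg_ext _ I) => x; rewrite cImM /= mulr0 add0r.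
  rewrite -[RHS]/(Im (0 : R[i])) -E ImCI; apply: eq_Rint => x.
  by rewrite cImM /= mulr0 add0r.
by apply: ae_imp2 R0 I0 => x r i; apply: complex_ext; [rewrite r|rewrite i].
Qed.

End fourier_uniqueness.

(** * Sobolev norms and frequency windows *)

Lemma addrBB (V : zmodType) (a b c d : V) : (a - b) - (c - d) = (a - c) - (b - d).
Proof. by rewrite !opprD !opprK addrACA. Qed.

Section sobolev.
Context {R : realType}.
Notation mu := (@lebesgue_measure R).
Notation Re := complex.Re.
Notation Im := complex.Im.
Implicit Types (u v w : dist R) (g : R -> R[i]) (s a : R).

Lemma fhatP u : has_fourier u -> is_fourier u (fhat u).
Proof. by move=> [g ug]; exact: (xgetPex (cst 0) (ex_intro _ g ug)). Qed.

Lemma is_fourier_unique u g1 g2 : is_fourier u g1 -> is_fourier u g2 ->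
  {ae mu, forall xi, g1 xi = g2 xi}.
Proof.
move=> [m1 H1] [m2 H2].
have H : {ae mu, forall xi, g1 xi - g2 xi = 0}.
  apply: fourier_separates; first exact: cmeasB.
  move=> psi; have [I1 E1] := H1 psi; have [I2 E2] := H2 psi.
  have e xi : (g1 xi - g2 xi) * inv_fourier psi xi =
    g1 xi * inv_fourier psi xi - g2 xi * inv_fourier psi xi by rewrite mulrBl.
  rewrite (funext e); split; first exact: CintegrableB.
  by rewrite CIB// -E1 -E2 subrr.
by apply: ae_imp H => xi /eqP; rewrite subr_eq0 => /eqP.
Qed.

Lemma fhat_ae u g : is_fourier u g -> {ae mu, forall xi, fhat u xi = g xi}.
Proof.
by move=> ug; exact: (is_fourier_unique (fhatP (ex_intro _ g ug)) ug).
Qed.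

Lemma is_fourier_lin a u v g1 g2 : is_fourier u g1 -> is_fourier v g2 ->
  is_fourier (a *: u + v) (fun xi => a%:C * g1 xi + g2 xi).
Proof.
move=> [m1 H1] [m2 H2]; split.
  by apply: cmeasD => //; apply: cmeasM => //; exact: cmeas_cst.
move=> psi; have [I1 E1] := H1 psi; have [I2 E2] := H2 psi.
have e xi : (a%:C * g1 xi + g2 xi) * inv_fourier psi xi =
   a%:C * (g1 xi * inv_fourier psi xi) + g2 xi * inv_fourier psi xi.
  by rewrite mulrDl mulrA.
have I1' := CintegrableZ a%:C I1.
rewrite (funext e); split; first exact: CintegrableD.
by rewrite (CID I1' I2) (CIZ _ I1) -E1 -E2 -real_complexM -real_complexD.
Qed.

Lemma is_fourier0 : is_fourier (0 : dist R) (fun=> 0).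
Proof.
split; first exact: cmeas_cst.
move=> psi; have e xi : (0 : R[i]) * inv_fourier psi xi = 0 by rewrite mul0r.
rewrite (funext e); split; first by split; exact: intg0.
by rewrite CI0.
Qed.

Definition weight s (xi : R) : R := (1 + xi ^+ 2) `^ s.

Lemma weight_gt0 s xi : 0 < weight s xi.
Proof. by rewrite powR_gt0// oneD_sqr_gt0. Qed.

Lemma measurable_weight s : measurable_fun setT (weight s).
Proof.
apply: (measurableT_comp (measurable_powR s)).
by apply: measurable_funD => //; exact: measurable_funX.
Qed.

Lemma measurable_density s g : cmeas g ->
  measurable_fun setT (fun xi => weight s xi * sqnorm (g xi)).
Proof.
by move=> mg; apply: measurable_funM; [exact: measurable_weight|exact: measurable_sqnorm].
Qed.

Lemma density_ge0 s (z : R[i]) xi : 0 <= weight s xi * sqnorm z.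
Proof. by rewrite mulr_ge0 ?sqnorm_ge0// ltW// weight_gt0. Qed.

Lemma HsP s u : Hs s u <->
  has_fourier u /\ intg (fun xi => weight s xi * sqnorm (fhat u xi)).
Proof.
have nn : (\int[mu]_xi `|(EFin \o (fun xi => (weight s xi * sqnorm (fhat u xi))%R)) xi| =
    \int[mu]_xi (sobolev_density s u xi)%:E)%E.
  by apply: eq_integral => xi _; rewrite /= ger0_norm ?density_ge0.
split=> -[hu H]; split=> //.
  apply/integrableP; split; last by rewrite nn.
  by apply/measurable_EFinP; apply: measurable_density; have [] := fhatP hu.
by move/integrableP: H => [_]; rewrite nn.
Qed.

Lemma Hs_norm_ge0 s u : 0 <= Hs_norm s u. Proof. exact: sqrtr_ge0. Qed.

Lemma Hs_norm_sqr s u :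
  Hs_norm s u ^+ 2 = \int[mu]_xi (weight s xi * sqnorm (fhat u xi)).
Proof. by rewrite sqr_sqrtr// Rintegral_ge0// => xi _; exact: density_ge0. Qed.

Lemma Hs_is_fourier s u g : is_fourier u g ->
  intg (fun xi => weight s xi * sqnorm (g xi)) ->
  Hs s u /\ Hs_norm s u ^+ 2 = \int[mu]_xi (weight s xi * sqnorm (g xi)).
Proof.
move=> ug Ig; have hu : has_fourier u by exists g.
have [mf _] := fhatP hu; have [mg _] := ug.
have e : {ae mu, forall xi, weight s xi * sqnorm (fhat u xi) = weight s xi * sqnorm (g xi)}.
  by apply: ae_imp (fhat_ae ug) => xi ->.
split.
  apply/HsP; split => //; apply: (intg_ae_eq (measurable_density s mf) _ Ig).
  by apply: ae_imp e => xi ->.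
rewrite Hs_norm_sqr; apply: Rint_ae_eq => //; exact: measurable_density.
Qed.

(** The inequality [|z + w|^2 <= 2 (|z|^2 + |w|^2)], applied pointwise to the transforms,
  takes the place of Minkowski's inequality. *)
Lemma Hs_lin s a u v : Hs s u -> Hs s v -> Hs s (a *: u + v) /\
  Hs_norm s (a *: u + v) ^+ 2 <= 2 * (a ^+ 2 * Hs_norm s u ^+ 2 + Hs_norm s v ^+ 2).
Proof.
move=> /HsP[hu iu] /HsP[hv iv].
have F := is_fourier_lin a (fhatP hu) (fhatP hv).
have [mu_ _] := fhatP hu; have [mv_ _] := fhatP hv.
have [mF _] := F.
have le xi : weight s xi * sqnorm (a%:C * fhat u xi + fhat v xi) <=
   2 * (a ^+ 2 * (weight s xi * sqnorm (fhat u xi)) + weight s xi * sqnorm (fhat v xi)).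
  rewrite [a ^+ 2 * _]mulrCA -mulrDr [leRHS]mulrCA ler_wpM2l//; first exact/ltW/weight_gt0.
  by apply: (le_trans (sqnormD _ _)); rewrite sqnormM sqnorm_real.
have I1 := intgZl (a ^+ 2) iu.
have I := intgZl 2 (intgD I1 iv).
have I' : intg (fun xi => weight s xi * sqnorm (a%:C * fhat u xi + fhat v xi)).
  apply: (intg_dom _ I); first exact: (measurable_density s mF).
  by move=> xi; rewrite ger0_norm//; exact: density_ge0.
have [H E] := Hs_is_fourier F I'; split=> //.
rewrite E !Hs_norm_sqr -RintegralZl// -RintegralD// -RintegralZl//; last exact: intgD.
exact: le_Rintegral.
Qed.

Lemma Hs0 s : Hs s (0 : dist R) /\ Hs_norm s (0 : dist R) = 0.
Proof.
have e xi : weight s xi * sqnorm (0 : R[i]) = 0 by rewrite sqnorm_real expr0n mulr0.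
have I : intg (fun xi => weight s xi * sqnorm (0 : R[i])).
  by rewrite (funext e); exact: intg0.
have [H E] := Hs_is_fourier is_fourier0 I; split=> //.
by apply/eqP; rewrite -sqrf_eq0 E (eq_Rint e) Rintegral_cst// mul0r.
Qed.

Lemma HsZ s a u : Hs s u -> Hs s (a *: u) /\ Hs_norm s (a *: u) = `|a| * Hs_norm s u.
Proof.
move=> /HsP[hu iu].
have F := is_fourier_lin a (fhatP hu) is_fourier0; rewrite addr0 in F.
have e xi : weight s xi * sqnorm (a%:C * fhat u xi + 0) =
   a ^+ 2 * (weight s xi * sqnorm (fhat u xi)).
  by rewrite addr0 sqnormM sqnorm_real mulrCA.
have I : intg (fun xi => weight s xi * sqnorm (a%:C * fhat u xi + 0)).
  by rewrite (funext e); exact: intgZl.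
have [H E] := Hs_is_fourier F I; split=> //.
apply/eqP; rewrite -(@eqrXn2 _ 2)// ?mulr_ge0 ?Hs_norm_ge0//.
by rewrite E (eq_Rint e) RintegralZl// exprMn Hs_norm_sqr real_normK ?num_real.
Qed.

Lemma HsB s u v : Hs s u -> Hs s v -> Hs s (u - v) /\
  Hs_norm s (u - v) ^+ 2 <= 2 * (Hs_norm s u ^+ 2 + Hs_norm s v ^+ 2).
Proof.
move=> Hu Hv; have [H E] := Hs_lin (-1) Hv Hu.
have e : -1 *: v + u = u - v by rewrite scaleN1r addrC.
rewrite -e; split=> //; apply: le_trans E _.
by rewrite sqrrN expr1n mul1r [_ ^+ 2 + _]addrC.
Qed.

Lemma CHsB s T (x y : R -> dist R) : CHs s T x -> CHs s T y -> CHs s T (x - y).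
Proof.
move=> [x1 x2] [y1 y2]; split=> [t tT|t tT e e0].
  by have [] := HsB (x1 t tT) (y1 t tT).
have [d1 d10 h1] := x2 t tT (e / 2) (divr_gt0 e0 (ltr0Sn R 1)).
have [d2 d20 h2] := y2 t tT (e / 2) (divr_gt0 e0 (ltr0Sn R 1)).
exists (Num.min d1 d2); first by rewrite lt_min d10.
move=> t' t'T; rewrite lt_min => /andP[/(h1 _ t'T) a1 /(h2 _ t'T) a2].
have Hx := (HsB (x1 t' t'T) (x1 t tT)).1; have Hy := (HsB (y1 t' t'T) (y1 t tT)).1.
have [_ E] := HsB Hx Hy.
have -> : (x - y) t' - (x - y) t = (x t' - x t) - (y t' - y t).
  exact: addrBB.
rewrite -(@ltr_pXn2r _ 2)// ?nnegrE ?Hs_norm_ge0 ?(ltW e0)//.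
apply: le_lt_trans E _.
have n1 := Hs_norm_ge0 s (x t' - x t); have n2 := Hs_norm_ge0 s (y t' - y t).
nra.
Qed.

(** By compactness of the time interval, the supremum that defines [CHs_norm] is over
  a bounded set. *)
Lemma CHs_bounded s T (x : R -> dist R) : CHs s T x ->
  forall t, 0 <= t <= T -> Hs_norm s (x t) <= CHs_norm s T x.
Proof.
move=> [x1 x2] t tT.
have loc : \forall M \near +oo,
    `[0, T] `<=` [set t' | 0 <= t' <= T -> Hs_norm s (x t') <= M].
  have /compact_near_coveringP := @segment_compact R 0 T.
  apply => t0 /= t0T; rewrite in_itv /= in t0T.
  have [d d0 h] := x2 t0 t0T 1 ltr01.
  pose M0 := 2 * (1 + Hs_norm s (x t0) ^+ 2) + 1.
  exists (ball t0 d, [set M | M0 < M]).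
    split; first exact: nbhsx_ballx.
    by exists M0; split => //; exact: num_real.
  move=> [t' M] /= [t'd MM] t'T.
  have hd : `|t' - t0| < d by rewrite distrC.
  have {}h := h t' t'T hd.
  have Hd := (HsB (x1 t' t'T) (x1 t0 t0T)).1.
  have [_] := Hs_lin 1 Hd (x1 t0 t0T).
  rewrite scale1r subrK expr1n mul1r => E.
  have n0 := Hs_norm_ge0 s (x t' - x t0); have n1 := Hs_norm_ge0 s (x t').
  have n2 := Hs_norm_ge0 s (x t0).
  have sq : Hs_norm s (x t') ^+ 2 <= M0.
    by apply: le_trans E _; rewrite /M0; nra.
  have M01 : 1 <= M0 by rewrite /M0; nra.
  apply: le_trans _ (ltW MM); nra.
have [M HM] : exists M, ubound [set Hs_norm s (x t) | t in `[0, T]] M.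
  case: loc => M [_ HM]; exists (M + 1) => _ [t' t'T <-].
  apply: (HM (M + 1) _ t') => //; by rewrite ltrDl.
apply: ub_le_sup; first by exists M.
by exists t => //=; rewrite in_itv.
Qed.

(** Distributions are observed through these scalar functionals, which see only
  frequencies in [[a, b]]; the factor [lam] selects the phase of interest. *)
Definition window (a b : R) (lam : R[i]) (w : dist R) : R :=
  Re (lam * Cintegral (fun xi => (\1_(`[a, b]) xi)%:C * fhat w xi)).

Lemma indic_01 (A : set R) x : 0 <= (\1_A x : R) <= 1.
Proof. by rewrite indicE; case: (_ \in _); rewrite ?ler01 ?lexx. Qed.

Lemma Rint_indic (a b : R) : a <= b -> \int[mu]_x \1_(`[a, b]) x = b - a.
Proof.
move=> ab; rewrite /Rintegral integral_indic//= setIT lebesgue_measure_itv /= lte_fin.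
by case: ltgtP ab => //= ->; rewrite subrr.
Qed.

(** With [kappa = X / (2 A)]: a family of arithmetic-geometric bounds contains the
  Cauchy-Schwarz inequality. *)
Lemma optimize_bound (X A B : R) : 0 <= X -> 0 <= A -> 0 <= B ->
  (forall kappa, 0 < kappa -> X <= kappa * A + B / kappa) -> X ^+ 2 <= 4 * (A * B).
Proof.
rewrite le_eqVlt => /predU1P[<- A0 B0 _|X0]; first by rewrite expr0n mulr_ge0// mulr_ge0.
rewrite le_eqVlt => /predU1P[<- B0 H|A0 B0 H].
  have k0 : 0 < (2 * B + 1) / X by rewrite divr_gt0// ltr_wpDl// mulr_ge0.
  have := H _ k0; rewrite mulr0 add0r invf_div [B * (_ / _)]mulrA ler_pdivlMr; last first.
    by rewrite ltr_wpDl// mulr_ge0.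
  nra.
have k0 : 0 < X / (2 * A) by rewrite divr_gt0// mulr_gt0.
have := H _ k0; rewrite invf_div.
have -> : X / (2 * A) * A = X / 2 by field; rewrite gt_eqF.
rewrite mulrA => h.
have {}h : X / 2 <= B * (2 * A) / X by lra.
by move: h; rewrite ler_pdivlMr// expr2; nra.
Qed.

Section window_bound.
Variables (s a b c : R) (lam : R[i]).
Hypotheses (ab : a <= b) (c0 : 0 < c) (lam2 : n1 lam <= 2).
Hypothesis wc : forall xi, a <= xi <= b -> c <= weight s xi.

Let window_pointwise (w : dist R) (kappa xi : R) : 0 < kappa ->
  n1 ((\1_(`[a, b]) xi)%:C * fhat w xi) <=
  kappa / c * (weight s xi * sqnorm (fhat w xi)) + 2^-1 / kappa * \1_(`[a, b]) xi.
Proof.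
move=> k0; have d0 := density_ge0 s (fhat w xi) xi.
rewrite n1Zl indicE; have [ixi|_] := boolP (xi \in _); last first.
  by rewrite normr0 mul0r mulr0 addr0 mulr_ge0// ltW// divr_gt0.
rewrite normr1 mul1r mulr1.
have /wc W : a <= xi <= b by move: ixi; rewrite inE /= in_itv.
have S := n1_sqnorm (fhat w xi); have S0 := sqnorm_ge0 (fhat w xi).
have n0 := n1_ge0 (fhat w xi); set n := n1 _ in S n0 *; set q := sqnorm _ in S S0 *.
have h1 : q * kappa <= kappa / c * (weight s xi * q).
  have -> : kappa / c * (weight s xi * q) = (weight s xi / c) * (q * kappa) by ring.
  by rewrite ler_peMl ?mulr_ge0 ?(ltW k0)// ler_pdivlMr// mul1r.
have h2 : n <= q * kappa + 2^-1 / kappa.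
  have h3 : n * kappa <= q * kappa ^+ 2 + 2^-1.
    have : 0 <= (n * kappa - 1) ^+ 2 by exact: sqr_ge0.
    have : n ^+ 2 * kappa ^+ 2 <= 2 * q * kappa ^+ 2 by rewrite ler_wpM2r// sqr_ge0.
    nra.
  rewrite -(ler_pM2r k0); apply: le_trans h3 _; rewrite le_eqVlt; apply/orP; left.
  by apply/eqP; field; rewrite gt_eqF.
lra.
Qed.

Lemma Cintegrable_window (w : dist R) : Hs s w ->
  Cintegrable (fun xi => (\1_(`[a, b]) xi)%:C * fhat w xi).
Proof.
move=> /HsP[hw iw]; have [mw _] := fhatP hw.
apply: (Cintegrable_dom _ (intgD (intgZl (1 / c) iw) (intgZl (2^-1 / 1) (@intg_indic _ a b)))).
  by apply: cmeasM => //; apply: cmeas_real; exact: measurable_indic_itv.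
by move=> xi; exact: window_pointwise.
Qed.

Lemma window_lin (r : R) (w w' : dist R) : Hs s w -> Hs s w' ->
  window a b lam (r *: w + w') = r * window a b lam w + window a b lam w'.
Proof.
move=> Hw Hw'; have I := Cintegrable_window Hw; have I' := Cintegrable_window Hw'.
have [/HsP[h _] _] := Hs_lin r Hw Hw'.
move/HsP: Hw => [hw iw]; move/HsP: Hw' => [hw' iw'].
have F := is_fourier_lin r (fhatP hw) (fhatP hw').
have [m1 _] := F; have [m2 _] := fhatP h.
have mi : cmeas (fun xi : R => (\1_(`[a, b]) xi)%:C : R[i]).
  by apply: cmeas_real; exact: measurable_indic_itv.
rewrite /window (@CI_ae_eq _ _ (fun xi => r%:C * ((\1_(`[a, b]) xi)%:C * fhat w xi) +
   (\1_(`[a, b]) xi)%:C * fhat w' xi)); last 3 first.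
- exact: cmeasM.
- apply: cmeasD; last by apply: cmeasM => //; have [] := fhatP hw'.
  by apply: cmeasM; [exact: cmeas_cst|apply: cmeasM => //; have [] := fhatP hw].
- by apply: ae_imp (fhat_ae F) => xi ->; rewrite mulrDr mulrCA.
have I1 := CintegrableZ r%:C I.
by rewrite (CID I1 I') (CIZ _ I) mulrDr mulrCA cReD [Re (r%:C * _)]cReM /= mul0r subr0.
Qed.

(** Cauchy-Schwarz on the window, in the form of an optimised weighted
  arithmetic-geometric inequality. *)
Lemma window_bound (w : dist R) : Hs s w ->
  `|window a b lam w| <= Num.sqrt (8 * (b - a) / c) * Hs_norm s w.
Proof.
move=> Hw; have I := Cintegrable_window Hw; move/HsP: (Hw) => [hw iw].
pose X := \int[mu]_xi n1 ((\1_(`[a, b]) xi)%:C * fhat w xi).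
have X0 : 0 <= X by apply: Rintegral_ge0 => xi _; exact: n1_ge0.
have bma : 0 <= b - a by rewrite subr_ge0.
have XX : X ^+ 2 <= 4 * ((Hs_norm s w ^+ 2 / c) * (2^-1 * (b - a))).
  apply: optimize_bound => //.
  - by rewrite divr_ge0 ?sqr_ge0// ltW.
  - by rewrite mulr_ge0.
  move=> kappa k0; rewrite Hs_norm_sqr.
  have -> : kappa * (\int[mu]_xi (weight s xi * sqnorm (fhat w xi)) / c) + 2^-1 * (b - a) / kappa =
    \int[mu]_xi (kappa / c * (weight s xi * sqnorm (fhat w xi)) + 2^-1 / kappa * \1_(`[a, b]) xi).
    rewrite RintegralD//; [|exact: intgZl|by apply: intgZl; exact: intg_indic].
    rewrite !RintegralZl//; last exact: intg_indic.
    by rewrite Rint_indic//; ring.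
  apply: le_Rintegral => //; first exact: intg_n1.
    by apply: intgD; apply: intgZl => //; exact: intg_indic.
  by move=> xi _; exact: window_pointwise.
have n0 := Hs_norm_ge0 s w.
have W : `|window a b lam w| <= 2 * X.
  by apply: (le_trans (Re_n1 _)); apply: n1M_le => //; exact: n1_CI.
have K0 : 0 <= 8 * (b - a) / c by rewrite divr_ge0 ?mulr_ge0// ltW.
apply: le_trans W _; rewrite -(@ler_pXn2r _ 2)// ?nnegrE ?mulr_ge0 ?sqrtr_ge0//.
rewrite exprMn [in leRHS]exprMn sqr_sqrtr//.
apply: (@le_trans _ _ (4 * (4 * ((Hs_norm s w ^+ 2 / c) * (2^-1 * (b - a)))))).
  by rewrite -natrX ler_wpM2l.
by rewrite le_eqVlt; apply/orP; left; apply/eqP; field; rewrite gt_eqF.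
Qed.

End window_bound.

End sobolev.

(** * The Duhamel term in a weighted space of analytic functions *)

Lemma indic_itvE (R : realType) (a b x : R) : \1_(`[a, b]) x = (a <= x <= b)%R%:R :> R.
Proof.
rewrite indicE; congr (_%:R); congr nat_of_bool.
by apply/idP/idP; rewrite inE /= in_itv.
Qed.

Section duhamel.
Context {R : realType}.
Notation mu := (@lebesgue_measure R).
Notation Re := complex.Re.
Notation Im := complex.Im.
Variables (T : R) (p : R -> R).
Hypothesis T0 : 0 <= T.
Hypothesis mp : measurable_fun setT p.
Hypothesis p0 : forall xi, 0 <= p xi.
Implicit Types (u v : R * R -> R[i]) (t tau xi eta c d : R).

(** Clamping lets functions on the strip [[0, T]] be total functions of time that keep
  their bounds. *)
Definition clamp t : R := Num.max 0 (Num.min t T).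

Lemma clamp_itv t : 0 <= clamp t <= T.
Proof. by rewrite /clamp le_max lexx /= ge_max T0 /= ge_min lexx orbT. Qed.
Lemma clamp_ge0 t : 0 <= clamp t. Proof. by case/andP: (clamp_itv t). Qed.
Lemma clamp_leT t : clamp t <= T. Proof. by case/andP: (clamp_itv t). Qed.
Lemma clamp_id t : 0 <= t <= T -> clamp t = t.
Proof. by move=> /andP[t0 tT]; rewrite /clamp min_l// max_r. Qed.
Lemma measurable_clamp : measurable_fun setT clamp.
Proof. by apply: measurable_maxr => //; exact: measurable_minr. Qed.

(** The strip width shrinks linearly in time: the loss of one derivative in the
  quadratic term is paid for by the time derivative of this weight. *)
Definition strip t xi : R := expR (- ((T + 1 - clamp t) * `|xi|)).
Definition W t xi : R := strip t xi * lorentz xi.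

Lemma strip_gt0 t xi : 0 < strip t xi. Proof. exact: expR_gt0. Qed.
Lemma strip_le1 t xi : strip t xi <= 1.
Proof.
rewrite -expR0 ler_expR oppr_le0 mulr_ge0//.
by rewrite -addrA [1 - _]addrC addrA addr_ge0// subr_ge0 clamp_leT.
Qed.
Lemma W_gt0 t xi : 0 < W t xi. Proof. by rewrite mulr_gt0 ?strip_gt0 ?lorentz_gt0. Qed.
Lemma W_ge0 t xi : 0 <= W t xi. Proof. exact/ltW/W_gt0. Qed.
Lemma W_lorentz t xi : W t xi <= lorentz xi.
Proof. by rewrite ler_piMl ?strip_le1// ltW// lorentz_gt0. Qed.
Lemma strip_mono t tau xi : clamp tau <= clamp t -> strip tau xi <= strip t xi.
Proof.
by move=> h; rewrite ler_expR lerN2 ler_wpM2r// lerD2l lerN2.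
Qed.
Lemma stripD t xi eta : strip t eta * strip t (xi - eta) <= strip t xi.
Proof.
rewrite -expRD ler_expR -opprD lerN2 -mulrDr ler_wpM2l//.
  by rewrite -addrA [1 - _]addrC addrA addr_ge0// subr_ge0 clamp_leT.
by apply: le_trans (ler_normD _ _); rewrite addrC subrK.
Qed.

(** A submultiplicativity that makes the weighted space an algebra under
  convolution. *)
Lemma lorentzD xi eta : lorentz eta * lorentz (xi - eta) <=
  2 * (lorentz xi * (lorentz eta + lorentz (xi - eta))).
Proof.
have a := oneD_sqr_gt0 eta; have b := oneD_sqr_gt0 (xi - eta).
have c := oneD_sqr_gt0 xi.
have h : 1 + xi ^+ 2 <= 2 * (1 + eta ^+ 2 + (1 + (xi - eta) ^+ 2)).
  have := sqr_ge0 (eta - (xi - eta)); nra.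
have -> : 2 * (lorentz xi * (lorentz eta + lorentz (xi - eta))) =
   2 * (1 + eta ^+ 2 + (1 + (xi - eta) ^+ 2)) / (1 + xi ^+ 2) * (lorentz eta * lorentz (xi - eta)).
  by rewrite /lorentz; field; rewrite !gt_eqF.
rewrite ler_peMl//; first by rewrite mulr_ge0// ltW// lorentz_gt0.
by rewrite ler_pdivlMr// mul1r.
Qed.

(** The ball of radius [c] in the weighted space where the equation is solved. *)
Definition bnd c u : Prop := forall t xi, n1 (u (t, xi)) <= c * W t xi.

Lemma bnd_ge0 c u : bnd c u -> 0 <= c.
Proof.
move=> /(_ 0 0) h; have := le_trans (n1_ge0 _) h; by rewrite pmulr_lge0// W_gt0.
Qed.
Lemma bndD c d u v : bnd c u -> bnd d v -> bnd (c + d) (fun z => u z + v z).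
Proof.
move=> hu hv t xi; rewrite mulrDl; apply: (le_trans (n1D _ _)); exact: lerD.
Qed.
Lemma bndW c d u : c <= d -> bnd c u -> bnd d u.
Proof. by move=> cd h t xi; apply: (le_trans (h t xi)); rewrite ler_wpM2r ?W_ge0. Qed.
Lemma bndZ (x : R) c u : bnd c u -> bnd (`|x| * c) (fun z => x%:C * u z).
Proof. by move=> h t xi; rewrite n1Zl -mulrA ler_wpM2l. Qed.

Definition conv u v (z : R * R) : R[i] :=
  Cintegral (fun eta => u (z.1, eta) * v (z.1, z.2 - eta)).

Definition lorentz_mass : R := \int[mu]_x lorentz x.

Lemma lorentz_mass_ge0 : 0 <= lorentz_mass.
Proof. by apply: Rintegral_ge0 => x _; rewrite ltW// lorentz_gt0. Qed.

Let dom c d t xi eta : R :=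
  (c * d * (strip t xi * (2 * lorentz xi))) * (lorentz eta + lorentz (xi - eta)).

Let intg_dom_conv c d t xi : intg (dom c d t xi).
Proof. by apply: intgZl; apply: intgD; [exact: intg_lorentz|exact: intg_reflect intg_lorentz]. Qed.

Lemma conv_pointwise c d u v t xi eta : bnd c u -> bnd d v ->
  n1 (u (t, eta) * v (t, xi - eta)) <= dom c d t xi eta.
Proof.
move=> hu hv; have c0 := bnd_ge0 hu; have d0 := bnd_ge0 hv.
apply: (le_trans (n1M_le (hu _ _) (hv _ _))).
have -> : c * W t eta * (d * W t (xi - eta)) =
  (c * d) * ((strip t eta * strip t (xi - eta)) * (lorentz eta * lorentz (xi - eta))).
  by rewrite /W; ring.
rewrite /dom -[leRHS]mulrA ler_wpM2l ?mulr_ge0// -[leRHS]mulrA.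
have -> : 2 * lorentz xi * (lorentz eta + lorentz (xi - eta)) =
   2 * (lorentz xi * (lorentz eta + lorentz (xi - eta))) by ring.
apply: ler_pM; [by rewrite mulr_ge0// ltW// strip_gt0| |exact: stripD|exact: lorentzD].
by rewrite mulr_ge0// ltW// lorentz_gt0.
Qed.

Lemma cmeas_conv_integrand u v : cmeas u -> cmeas v ->
  cmeas (fun z : (R * R) * R => u (z.1.1, z.2) * v (z.1.1, z.1.2 - z.2)).
Proof.
have m11 : measurable_fun setT (fun z : (R * R) * R => z.1.1).
  exact: (measurableT_comp measurable_fst measurable_fst).
have m12 : measurable_fun setT (fun z : (R * R) * R => z.1.2).
  exact: (measurableT_comp measurable_snd measurable_fst).
move=> mu_ mv_; apply: cmeasM.
  apply: (@cmeas_comp _ _ _ _ _ u (fun z : (R * R) * R => (z.1.1, z.2)) mu_).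
  by apply/measurable_fun_pairP; split => //=; exact: measurable_snd.
apply: (@cmeas_comp _ _ _ _ _ v (fun z : (R * R) * R => (z.1.1, z.1.2 - z.2)) mv_).
apply/measurable_fun_pairP; split => //=.
by apply: measurable_funB => //; exact: measurable_snd.
Qed.

Lemma cmeas_conv u v : cmeas u -> cmeas v -> cmeas (conv u v).
Proof.
move=> mu_ mv_; exact: (cmeas_CI_param (cmeas_conv_integrand mu_ mv_)).
Qed.

Lemma cmeas_conv1 u v t xi : cmeas u -> cmeas v ->
  cmeas (fun eta : R => u (t, eta) * v (t, xi - eta)).
Proof.
move=> mu_ mv_.
apply: (@cmeas_comp _ _ _ _ _ _ (fun eta : R => ((t, xi), eta)) (cmeas_conv_integrand mu_ mv_)).
exact: measurable_pair1.
Qed.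

Lemma Cintegrable_conv c d u v t xi : cmeas u -> cmeas v -> bnd c u -> bnd d v ->
  Cintegrable (fun eta => u (t, eta) * v (t, xi - eta)).
Proof.
move=> mu_ mv_ hu hv; apply: (Cintegrable_dom _ (intg_dom_conv c d t xi)).
  exact: cmeas_conv1.
by move=> eta; exact: conv_pointwise.
Qed.

(** The strip weight is submultiplicative, and [lorentzD] distributes the algebraic
  weight, so that the weighted space is stable under convolution. *)
Lemma conv_bnd c d u v : cmeas u -> cmeas v -> bnd c u -> bnd d v ->
  bnd (4 * lorentz_mass * (c * d)) (conv u v).
Proof.
move=> mu_ mv_ hu hv t xi.
apply: (le_trans (n1_CI_dom (cmeas_conv1 t xi mu_ mv_) (intg_dom_conv c d t xi) _)).
  by move=> eta; exact: conv_pointwise.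
rewrite /dom RintegralZl//; last first.
  by apply: intgD; [exact: intg_lorentz|exact: intg_reflect intg_lorentz].
rewrite RintegralD//; [|exact: intg_lorentz|exact: intg_reflect intg_lorentz].
rewrite (Rint_reflect xi intg_lorentz) -/lorentz_mass le_eqVlt; apply/orP; left.
by apply/eqP; rewrite /W; ring.
Qed.

Lemma convBl c d e u1 u2 v : cmeas u1 -> cmeas u2 -> cmeas v -> bnd c u1 -> bnd d u2 ->
  bnd e v -> conv (fun z => u1 z - u2 z) v =1 (fun z => conv u1 v z - conv u2 v z).
Proof.
move=> m1 m2 m3 b1 b2 b3 [t xi]; rewrite /conv -CIB.
- by apply: eq_CI => eta; rewrite mulrBl.
- exact: Cintegrable_conv b1 b3.
- exact: Cintegrable_conv b2 b3.
Qed.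
Lemma convBr c d e u1 u2 v : cmeas u1 -> cmeas u2 -> cmeas v -> bnd c u1 -> bnd d u2 ->
  bnd e v -> conv v (fun z => u1 z - u2 z) =1 (fun z => conv v u1 z - conv v u2 z).
Proof.
move=> m1 m2 m3 b1 b2 b3 [t xi]; rewrite /conv -CIB.
- by apply: eq_CI => eta; rewrite mulrBr.
- exact: Cintegrable_conv b3 b1.
- exact: Cintegrable_conv b3 b2.
Qed.
Lemma convZ (x : R) c u : cmeas u -> bnd c u ->
  conv (fun z => x%:C * u z) (fun z => x%:C * u z) =1 (fun z => (x ^+ 2)%:C * conv u u z).
Proof.
move=> m1 b1 [t xi]; rewrite /conv -CIZ; last exact: (Cintegrable_conv _ _ m1 m1 b1 b1).
by apply: eq_CI => eta; rewrite expr2 real_complexM; ring.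
Qed.

(** The semigroup of the linear equation on the Fourier side. *)
Definition prop t xi : R[i] := (expR (- (t * p xi)))%:C * expi (- (t * (xi * `|xi|))).

Lemma propD t tau xi : prop (t + tau) xi = prop t xi * prop tau xi.
Proof.
rewrite /prop mulrACA -real_complexM -expRD -expiD !mulrDl !opprD; reflexivity.
Qed.
Lemma prop0 xi : prop 0 xi = 1.
Proof. by rewrite /prop !mul0r oppr0 expR0 expi0 mul1r. Qed.
Lemma n1_prop t xi : 0 <= t -> n1 (prop t xi) <= 2.
Proof.
move=> t0; rewrite /prop n1Zl ger0_norm ?expR_ge0//.
apply: (@le_trans _ _ (1 * 2)); last by rewrite mul1r.
apply: ler_pM; rewrite ?expR_ge0 ?n1_ge0 ?n1_expi//.
by rewrite -expR0 ler_expR oppr_le0 mulr_ge0.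
Qed.
Lemma cmeas_prop : cmeas (fun z : R * R => prop z.1 z.2).
Proof.
apply: cmeasM.
  apply: cmeas_real; apply: measurableT_comp => //; apply: measurableT_comp => //.
  apply: measurable_funM; first exact: measurable_fst.
  exact: (measurableT_comp mp measurable_snd).
apply: cmeas_expi; apply: measurableT_comp => //.
apply: measurable_funM; first exact: measurable_fst.
apply: measurable_funM; first exact: measurable_snd.
by apply: measurableT_comp => //; exact: measurable_snd.
Qed.

Definition duh_integrand (f : R * R -> R[i]) t xi tau : R[i] :=
  if 0 <= tau <= clamp t then prop (clamp t - tau) xi * f (tau, xi) else 0.

(** Duhamel integral of [- d_x (f / 2)], where [f] is the Fourier transform of
  a product up to the factor [2 pi] of the convolution theorem. *)
Definition duhamel (f : R * R -> R[i]) (z : R * R) : R[i] :=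
  (0 -i* (z.2 / (4 * pi))) * Cintegral (duh_integrand f z.1 z.2).

Lemma cmeas_duh_integrand f : cmeas f ->
  cmeas (fun z : (R * R) * R => duh_integrand f z.1.1 z.1.2 z.2).
Proof.
move=> mf.
have m11 : measurable_fun setT (fun z : (R * R) * R => clamp z.1.1).
  apply: (measurableT_comp measurable_clamp).
  exact: (measurableT_comp measurable_fst measurable_fst).
have m12 : measurable_fun setT (fun z : (R * R) * R => z.1.2).
  exact: (measurableT_comp measurable_snd measurable_fst).
have m2 : measurable_fun setT (fun z : (R * R) * R => z.2) by exact: measurable_snd.
apply: (@cmeas_if _ _ _ (fun z : (R * R) * R => 0 <= z.2 <= clamp z.1.1)).
  rewrite (_ : [set z | _] = (fun z : (R * R) * R => (0 <= z.2) && (z.2 <= clamp z.1.1)) @^-1` [set true]).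
    rewrite -[X in measurable X]setTI.
    by apply: measurable_and => //; exact: measurable_fun_ler.
  by apply/seteqP; split.
apply: cmeasM.
  apply: (@cmeas_comp _ _ _ _ _ _ (fun z : (R * R) * R => (clamp z.1.1 - z.2, z.1.2)) cmeas_prop).
  by apply/measurable_fun_pairP; split => //=; exact: measurable_funB.
apply: (@cmeas_comp _ _ _ _ _ f (fun z : (R * R) * R => (z.2, z.1.2)) mf).
by apply/measurable_fun_pairP; split.
Qed.

Lemma cmeas_duhamel f : cmeas f -> cmeas (duhamel f).
Proof.
move=> mf; apply: cmeasM; last exact: (cmeas_CI_param (cmeas_duh_integrand mf)).
split => /=; first exact: measurable_cst.
by apply: measurableT_comp => //; apply: measurable_funM => //; exact: measurable_snd.
Qed.

Lemma cmeas_duh_integrand1 f t xi : cmeas f -> cmeas (duh_integrand f t xi).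
Proof.
move=> mf; apply: (@cmeas_comp _ _ _ _ _ _ (fun tau : R => ((t, xi), tau)) (cmeas_duh_integrand mf)).
exact: measurable_pair1.
Qed.

Let time_dom c t xi tau : R := 2 * c * lorentz xi * (strip tau xi * \1_(`[0, clamp t]) tau).

Let intg_strip t xi : intg (fun tau => strip tau xi * \1_(`[0, clamp t]) tau).
Proof.
apply: (intg_dom _ (@intg_indic _ 0 (clamp t))).
  apply: measurable_funM; last exact: measurable_indic_itv.
  apply: measurableT_comp => //; apply: measurableT_comp => //.
  apply: measurable_funM => //; apply: measurable_funB => //; exact: measurable_clamp.
move=> tau; have /andP[i0 _] := indic_01 `[0, clamp t] tau.
by rewrite ger0_norm ?mulr_ge0 ?(ltW (strip_gt0 _ _))// ler_piMl ?strip_le1.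
Qed.

Lemma duh_pointwise c f t xi tau : bnd c f ->
  n1 (duh_integrand f t xi tau) <= time_dom c t xi tau.
Proof.
move=> hf; have c0 := bnd_ge0 hf; rewrite /duh_integrand /time_dom indic_itvE.
case: ifP => [/andP[t0 tt]|_]; last by rewrite n10 !mulr0.
rewrite mulr1 -mulrA -mulrA; apply: n1M_le; first by rewrite n1_prop// subr_ge0.
by apply: le_trans (hf _ _) _; rewrite /W [lorentz _ * _]mulrC.
Qed.

(** The derivative is absorbed by the shrinking of the strip:
  the time integral of [|xi| exp (- (T + 1 - tau) |xi|)] is an exponential. *)
Lemma strip_absorbs t xi :
  `|xi| * \int[mu]_tau (strip tau xi * \1_(`[0, clamp t]) tau) <= strip t xi.
Proof.
pose F tau := expR (- ((T + 1 - tau) * `|xi|)).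
have dF tau : is_derive tau 1 F (`|xi| * F tau).
  have h := dN (dM (dB (dcst (T + 1) tau) (did tau)) (dcst `|xi| tau)).
  by apply: (deq (dexp h)); rewrite /F; ring.
have cF : continuous F by exact: (derive_continuous dF).
rewrite -RintegralZl//; last exact: intg_strip.
rewrite (eq_Rint (g := (fun tau => `|xi| * F tau) \_ `[0, clamp t])); last first.
  move=> tau; rewrite patchE indic_itvE; have -> : (tau \in `[0, clamp t]%classic) = (0 <= tau <= clamp t).
    by apply/idP/idP; rewrite inE /= in_itv.
  case: ifP => [/andP[h0 h1]|_]; last by rewrite !mulr0.
  by rewrite mulr1 /strip clamp_id// h0 (le_trans h1)// clamp_leT.
rewrite -Rintegral_mkcond (FTC2 (F := F))//; last 2 first.
- exact: clamp_ge0.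
- by move=> tau; apply: cvgM; [exact: cvg_cst|exact: cF].
by rewrite lerBlDr lerDl expR_ge0.
Qed.

Lemma duh_cintegrable c f t xi : cmeas f -> bnd c f -> Cintegrable (duh_integrand f t xi).
Proof.
move=> mf hf; apply: (Cintegrable_dom _ (intgZl (2 * c * lorentz xi) (intg_strip t xi))).
  exact: cmeas_duh_integrand1.
by move=> tau; exact: duh_pointwise.
Qed.

(** The factor [xi] of the derivative is absorbed by the time integral of the weight,
  so the quadratic term loses no derivative in this scale. *)
Lemma duhamel_bnd c f : cmeas f -> bnd c f -> bnd c (duhamel f).
Proof.
move=> mf hf t xi; have c0 := bnd_ge0 hf.
have pi1 : 1 <= pi :> R by have := pi_ge2 R; lra.
have pi4 : 0 < 4 * pi :> R by rewrite mulr_gt0// pi_gt0.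
have E : n1 (0 -i* (xi / (4 * pi))) = `|xi| / (4 * pi).
  by rewrite /n1 /= normr0 add0r normrN normrM normfV [`|4 * pi|]gtr0_norm.
apply: (le_trans (n1M _ _)); rewrite E.
have H : n1 (Cintegral (duh_integrand f t xi)) <=
   2 * c * lorentz xi * \int[mu]_tau (strip tau xi * \1_(`[0, clamp t]) tau).
  rewrite -RintegralZl//; last exact: intg_strip.
  apply: (n1_CI_dom (A := time_dom c t xi)).
  - exact: cmeas_duh_integrand1.
  - exact: (intgZl (2 * c * lorentz xi) (intg_strip t xi)).
  - by move=> tau; exact: duh_pointwise.
have a0 : 0 <= `|xi| / (4 * pi) by rewrite divr_ge0// ltW.
apply: (le_trans (ler_wpM2l a0 H)).
have -> : `|xi| / (4 * pi) * (2 * c * lorentz xi * \int[mu]_tau (strip tau xi * \1_(`[0, clamp t]) tau)) =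
  (c * lorentz xi / (2 * pi)) * (`|xi| * \int[mu]_tau (strip tau xi * \1_(`[0, clamp t]) tau)).
  have pin : pi != 0 :> R by rewrite gt_eqF// pi_gt0.
  by move: (pi : R) pin => P Pn; field.
have l0 := lorentz_gt0 xi.
have b0 : 0 <= c * lorentz xi / (2 * pi) by rewrite divr_ge0 ?mulr_ge0 ?(ltW l0) ?pi_ge0.
apply: (le_trans (ler_wpM2l b0 (strip_absorbs t xi))).
rewrite /W [strip t xi * _]mulrC mulrA ler_wpM2r ?(ltW (strip_gt0 _ _))//.
by rewrite ler_piMr ?mulr_ge0 ?(ltW l0)// invf_le1; lra.
Qed.

Lemma duhamelB c d f g : cmeas f -> cmeas g -> bnd c f -> bnd d g ->
  duhamel (fun z => f z - g z) =1 (fun z => duhamel f z - duhamel g z).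
Proof.
move=> mf mg hf hg [t xi]; rewrite /duhamel -mulrBr -CIB.
- congr (_ * _); apply: eq_CI => tau; rewrite /duh_integrand.
  by case: ifP => _; rewrite ?subr0// mulrBr.
- exact: (duh_cintegrable _ _ mf hf).
- exact: (duh_cintegrable _ _ mg hg).
Qed.
Lemma duhamelZ (x : R) c f : cmeas f -> bnd c f ->
  duhamel (fun z => x%:C * f z) =1 (fun z => x%:C * duhamel f z).
Proof.
move=> mf hf [t xi]; rewrite /duhamel mulrCA -(CIZ x%:C (duh_cintegrable t xi mf hf)).
congr (_ * _); apply: eq_CI => tau; rewrite /duh_integrand.
by case: ifP => _; rewrite ?mulr0// mulrCA.
Qed.

(** The quadratic term of the integral equation. *)
Definition quad u : R * R -> R[i] := duhamel (conv u u).

(** The constant of the algebra property [conv_bnd]. *)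
Definition K : R := 4 * lorentz_mass.
Lemma K_ge0 : 0 <= K. Proof. by rewrite mulr_ge0// lorentz_mass_ge0. Qed.

Lemma cmeas_quad u : cmeas u -> cmeas (quad u).
Proof. by move=> mu_; apply: cmeas_duhamel; exact: cmeas_conv. Qed.

Lemma quad_bnd c u : cmeas u -> bnd c u -> bnd (K * c ^+ 2) (quad u).
Proof.
by move=> mu_ hu; apply: duhamel_bnd; [exact: cmeas_conv|exact: conv_bnd].
Qed.

Lemma quadB_bnd c d u v : cmeas u -> cmeas v -> bnd c u -> bnd c v ->
  bnd d (fun z => u z - v z) ->
  bnd (K * (2 * c) * d) (fun z => quad u z - quad v z).
Proof.
move=> mu_ mv_ hu hv huv.
pose w z := u z - v z.
have mw : cmeas w by exact: cmeasB.
have m1 := cmeas_conv mw mu_; have m2 := cmeas_conv mv_ mw.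
have b1 := conv_bnd mw mu_ huv hu; have b2 := conv_bnd mv_ mw hv huv.
have e1 : conv w u =1 (fun z => conv u u z - conv v u z) by exact: (convBl mu_ mv_ mu_ hu hv hu).
have e2 : conv v w =1 (fun z => conv v u z - conv v v z) by exact: (convBr mu_ mv_ mv_ hu hv hv).
have e z : conv u u z - conv v v z = conv w u z + conv v w z.
  by rewrite e1 e2 addrA subrK.
have B := duhamelB (cmeas_conv mu_ mu_) (cmeas_conv mv_ mv_) (conv_bnd mu_ mu_ hu hu) (conv_bnd mv_ mv_ hv hv).
move=> t xi; rewrite /quad -(B (t, xi)).
have -> : (fun z => conv u u z - conv v v z) = (fun z => conv w u z + conv v w z) by exact: funext e.
have mD : cmeas (fun z => conv w u z + conv v w z) by exact: cmeasD.
apply: le_trans (duhamel_bnd mD (bndD b1 b2) t xi) _.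
by rewrite le_eqVlt; apply/orP; left; apply/eqP; rewrite /K; ring.
Qed.

Lemma quadZ (x : R) c u : cmeas u -> bnd c u ->
  quad (fun z => x%:C * u z) =1 (fun z => (x ^+ 2)%:C * quad u z).
Proof.
move=> mu_ hu z; rewrite /quad (funext (convZ x mu_ hu)).
exact: (duhamelZ (x ^+ 2) (cmeas_conv mu_ mu_) (conv_bnd mu_ mu_ hu hu)).
Qed.

Section hermitian.
Hypothesis p_even : forall xi, p (- xi) = p xi.

Definition hermitian u : Prop := forall t xi, u (t, - xi) = cj (u (t, xi)).

Lemma prop_cj t xi : prop t (- xi) = cj (prop t xi).
Proof. by rewrite /prop cjM cj_real -expiN p_even normrN mulNr mulrN. Qed.

Lemma hermitian_conv c u : cmeas u -> bnd c u -> hermitian u -> hermitian (conv u u).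
Proof.
move=> mu_ hu H t xi; rewrite /conv /= -CI_cj; last exact: (Cintegrable_conv _ _ mu_ mu_ hu hu).
have I := Cintegrable_conv t (- xi) mu_ mu_ hu hu.
rewrite -(CI_reflect 0 I); apply: eq_CI => eta.
by rewrite cjM -!H sub0r opprK opprB addrC.
Qed.

Lemma hermitian_duhamel c f : cmeas f -> bnd c f -> hermitian f -> hermitian (duhamel f).
Proof.
move=> mf hf H t xi; rewrite /duhamel cjM /= -CI_cj; last exact: (duh_cintegrable _ _ mf hf).
congr (_ * _).
  by apply: complex_ext; rewrite /= ?mulNr ?opprK.
apply: eq_CI => tau; rewrite /duh_integrand; case: ifP => _.
  by rewrite cjM -H prop_cj.
by apply: complex_ext; rewrite /= ?oppr0.
Qed.

Lemma hermitian_quad c u : cmeas u -> bnd c u -> hermitian u -> hermitian (quad u).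
Proof.
move=> mu_ hu H.
apply: (hermitian_duhamel (cmeas_conv mu_ mu_) (conv_bnd mu_ mu_ hu hu)).
exact: (hermitian_conv mu_ hu H).
Qed.

End hermitian.

End duhamel.

(** * Sequences with geometric increments *)

Section geometric_limits.
Context {R : realType}.
Implicit Types (a : nat -> R) (C : R).

Lemma cvg_half_geometric C : C * 2^-1 ^+ n @[n --> \oo] --> (0 : R).
Proof. by apply: cvg_geometric; rewrite ger0_norm// invf_lt1 ?ltr1n. Qed.

Lemma le_half_geometric (x C : R) : (forall n : nat, x <= C * 2^-1 ^+ n) -> x <= 0.
Proof.
move=> h; rewrite -(cvg_lim (@Rhausdorff R) (cvg_half_geometric C)).
apply: limr_ge; first by apply/cvg_ex; eexists; exact: cvg_half_geometric.
by apply: nearW => n; exact: h.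
Qed.

(** The sequences [a n + e n] and [a n - e n], with [e n = 2 C / 2 ^ n], are monotone
  and squeeze the limit. *)
Lemma geometric_cvg a C : (forall n, `|a n.+1 - a n| <= C * 2^-1 ^+ n) ->
  (a n @[n --> \oo] --> limn a) /\
  (forall n, `|limn a - a n| <= 2 * C * 2^-1 ^+ n).
Proof.
move=> h.
pose e n : R := 2 * C * 2^-1 ^+ n.
have he n : e n = e n.+1 + C * 2^-1 ^+ n by rewrite /e exprS; field.
pose b n := a n + e n; pose c n := a n - e n.
have hb n : b n.+1 <= b n.
  have /ler_normlP[_ h1] := h n; rewrite /b [e n]he.
  have e1 : e n.+1 = C * 2^-1 ^+ n by rewrite /e exprS; field.
  lra.
have hc n : c n <= c n.+1.
  have /ler_normlP[h1 _] := h n; rewrite /c [e n]he.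
  have e1 : e n.+1 = C * 2^-1 ^+ n by rewrite /e exprS; field.
  lra.
have C0 : 0 <= C by have := h 0%N; rewrite expr0 mulr1; exact: le_trans (normr_ge0 _).
have e0 n : 0 <= e n by rewrite /e mulr_ge0 ?mulr_ge0// exprn_ge0// invr_ge0.
have mb : nonincreasing_seq b by apply/nonincreasing_seqP.
have mc : nondecreasing_seq c by apply/nondecreasing_seqP.
have cb : cvgn b.
  apply: nonincreasing_is_cvgn => //; exists (c 0%N) => _ [n _ <-].
  apply: (@le_trans _ _ (c n)); first exact: mc.
  by rewrite /c /b; have := e0 n; lra.
have ce : e n @[n --> \oo] --> (0 : R) by exact: cvg_half_geometric.
have la : a n @[n --> \oo] --> limn b.
  have H := cvgB cb ce; rewrite subr0 in H.
  rewrite (_ : (fun n => a n) = b - e); first exact: H.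
  by apply/funext => n; rewrite /b fctE addrK.
have lc : c n @[n --> \oo] --> limn b.
  by have H := cvgB la ce; rewrite subr0 in H; exact: H.
have el : limn a = limn b by exact: cvg_lim la.
split; first by rewrite el.
move=> n; rewrite el ler_distl; apply/andP; split.
  rewrite -[leRHS](cvg_lim (@Rhausdorff R) lc); apply: nondecreasing_cvgn_le => //.
  by apply/cvg_ex; eexists; exact: lc.
exact: nonincreasing_cvgn_ge.
Qed.

End geometric_limits.

(** * Solutions of the integral equation by Picard iteration *)

Section picard.
Context {R : realType}.
Notation mu := (@lebesgue_measure R).
Notation Re := complex.Re.
Notation Im := complex.Im.
Variables (T : R) (p : R -> R) (h : R -> R[i]) (H : R).
Hypothesis T0 : 0 <= T.
Hypothesis mp : measurable_fun setT p.
Hypothesis p0 : forall xi, 0 <= p xi.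
Hypothesis mh : cmeas h.
Hypothesis hH : forall xi, n1 (h xi) <= H * W T 0 xi.
Implicit Types (u v : R * R -> R[i]) (t tau xi eta c d x : R).

Notation bnd := (bnd T).
Notation quad := (quad T p).
Notation K := (@K R).

Lemma H_ge0 : 0 <= H.
Proof. by have := le_trans (n1_ge0 _) (hH 0); rewrite pmulr_lge0// W_gt0. Qed.

(** The solution of the linear equation with datum [h]. *)
Definition free (z : R * R) : R[i] := prop p (clamp T z.1) z.2 * h z.2.

Lemma cmeas_free : cmeas free.
Proof.
apply: cmeasM; last exact: (cmeas_comp mh measurable_snd).
apply: (@cmeas_comp _ _ _ _ _ _ (fun z : R * R => (clamp T z.1, z.2)) (cmeas_prop mp)).
apply/measurable_fun_pairP; split => /=; last exact: measurable_snd.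
exact: (measurableT_comp (measurable_clamp T) measurable_fst).
Qed.

Lemma free_bnd : bnd (2 * H) free.
Proof.
move=> t xi; rewrite -mulrA; apply: n1M_le; first by apply: n1_prop => //; exact: clamp_ge0.
apply: (le_trans (hH xi)); rewrite ler_wpM2l ?H_ge0// ler_wpM2r//.
  exact/ltW/lorentz_gt0.
by apply: strip_mono; rewrite clamp_id ?lexx// clamp_ge0.
Qed.

Definition picard_map x u (z : R * R) : R[i] := x%:C * free z + quad u z.

Fixpoint picard x (n : nat) : R * R -> R[i] :=
  if n is n'.+1 then picard_map x (picard x n') else fun=> 0.

(** Radius and threshold chosen so that the ball is stable and the map halves
  distances in it. *)
Definition radius x : R := 4 * H * `|x|.
Definition small x : Prop := K * (2 * radius x) <= 2^-1.

Lemma radius_ge0 x : 0 <= radius x. Proof. by rewrite !mulr_ge0 ?H_ge0. Qed.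

Lemma cmeas_picard_map x u : cmeas u -> cmeas (picard_map x u).
Proof.
move=> mu_; apply: cmeasD; last exact: cmeas_quad.
by apply: cmeasM; [exact: cmeas_cst|exact: cmeas_free].
Qed.

Lemma picard_map_bnd x u : small x -> cmeas u -> bnd (radius x) u ->
  bnd (radius x) (picard_map x u).
Proof.
move=> sx mu_ hu.
apply: bndW (bndD (bndZ x free_bnd) (quad_bnd T0 mp p0 mu_ hu)).
have r0 := radius_ge0 x; move: sx; rewrite /small => sx.
have -> : `|x| * (2 * H) = radius x / 2 by rewrite /radius; field.
by nra.
Qed.

Lemma picard_map_contracts x u v d : small x -> cmeas u -> cmeas v ->
  bnd (radius x) u -> bnd (radius x) v -> bnd d (fun z => u z - v z) ->
  bnd (2^-1 * d) (fun z => picard_map x u z - picard_map x v z).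
Proof.
move=> sx mu_ mv_ hu hv huv t xi; rewrite /picard_map.
have -> : x%:C * free (t, xi) + quad u (t, xi) - (x%:C * free (t, xi) + quad v (t, xi)) =
  quad u (t, xi) - quad v (t, xi) by rewrite opprD addrACA subrr add0r.
have d0 := bnd_ge0 huv.
exact: (bndW (ler_wpM2r d0 sx) (quadB_bnd T0 mp p0 mu_ mv_ hu hv huv)).
Qed.

Lemma picard_inv x n : small x -> cmeas (picard x n) /\ bnd (radius x) (picard x n).
Proof.
move=> sx; elim: n => [|n [m b]] /=.
  split; first exact: cmeas_cst.
  by move=> t xi; rewrite n10 mulr_ge0 ?radius_ge0 ?W_ge0.
by split; [exact: cmeas_picard_map|exact: picard_map_bnd].
Qed.

Lemma picard_diff x n : small x ->
  bnd (radius x * 2^-1 ^+ n) (fun z => picard x n.+1 z - picard x n z).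
Proof.
move=> sx; elim: n => [|n IH].
  have [_ b] := picard_inv 1 sx.
  by move=> t xi; rewrite expr0 mulr1 /= subr0; exact: b.
have [m1 b1] := picard_inv n.+1 sx; have [m b] := picard_inv n sx.
rewrite exprS mulrCA; exact: (picard_map_contracts sx m1 m b1 b IH).
Qed.

Definition sol x (z : R * R) : R[i] :=
  limn (fun n => Re (picard x n z)) +i* limn (fun n => Im (picard x n z)).

Lemma sol_approx x : small x -> forall z,
  [/\ Re (picard x n z) @[n --> \oo] --> Re (sol x z),
      Im (picard x n z) @[n --> \oo] --> Im (sol x z) &
      forall n, n1 (sol x z - picard x n z) <= (4 * radius x * W T z.1 z.2) * 2^-1 ^+ n].
Proof.
move=> sx [t xi].
have hd n : n1 (picard x n.+1 (t, xi) - picard x n (t, xi)) <= (radius x * W T t xi) * 2^-1 ^+ n.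
  by apply: (le_trans (picard_diff n sx t xi)); rewrite mulrAC.
have hr n : `|Re (picard x n.+1 (t, xi)) - Re (picard x n (t, xi))| <= (radius x * W T t xi) * 2^-1 ^+ n.
  by rewrite -cReN -cReD; exact: le_trans (Re_n1 _) (hd n).
have hi n : `|Im (picard x n.+1 (t, xi)) - Im (picard x n (t, xi))| <= (radius x * W T t xi) * 2^-1 ^+ n.
  by rewrite -cImN -cImD; exact: le_trans (Im_n1 _) (hd n).
have [cr er] := geometric_cvg hr; have [ci ei] := geometric_cvg hi.
split; [exact: cr|exact: ci|].
move=> n; rewrite /n1 cReD cImD cReN cImN; apply: (le_trans (lerD (er n) (ei n))).
by rewrite le_eqVlt; apply/orP; left; apply/eqP => /=; ring.
Qed.

Lemma cmeas_sol x : small x -> cmeas (sol x).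
Proof.
move=> sx; split.
  apply: (@measurable_fun_cvg _ _ _ setT (fun n z => Re (picard x n z))).
    by move=> n; have [[]] := picard_inv n sx.
  by move=> z _; have [] := sol_approx sx z.
apply: (@measurable_fun_cvg _ _ _ setT (fun n z => Im (picard x n z))).
  by move=> n; have [[]] := picard_inv n sx.
by move=> z _; have [] := sol_approx sx z.
Qed.

(** The bound of the iterates passes to the limit. *)
Lemma sol_bnd x : small x -> bnd (radius x) (sol x).
Proof.
move=> sx t xi; rewrite -subr_le0; apply: le_half_geometric => n.
have [_ _ /(_ n) e] := sol_approx sx (t, xi).
have [_ b] := picard_inv n sx; have {}b := b t xi.
have := n1D (sol x (t, xi) - picard x n (t, xi)) (picard x n (t, xi)).
rewrite subrK => h1; rewrite lerBlDr.
apply: (le_trans h1); exact: lerD e b.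
Qed.

(** The solution differs from the image of an iterate by [O(2 ^ -n)], by contraction,
  and from the next iterate by as much. *)
Lemma solE x : small x -> forall z, sol x z = x%:C * free z + quad (sol x) z.
Proof.
move=> sx z; apply/esym/eqP; rewrite -subr_eq0; apply/eqP/n1_eq0/eqP.
rewrite eq_le n1_ge0 andbT; case: z => t xi.
apply: (@le_half_geometric _ _ (4 * radius x * W T t xi)) => n.
have [_ _ ap] := sol_approx sx (t, xi).
have [m b] := picard_inv n sx.
have huv : bnd (4 * radius x * 2^-1 ^+ n) (fun z => sol x z - picard x n z).
  move=> t' xi'; have [_ _ /(_ n) e] := sol_approx sx (t', xi').
  by apply: (le_trans e); rewrite mulrAC.
have ct := picard_map_contracts sx (cmeas_sol sx) m (sol_bnd sx) b huv t xi.
have e1 := ap n.+1.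
have -> : x%:C * free (t, xi) + quad (sol x) (t, xi) - sol x (t, xi) =
    (picard_map x (sol x) (t, xi) - picard x n.+1 (t, xi)) - (sol x (t, xi) - picard x n.+1 (t, xi)).
  by rewrite opprB addrA subrK.
apply: (le_trans (n1B _ _)); apply: (le_trans (lerD ct e1)).
by rewrite le_eqVlt; apply/orP; left; apply/eqP; rewrite /= exprS; field.
Qed.

(** Feeding the integral equation into its own quadratic term: [sol x] is [x free] up
  to [O(x^2)], and the bilinear estimate turns this into an error [O(x^3)]. *)
Lemma sol_taylor x : small x ->
  bnd (64 * K ^+ 2 * H ^+ 3 * 2 * `|x| ^+ 3)
    (fun z => sol x z - (x%:C * free z + (x ^+ 2)%:C * quad free z)).
Proof.
move=> sx.
have ms := cmeas_sol sx; have bs := sol_bnd sx; have r0 := radius_ge0 x.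
have mxf : cmeas (fun z => x%:C * free z).
  by apply: cmeasM; [exact: cmeas_cst|exact: cmeas_free].
have bxf : bnd (radius x) (fun z => x%:C * free z).
  apply: bndW (bndZ x free_bnd); rewrite /radius.
  by have := H_ge0; have := normr_ge0 x; nra.
have bd : bnd (K * radius x ^+ 2) (fun z => sol x z - x%:C * free z).
  move=> t xi; rewrite (solE sx) addrAC subrr add0r.
  exact: (quad_bnd T0 mp p0 ms bs).
have B := quadB_bnd T0 mp p0 ms mxf bs bxf bd.
move=> t xi.
rewrite -(quadZ T0 mp p0 x cmeas_free free_bnd) {1}(solE sx).
rewrite opprD addrACA subrr add0r.
apply: le_trans (B t xi) _; rewrite le_eqVlt; apply/orP; left; apply/eqP.
by rewrite /radius; ring.
Qed.

Section hermitian_solution.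
Hypothesis p_even : forall xi, p (- xi) = p xi.
Hypothesis h_cj : forall xi, h (- xi) = cj (h xi).

Lemma hermitian_free : hermitian free.
Proof. by move=> t xi; rewrite /free /= prop_cj// h_cj cjM. Qed.

Lemma hermitian_picard x n : small x -> hermitian (picard x n).
Proof.
move=> sx; elim: n => [|n IH] t xi /=.
  by apply: complex_ext; rewrite /= ?oppr0.
have [m b] := picard_inv n sx.
rewrite /picard_map hermitian_free cjD cjM cj_real; congr (_ + _).
exact: (hermitian_quad T0 mp p0 p_even m b IH).
Qed.

Lemma hermitian_sol x : small x -> hermitian (sol x).
Proof.
move=> sx t xi.
have [cr ci _] := sol_approx sx (t, xi).
have hp n := hermitian_picard n sx t xi.
apply: complex_ext => /=.
  by congr (limn _); apply/funext => n; rewrite hp ReConj.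
rewrite -(cvg_lim (@Rhausdorff R) (cvgN ci)); congr (limn _); apply/funext => n.
by rewrite hp ImConj fctE.
Qed.

End hermitian_solution.

End picard.

(** * Continuity in time *)

Section exponential_bounds.
Context {R : realType}.
Implicit Types (x t xi : R).

Lemma exp_abs_lorentz xi : expR (- `|xi|) <= 2 * lorentz xi.
Proof.
rewrite expRN ler_pdivlMr ?oneD_sqr_gt0// mulrC ler_pdivrMr ?expR_gt0//.
have := @expR_ge1Dxn R `|xi| 1 (normr_ge0 _).
rewrite -[xi ^+ 2]real_normK ?num_real// (_ : (2`!)%:R = 2 :> R)//; lra.
Qed.

Lemma pow_exp_bound (n : nat) : exists2 C : R, 0 <= C & forall xi,
  (1 + xi ^+ 2) ^+ n * expR (- `|xi|) <= C.
Proof.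
exists ((2 * n).+1`!%:R * expR 1); first by rewrite mulr_ge0 ?expR_ge0.
move=> xi; rewrite expRN ler_pdivrMr ?expR_gt0// -mulrA -expRD.
have x0 := normr_ge0 xi.
have h1 : (1 + xi ^+ 2) ^+ n <= (1 + `|xi|) ^+ (2 * n).+1.
  apply: (@le_trans _ _ ((1 + `|xi|) ^+ (2 * n))).
    rewrite exprM; apply: lerXn2r; rewrite ?nnegrE ?exprn_ge0 ?addr_ge0 ?sqr_ge0//.
    by rewrite -[xi ^+ 2]real_normK ?num_real//; nra.
  by apply: ler_weXn2l => //; rewrite lerDl.
apply: le_trans h1 _.
have y0 : 0 <= 1 + `|xi| by rewrite addr_ge0.
have h := expR_ge1Dxn (2 * n) y0.
rewrite mulrC -ler_pdivrMr ?ltr0n ?fact_gt0//; apply: le_trans h.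
by rewrite lerDr.
Qed.

(** Exponential decay in frequency beats every Sobolev weight: the solutions lie in
  [H^s] for all real [s], negative or not. *)
Lemma weight_exp_lorentz (s : R) : exists2 C : R, 0 <= C & forall xi,
  weight s xi * expR (- `|xi|) <= C * lorentz xi.
Proof.
pose n := (Num.truncn `|s|).+2.
have [C C0 hC] := pow_exp_bound n; exists C => // xi.
rewrite ler_pdivlMr ?oneD_sqr_gt0//; apply: le_trans (hC xi).
rewrite mulrAC; apply: ler_wpM2r; first exact: expR_ge0.
rewrite /n [leRHS]exprSr; apply: ler_wpM2r; first exact/ltW/oneD_sqr_gt0.
rewrite -powR_mulrn; last exact/ltW/oneD_sqr_gt0.
rewrite ler_powR ?lerDl ?sqr_ge0//.
by apply: (le_trans (ler_norm s)); apply/ltW/truncnS_gt.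
Qed.

Lemma norm_sin_le x : `|sin x| <= `|x|.
Proof.
wlog x0 : x / 0 <= x => [W|].
  have [/W//|/ltW x0] := leP 0 x.
  by rewrite -normrN -sinN -[X in _ <= X]normrN; apply: W; rewrite oppr_ge0.
move: x0; rewrite le_eqVlt => /predU1P[<-|x0]; first by rewrite sin0.
have [c _] := @MVT R sin cos 0 x x0 (fun y _ => is_derive_sin y) (continuous_subspaceT (@continuous_sin R)).
rewrite sin0 !subr0 => ->; rewrite normrM ler_piMl// norm_cos//.
Qed.

Lemma norm_cosB1_le x : `|cos x - 1| <= `|x|.
Proof.
wlog x0 : x / 0 <= x => [W|].
  have [/W//|/ltW x0] := leP 0 x.
  by rewrite -cosN -[X in _ <= X]normrN; apply: W; rewrite oppr_ge0.
move: x0; rewrite le_eqVlt => /predU1P[<-|x0]; first by rewrite cos0 subrr.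
have [c _] := @MVT R cos (fun y => - sin y) 0 x x0 (fun y _ => is_derive_cos y) (continuous_subspaceT (@continuous_cos R)).
rewrite cos0 !subr0 => ->; rewrite normrM ler_piMl// normrN norm_sin//.
Qed.

Lemma norm_expB1_le x : 0 <= x -> `|expR (- x) - 1| <= x.
Proof.
move=> x0; have h1 : expR (- x) <= 1 by rewrite -expR0 ler_expR oppr_le0.
rewrite distrC ger0_norm ?subr_ge0//.
by have := expR_ge1Dx (- x); lra.
Qed.

End exponential_bounds.

Section time_lipschitz.
Context {R : realType}.
Notation mu := (@lebesgue_measure R).
Notation Re := complex.Re.
Notation Im := complex.Im.
Variables (T : R) (p : R -> R).
Hypothesis T0 : 0 <= T.
Hypothesis mp : measurable_fun setT p.
Hypothesis p0 : forall xi, 0 <= p xi.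
Hypothesis p_le : forall xi, p xi <= 1 + xi ^+ 2.
Implicit Types (u v f : R * R -> R[i]) (t tau xi eta c d x : R).

Lemma W_exp t xi : W T t xi <= expR (- `|xi|) * lorentz xi.
Proof.
rewrite ler_wpM2r ?(ltW (lorentz_gt0 _))// ler_expR lerN2 ler_peMl//.
by rewrite -addrA addrC -addrA lerDl addrC subr_ge0 clamp_leT.
Qed.

Lemma W_exp1 t xi : (1 + xi ^+ 2) * W T t xi <= expR (- `|xi|).
Proof.
have a := oneD_sqr_gt0 xi.
apply: (le_trans (ler_wpM2l (ltW a) (W_exp t xi))).
by rewrite mulrCA /lorentz mulfV ?mulr1// gt_eqF.
Qed.

Lemma propB1 t xi : 0 <= t -> n1 (prop p t xi - 1) <= t * (3 * (1 + xi ^+ 2)).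
Proof.
move=> t0; set e := expR (- (t * p xi)); set th := t * (xi * `|xi|).
have tp : 0 <= t * p xi by rewrite mulr_ge0.
have he : `|e - 1| <= t * (1 + xi ^+ 2).
  by apply: (le_trans (norm_expB1_le tp)); rewrite ler_wpM2l.
have hth : `|th| <= t * (1 + xi ^+ 2).
  rewrite /th !normrM (ger0_norm t0) normr_id ler_wpM2l//.
  by rewrite -expr2 real_normK ?num_real// lerDr.
have e0 : 0 <= e by exact: expR_ge0.
have e1 : e <= 1 by rewrite -expR0 ler_expR oppr_le0.
have -> : prop p t xi - 1 = (e - 1)%:C + (e%:C * (expi (- th) - 1)).
  by rewrite /prop -/e -/th; apply: complex_ext; rewrite !ReImE /=; ring.
apply: (le_trans (n1D _ _)); rewrite n1_real n1Zl [`|e|]ger0_norm//.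
have hx : n1 (expi (- th) - 1) <= 2 * (t * (1 + xi ^+ 2)).
  rewrite /n1 !ReImE /= oppr0 addr0 cosN sinN normrN.
  have := norm_cosB1_le th; have := norm_sin_le th; lra.
have := ler_piMl (n1_ge0 (expi (- th) - 1)) e1; lra.
Qed.

Section mild_solution.
Variables (k : R -> R[i]) (U : R * R -> R[i]) (f : R * R -> R[i]) (c d : R).
Hypotheses (mf : cmeas f) (hf : bnd T d f) (hU : bnd T c U).
Hypothesis UE : forall z, U z = prop p (clamp T z.1) z.2 * k z.2 + duhamel T p f z.

(** The part of the Duhamel integrand that comes from times between [t'] and [t]. *)
Let gap t t' xi tau : R[i] :=
  duh_integrand T p f t xi tau - prop p (clamp T t - clamp T t') xi * duh_integrand T p f t' xi tau.

Let gap_bound t t' xi tau : clamp T t' <= clamp T t ->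
  n1 (gap t t' xi tau) <= 2 * (d * lorentz xi) * (expR (- `|xi|) * \1_(`[clamp T t', clamp T t]) tau).
Proof.
move=> tt; have d0 := bnd_ge0 hf.
have l0 := lorentz_gt0 xi.
rewrite /gap /duh_integrand indic_itvE.
have [tau0|tau0] := leP 0 tau => /=; last first.
  by rewrite mulr0 subrr n10 !mulr_ge0 ?expR_ge0 ?(ltW l0).
have [ht'|ht'] := leP tau (clamp T t').
  rewrite (le_trans ht' tt) mulrA -propD.
  have -> : clamp T t - clamp T t' + (clamp T t' - tau) = clamp T t - tau by ring.
  by rewrite subrr n10 !mulr_ge0 ?expR_ge0 ?(ltW l0).
rewrite mulr0 subr0 (ltW ht') /=; case: ifP => [ht|ht]; last first.
  by rewrite n10 !mulr_ge0 ?expR_ge0 ?(ltW l0).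
rewrite mulr1 -mulrA; apply: n1M_le; first by rewrite n1_prop// subr_ge0.
apply: (le_trans (hf _ _)); rewrite -mulrA ler_wpM2l//.
by rewrite [leRHS]mulrC; exact: W_exp.
Qed.

(** Restarting at time [t'] gives [U(t) = prop(t - t') U(t')] plus the Duhamel integral
  over [[t', t]]; both increments are proportional to [t - t']. *)
Lemma mild_lipschitz t t' xi :
  n1 (U (t, xi) - U (t', xi)) <= (3 * c + 2 * d) * `|clamp T t - clamp T t'| * expR (- `|xi|).
Proof.
wlog tt : t t' / clamp T t' <= clamp T t => [hw|].
  have [/hw//|/ltW/hw] := leP (clamp T t') (clamp T t).
  by rewrite n1BC distrC.
have c0 := bnd_ge0 hU; have d0 := bnd_ge0 hf.
have r0 : 0 <= clamp T t - clamp T t' by rewrite subr_ge0.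
rewrite (ger0_norm r0); set r := clamp T t - clamp T t' in r0 *.
have It := duh_cintegrable T0 mp p0 t xi mf hf; have It' := duh_cintegrable T0 mp p0 t' xi mf hf.
have It'' := CintegrableZ (prop p r xi) It'.
have E : U (t, xi) - U (t', xi) = (prop p r xi - 1) * U (t', xi) +
    (0 -i* (xi / (4 * pi))) * Cintegral (gap t t' xi).
  rewrite /gap (CIB It It'') (CIZ _ It') !UE /duhamel /=.
  have -> : prop p (clamp T t) xi = prop p r xi * prop p (clamp T t') xi.
    by rewrite -propD /r subrK.
  ring.
have mg : cmeas (gap t t' xi).
  apply: cmeasB; first exact: cmeas_duh_integrand1.
  by apply: cmeasM; [exact: cmeas_cst|exact: cmeas_duh_integrand1].
have Ig : intg (fun tau => 2 * (d * lorentz xi) * (expR (- `|xi|) * \1_(`[clamp T t', clamp T t]) tau)).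
  by apply: intgZl; apply: intgZl; exact: intg_indic.
have G : n1 (Cintegral (gap t t' xi)) <= 2 * (d * lorentz xi) * (expR (- `|xi|) * r).
  apply: (le_trans (n1_CI_dom mg Ig _)); first by move=> tau; exact: gap_bound.
  rewrite !RintegralZl// ?Rint_indic//; first exact: intg_indic.
  by apply: intgZl; exact: intg_indic.
have e0 := expR_ge0 (- `|xi|).
have A1 : n1 ((prop p r xi - 1) * U (t', xi)) <= 3 * c * r * expR (- `|xi|).
  apply: (le_trans (n1M_le (propB1 xi r0) (hU t' xi))).
  have -> : r * (3 * (1 + xi ^+ 2)) * (c * W T t' xi) = 3 * c * r * ((1 + xi ^+ 2) * W T t' xi) by ring.
  by rewrite ler_wpM2l ?mulr_ge0// W_exp1.
have pi1 : 1 <= pi :> R by have := pi_ge2 R; lra.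
have E1 : n1 (0 -i* (xi / (4 * pi))) <= `|xi|.
  rewrite /n1 /= normr0 add0r normrN normrM normfV ler_piMr// invf_le1 ger0_norm; lra.
have l1 : `|xi| * lorentz xi <= 1.
  rewrite ler_pdivrMr ?oneD_sqr_gt0// mul1r -[xi ^+ 2]real_normK ?num_real//.
  by have := sqr_ge0 (`|xi| - 2^-1); nra.
have A2 : n1 ((0 -i* (xi / (4 * pi))) * Cintegral (gap t t' xi)) <= 2 * d * r * expR (- `|xi|).
  apply: (le_trans (n1M_le E1 G)).
  have -> : `|xi| * (2 * (d * lorentz xi) * (expR (- `|xi|) * r)) =
    (2 * d * r * expR (- `|xi|)) * (`|xi| * lorentz xi) by ring.
  by rewrite ler_piMr ?mulr_ge0.
rewrite E; apply: (le_trans (n1D _ _)); apply: (le_trans (lerD A1 A2)).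
by rewrite -!mulrDl.
Qed.

End mild_solution.
End time_lipschitz.

(** * The square of a function and the convolution of its transform *)

Section convolution_theorem.
Context {R : realType}.
Notation mu := (@lebesgue_measure R).
Notation Re := complex.Re.
Notation Im := complex.Im.
Variables (g : R -> R[i]) (c : R).
Hypothesis mg : cmeas g.
Hypothesis hg : forall xi, n1 (g xi) <= c * (expR (- `|xi|) * lorentz xi).
Implicit Types (x xi eta : R).

Definition wave x : R[i] := Cintegral (fun xi => g xi * expi (x * xi)).
Definition selfconv xi : R[i] := Cintegral (fun eta => g eta * g (xi - eta)).

Let c0 : 0 <= c.
Proof.
have := le_trans (n1_ge0 _) (hg 0).
by rewrite pmulr_lge0// mulr_gt0 ?expR_gt0 ?lorentz_gt0.
Qed.

Let hg1 xi : n1 (g xi) <= c * lorentz xi.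
Proof.
by apply: (le_trans (hg xi)); rewrite ler_wpM2l// ler_piMl ?(ltW (lorentz_gt0 _))//.
Qed.

Lemma Cintegrable_decay : Cintegrable g.
Proof. exact: (Cintegrable_dom mg (intgZl c intg_lorentz) hg1). Qed.

Lemma Cintegrable_wave x : Cintegrable (fun xi => g xi * expi (x * xi)).
Proof.
apply: (Cintegrable_dom _ (intgZr 2 (intg_n1 Cintegrable_decay))).
  by apply: cmeasM => //; apply: cmeas_expi; exact: measurable_funM.
by move=> xi; apply: n1M_le => //; exact: n1_expi.
Qed.

(** The exponential weight absorbs the factor lost in Peetre's inequality. *)
Let conv_dom xi eta : n1 (g eta * g (xi - eta)) <= (4 * c ^+ 2 * lorentz xi) * lorentz eta.
Proof.
apply: (le_trans (n1M_le (hg eta) (hg1 (xi - eta)))).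
have e := exp_abs_lorentz eta.
have -> : c * (expR (- `|eta|) * lorentz eta) * (c * lorentz (xi - eta)) =
  c ^+ 2 * (expR (- `|eta|) * (lorentz eta * lorentz (xi - eta))) by ring.
have -> : 4 * c ^+ 2 * lorentz xi * lorentz eta = c ^+ 2 * ((2 * lorentz eta) * (2 * lorentz xi)) by ring.
rewrite ler_wpM2l ?sqr_ge0//; apply: ler_pM => //; rewrite ?expR_ge0 ?mulr_ge0//
  ?(ltW (lorentz_gt0 _))//.
have a := oneD_sqr_gt0 eta; have b := oneD_sqr_gt0 (xi - eta); have d := oneD_sqr_gt0 xi.
rewrite /lorentz -invfM ler_pdivlMr// mulrC ler_pdivrMr ?mulr_gt0//.
have := sqr_ge0 (eta - (xi - eta)); have := sqr_ge0 (eta * (xi - eta)); nra.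
Qed.

Let shear : measurable_fun setT (fun z : R * R => z.1 - z.2).
Proof. by apply: measurable_funB; [exact: measurable_fst|exact: measurable_snd]. Qed.

Let mconv : cmeas (fun z : R * R => g z.2 * g (z.1 - z.2)).
Proof.
by apply: cmeasM; [exact: (cmeas_comp mg measurable_snd)|exact: (cmeas_comp mg shear)].
Qed.

Lemma Cintegrable_selfconv : Cintegrable selfconv.
Proof.
exact: (Cintegrable_fubini mconv (intgZl (4 * c ^+ 2) intg_lorentz) intg_lorentz conv_dom).
Qed.

(** The convolution theorem, by Fubini and translation. *)
Lemma wave_sqr x : wave x ^+ 2 = Cintegral (fun xi => selfconv xi * expi (x * xi)).
Proof.
have Ig := Cintegrable_decay.
have Ic xi : Cintegrable (fun eta => g eta * g (xi - eta)).
  apply: (Cintegrable_dom _ (intgZl (4 * c ^+ 2 * lorentz xi) intg_lorentz)).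
    exact: cmeas_pair1 mconv.
  by move=> eta; exact: conv_dom.
transitivity (Cintegral (fun xi => Cintegral (fun eta => g eta * g (xi - eta) * expi (x * xi)))).
  rewrite (@CI_fubini _ (fun z => g z.2 * g (z.1 - z.2) * expi (x * z.1))
    (fun xi => 2 * (4 * c ^+ 2 * lorentz xi)) lorentz) /=.
  - rewrite expr2 /wave -CIZr; last exact: Cintegrable_wave.
    apply: eq_CI => eta.
    have -> : (fun xi => g eta * g (xi - eta) * expi (x * xi)) =
       (fun xi => (g eta * expi (x * eta)) * (g (xi - eta) * expi (x * (xi - eta)))).
      apply/funext => xi; have -> : x * xi = x * eta + x * (xi - eta) by ring.
      by rewrite expiD; ring.
    have Is := Cintegrable_shift (- eta) (Cintegrable_wave x).
    rewrite CIZ; last exact: Is.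
    by congr (_ * _); rewrite -(CI_shift (- eta) (Cintegrable_wave x)).
  - apply: cmeasM => //; apply: cmeas_expi.
    by apply: measurable_funM => //; exact: measurable_fst.
  - by apply: intgZl; apply: intgZl; exact: intg_lorentz.
  - exact: intg_lorentz.
  - move=> xi eta /=; apply: le_trans (n1M_le (conv_dom xi eta) (n1_expi (x * xi))) _.
    by rewrite le_eqVlt; apply/orP; left; apply/eqP; ring.
by apply: eq_CI => xi; rewrite CIZr.
Qed.

Hypothesis g_cj : forall xi, g (- xi) = cj (g xi).

Lemma wave_real x : (Re (wave x))%:C = wave x.
Proof.
apply: cj_fix; have I := Cintegrable_wave x.
rewrite /wave -CI_cj// -[RHS](CI_reflect 0 I); apply: eq_CI => xi.
by rewrite cjM sub0r g_cj mulrN expiN.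
Qed.

Lemma pairing_real (psi : R -> R) : intg psi ->
  (Re (Cintegral (fun xi => g xi * inv_fourier psi xi)))%:C =
  Cintegral (fun xi => g xi * inv_fourier psi xi).
Proof.
move=> Ip; have [K K0 hK] := inv_fourier_bounded Ip.
have I : Cintegrable (fun xi => g xi * inv_fourier psi xi).
  apply: (Cintegrable_dom _ (intgZr K (intg_n1 Cintegrable_decay))).
    by apply: cmeasM => //; apply: cmeas_inv_fourier; exact: intg_meas.
  by move=> xi; exact: n1M_le.
apply: cj_fix; rewrite -CI_cj// -[RHS](CI_reflect 0 I); apply: eq_CI => xi.
by rewrite cjM sub0r g_cj inv_fourier_cj.
Qed.

(** The function of [x] with Fourier transform [g]; it is real because [g] is
  Hermitian. *)
Definition profile x : R := (2 * pi)^-1 * Re (wave x).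

Lemma profileC x : (profile x)%:C = ((2 * pi)^-1)%:C * wave x.
Proof. by rewrite /profile real_complexM wave_real. Qed.

(** Parseval's identity against a test function. *)
Lemma profile_pairing (psi : R -> R) : intg psi ->
  Re (Cintegral (fun xi => g xi * inv_fourier psi xi)) = \int[mu]_x (profile x * psi x).
Proof.
move=> Ip; have Io : Cintegrable (fun xi => g xi * osc psi xi).
  have [K K0 hK] := osc_bounded Ip.
  apply: (Cintegrable_dom _ (intgZr K (intg_n1 Cintegrable_decay))).
    by apply: cmeasM => //; apply: cmeas_osc; exact: intg_meas.
  by move=> xi; exact: n1M_le.
have e : Cintegral (fun xi => g xi * inv_fourier psi xi) =
   Cintegral (fun x => (profile x * psi x)%:C).
  transitivity (((2 * pi)^-1)%:C * Cintegral (fun xi => g xi * osc psi xi)).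
    by rewrite -(CIZ _ Io); apply: eq_CI => xi; rewrite inv_fourierE mulrCA.
  rewrite -(pairing_fubini Cintegrable_decay Ip) -CIZ.
    by apply: eq_CI => x; rewrite real_complexM profileC mulrA.
  have mw : cmeas wave.
    refine (@cmeas_CI_param _ _ (measurableTypeR R) (fun z : R * R => g z.2 * expi (z.1 * z.2)) _).
    apply: cmeasM; first exact: (cmeas_comp mg measurable_snd).
    by apply: cmeas_expi; exact: measurable_mulxy.
  apply: (Cintegrable_dom _ (intgZl (\int[mu]_xi (n1 (g xi) * 2)) (intg_norm Ip))).
    by apply: cmeasM => //; apply: cmeas_real; exact: intg_meas.
  move=> x; rewrite -n1_real; apply: n1M_le => //.
  apply: n1_CI_dom.
  - by case: (Cintegrable_wave x) => /intg_meas ? /intg_meas.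
  - exact: (intgZr 2 (intg_n1 Cintegrable_decay)).
  - by move=> xi; apply: n1M_le => //; exact: n1_expi.
by rewrite e ReCI.
Qed.

Lemma profile_bounded : exists C : R, forall x, `|profile x| <= C.
Proof.
exists ((2 * pi)^-1 * \int[mu]_xi (n1 (g xi) * 2)) => x.
rewrite /profile normrM ger0_norm ?invr_ge0 ?mulr_ge0 ?pi_ge0// ler_wpM2l//.
  by rewrite invr_ge0 mulr_ge0 ?pi_ge0.
apply: (le_trans (Re_n1 _)); apply: n1_CI_dom.
- by case: (Cintegrable_wave x) => /intg_meas ? /intg_meas.
- exact: (intgZr 2 (intg_n1 Cintegrable_decay)).
- by move=> xi; apply: n1M_le => //; exact: n1_expi.
Qed.

(** The convolution theorem for the square, and integration by parts for the derivative
  of [psi]: this is the term [u u_x] of the equation on the Fourier side. *)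
Lemma profile_flux (psi : schwartz R) : compactly_supported_in setT psi ->
  \int[mu]_x (profile x ^+ 2 / 2 * derive1 psi x) =
  Re (Cintegral (fun xi => (0 -i* (xi / (4 * pi))) * selfconv xi * inv_fourier psi xi)).
Proof.
move=> cpsi; have Id := intg_schwartz_derive psi.
have pi_neq0 : pi != 0 :> R by rewrite gt_eqF// pi_gt0.
have Is := Cintegrable_selfconv.
have P := pairing_fubini Is Id.
have [K K0 hK] := osc_bounded Id.
have Io : Cintegrable (fun xi => selfconv xi * osc (derive1 psi) xi).
  apply: (Cintegrable_dom _ (intgZr K (intg_n1 Is))).
    apply: cmeasM; first exact: Cintegrable_cmeas.
    by apply: cmeas_osc; exact: intg_meas.
  by move=> xi; exact: n1M_le.
have [C hC] := profile_bounded.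
have mw : measurable_fun setT profile.
  have [mw _] : cmeas wave.
    refine (@cmeas_CI_param _ _ (measurableTypeR R) (fun z : R * R => g z.2 * expi (z.1 * z.2)) _).
    apply: cmeasM; first exact: (cmeas_comp mg measurable_snd).
    by apply: cmeas_expi; exact: measurable_mulxy.
  exact: measurable_funM.
pose a : R := (2 * pi)^-1 ^+ 2 / 2.
have E1 x : (profile x ^+ 2 / 2 * derive1 psi x)%:C =
   a%:C * (Cintegral (fun xi => selfconv xi * expi (x * xi)) * (derive1 psi x)%:C).
  rewrite -wave_sqr -wave_real -[(Re (wave x))%:C ^+ 2]/((Re (wave x))%:C * (Re (wave x))%:C).
  by rewrite -!real_complexM; congr (_%:C); rewrite /a /profile; ring.
have E2 xi : (0 -i* (xi / (4 * pi))) * selfconv xi * inv_fourier psi xi =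
   a%:C * (selfconv xi * osc (derive1 psi) xi).
  rewrite inv_fourierE osc_derive//.
  have -> : (0 -i* (xi / (4 * pi))) = (xi / (4 * pi))%:C * (0 -i* 1) :> R[i].
    by apply: complex_ext; rewrite !ReImE /=; ring.
  have -> : (0 -i* xi) = xi%:C * (0 -i* 1) :> R[i].
    by apply: complex_ext; rewrite !ReImE /=; ring.
  have -> : (xi / (4 * pi))%:C * (0 -i* 1) * selfconv xi * (((2 * pi)^-1)%:C * osc psi xi) =
     ((xi / (4 * pi))%:C * ((2 * pi)^-1)%:C) * ((0 -i* 1) * selfconv xi * osc psi xi) by ring.
  have -> : a%:C * (selfconv xi * (xi%:C * (0 -i* 1) * osc psi xi)) =
     (a%:C * xi%:C) * ((0 -i* 1) * selfconv xi * osc psi xi) by ring.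
  rewrite -!real_complexM; congr (_%:C * _); rewrite /a.
  by move: (pi : R) pi_neq0 => P0 h0; field.
transitivity (Re (Cintegral (fun x => (profile x ^+ 2 / 2 * derive1 psi x)%:C))).
  by rewrite ReCI.
rewrite (eq_CI E2) (CIZ _ Io) -P (eq_CI E1) CIZ//.
have Ireal : Cintegrable (fun x => (profile x ^+ 2 / 2 * derive1 psi x)%:C).
  split => /=; last exact: intg0.
  apply: (@intg_dom _ _ (fun x => C ^+ 2 / 2 * `|derive1 psi x|)).
  - apply: measurable_funM; last exact: intg_meas.
    by apply: measurable_funM => //; exact: measurable_funX.
  - by apply: intgZl; exact: intg_norm.
  - move=> x; rewrite normrM ler_wpM2r// normrM normrX [`|2^-1|]ger0_norm ?invr_ge0//.
    rewrite ler_wpM2r ?invr_ge0// lerXn2r ?nnegrE//; exact: le_trans (hC 0).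
have a0 : a != 0.
  by rewrite /a mulf_neq0 ?invr_eq0 ?pnatr_eq0// expf_neq0// invr_eq0 mulf_neq0// pnatr_eq0.
have := CintegrableZ (a^-1)%:C Ireal.
under eq_fun do rewrite E1 mulrA -real_complexM mulVf// mul1r.
by [].
Qed.

End convolution_theorem.

(** * The weak equation at a fixed frequency *)

Section weak_time.
Context {R : realType}.
Notation mu := (@lebesgue_measure R).
Notation Re := complex.Re.
Notation Im := complex.Im.
Variables (T : R) (p : R -> R).
Hypothesis T0 : 0 <= T.
Hypothesis mp : measurable_fun setT p.
Hypothesis p0 : forall xi, 0 <= p xi.
Variable theta : R -> R.
Hypothesis dtheta : forall t : R, is_derive t 1 theta (derive1 theta t).
Hypothesis cdtheta : continuous (derive1 theta).
Hypothesis theta0 : theta 0 = 0.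
Hypothesis thetaT : theta T = 0.
Implicit Types (t tau xi : R).

Definition symbol xi : R[i] := p xi +i* (xi * `|xi|).

(** The adjoint of [d/dt + symbol] applied to the time test function. *)
Definition adj t xi : R[i] := (- derive1 theta t)%:C + (theta t)%:C * symbol xi.

Let ctheta : continuous theta. Proof. exact: derive_continuous dtheta. Qed.

Lemma cmeas_adj : cmeas (fun z : R * R => adj z.1 z.2).
Proof.
have m1 : measurable_fun setT (fun z : R * R => z.1) by exact: measurable_fst.
have m2 : measurable_fun setT (fun z : R * R => z.2) by exact: measurable_snd.
apply: cmeasD.
  apply: cmeas_real; apply: measurableT_comp => //.
  exact: (measurableT_comp (continuous_meas cdtheta) m1).
apply: cmeasM.
  by apply: cmeas_real; exact: (measurableT_comp (continuous_meas ctheta) m1).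
split => /=; first exact: (measurableT_comp mp m2).
by apply: measurable_funM => //; exact: measurableT_comp.
Qed.

Definition adj_dom t : R := (`|derive1 theta t| + `|theta t|) * \1_(`[0, T]) t.

Lemma intg_adj_dom : intg adj_dom.
Proof.
have cc : continuous (fun t => `|derive1 theta t| + `|theta t|).
  move=> t; apply: cvgD; apply: (continuous_comp _ (@norm_continuous _ _ _)).
    exact: cdtheta.
  exact: ctheta.
have := intg_itv 0 T cc; move/integrable_mkcond => /(_ (measurable_itv _)).
apply: eq_integrable => // t _; rewrite /adj_dom /= patchE indicE.
by case: (t \in _); rewrite ?mulr1 ?mulr0.
Qed.

Lemma n1_adj t xi : n1 (adj t xi) <= (`|derive1 theta t| + `|theta t|) * (1 + n1 (symbol xi)).
Proof.
apply: (le_trans (n1D _ _)); rewrite n1_real normrN n1Zl.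
have := n1_ge0 (symbol xi); have := normr_ge0 (derive1 theta t).
have := normr_ge0 (theta t); nra.
Qed.

(** The integrand is minus the derivative of [theta(t) prop(t - tau)], and [theta]
  vanishes at [T]. *)
Lemma adj_prop tau xi : 0 <= tau <= T ->
  Cintegral (fun t => if tau <= t <= T then adj t xi * prop p (t - tau) xi else 0) =
  (theta tau)%:C.
Proof.
move=> /andP[t0 tT].
pose b := xi * `|xi|.
pose e t := expR (- ((t - tau) * p xi)).
pose Gr t := theta t * (e t * cos ((t - tau) * b)).
pose Gi t := - (theta t * (e t * sin ((t - tau) * b))).
have dl t : is_derive t 1 (fun t => t - tau) 1.
  by apply: (deq (dB (did t) (dcst tau t))); rewrite subr0.
have de t : is_derive t 1 e (- (p xi * e t)).
  apply: (deq (dexp (dN (dM (dl t) (dcst (p xi) t))))); rewrite /e; ring.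
have dbb t : is_derive t 1 (fun t => (t - tau) * b) b.
  by apply: (deq (dM (dl t) (dcst b t))); ring.
have dc t := dcos (dbb t); have ds t := dsin (dbb t).
have dGr t : is_derive t 1 Gr (- Re (adj t xi * prop p (t - tau) xi)).
  apply: (deq (dM (dtheta t) (dM (de t) (dc t)))).
  by rewrite /adj /prop /symbol !ReImE /= cosN sinN -/b -/(e t); ring.
have dGi t : is_derive t 1 Gi (- Im (adj t xi * prop p (t - tau) xi)).
  apply: (deq (dN (dM (dtheta t) (dM (de t) (ds t))))).
  by rewrite /adj /prop /symbol !ReImE /= cosN sinN -/b -/(e t); ring.
have ce : continuous e by exact: derive_continuous de.
have cl : continuous (fun t => (t - tau) * b) by exact: derive_continuous dbb.
have cc : continuous (fun t => cos ((t - tau) * b)) by exact: derive_continuous dc.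
have cs : continuous (fun t => sin ((t - tau) * b)) by exact: derive_continuous ds.
have cRe : continuous (fun t => Re (adj t xi * prop p (t - tau) xi)).
  rewrite (_ : (fun t => _) = fun t => (- derive1 theta t + theta t * p xi) * (e t * cos ((t - tau) * b))
     + theta t * b * (e t * sin ((t - tau) * b))).
    move=> t; apply: cvgD; (apply: cvgM; last by apply: cvgM; [exact: ce|exact: cc || exact: cs]).
      apply: cvgD; first by apply: cvgN; exact: cdtheta.
      by apply: cvgM; [exact: ctheta|exact: cvg_cst].
    by apply: cvgM; [exact: ctheta|exact: cvg_cst].
  apply/funext => t.
  by rewrite /adj /prop /symbol !ReImE /= cosN sinN -/b -/(e t); ring.
have cIm : continuous (fun t => Im (adj t xi * prop p (t - tau) xi)).
  rewrite (_ : (fun t => _) = fun t => theta t * b * (e t * cos ((t - tau) * b))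
     - (- derive1 theta t + theta t * p xi) * (e t * sin ((t - tau) * b))).
    move=> t; apply: cvgB; (apply: cvgM; last by apply: cvgM; [exact: ce|exact: cc || exact: cs]).
      by apply: cvgM; [exact: ctheta|exact: cvg_cst].
    apply: cvgD; first by apply: cvgN; exact: cdtheta.
    by apply: cvgM; [exact: ctheta|exact: cvg_cst].
  apply/funext => t.
  by rewrite /adj /prop /symbol !ReImE /= cosN sinN -/b -/(e t); ring.
have itvE t : (t \in `[tau, T]%classic) = (tau <= t <= T).
  by apply/idP/idP; rewrite inE /= in_itv.
have cut (F : R -> R) : \int[mu]_t (if tau <= t <= T then F t else 0) = \int[mu]_(t in `[tau, T]) F t.
  by rewrite [RHS]Rintegral_mkcond; apply: eq_Rint => t; rewrite patchE itvE.
have neg (F G : R -> R) : (forall t : R, is_derive t 1 G (- F t)) -> continuous F ->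
   \int[mu]_(t in `[tau, T]) F t = G tau - G T.
  move=> dG cF.
  rewrite -(opprB (G T)) -(FTC2 tT dG); last by move=> t; apply: cvgN; exact: cF.
  rewrite -mulN1r -RintegralZl//.
    by apply: eq_Rintegral => t _; rewrite mulN1r opprK.
  by apply: intg_itv => t; apply: cvgN; exact: cF.
apply: complex_ext; rewrite !(ReCI, ImCI) /=.
- rewrite (eq_Rint (g := fun t => if tau <= t <= T then Re (adj t xi * prop p (t - tau) xi) else 0)); last first.
    by move=> t; case: ifP.
  rewrite cut (neg _ _ dGr cRe) /Gr thetaT mul0r subr0 subrr mul0r cos0 mulr1.
  by rewrite /e subrr mul0r oppr0 expR0 mulr1.
- rewrite (eq_Rint (g := fun t => if tau <= t <= T then Im (adj t xi * prop p (t - tau) xi) else 0)); last first.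
    by move=> t; case: ifP.
  by rewrite cut (neg _ _ dGi cIm) /Gi thetaT mul0r subrr mul0r sin0 !mulr0 !oppr0 addr0.
Qed.

Section mild_weak.
Variables (k : R -> R[i]) (U : R * R -> R[i]) (f : R * R -> R[i]) (d : R).
Hypotheses (mf : cmeas f) (hf : bnd T d f).
Hypothesis UE : forall z, U z = prop p (clamp T z.1) z.2 * k z.2 + duhamel T p f z.

Let cc xi : R[i] := 0 -i* (xi / (4 * pi)).

Let adj_cut_int xi : Cintegrable (fun t => if 0 <= t <= T then adj t xi * prop p (clamp T t) xi else 0).
Proof.
have m0 : measurable [set t : R | 0 <= t <= T].
  rewrite (_ : [set t : R | 0 <= t <= T] = `[0, T]%classic); first exact: measurable_itv.
  by apply/seteqP; split => t /=; rewrite in_itv.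
apply: (Cintegrable_dom _ (intgZr (2 * (1 + n1 (symbol xi))) intg_adj_dom)).
  apply: (@cmeas_if _ _ _ (fun t : R => 0 <= t <= T)) => //.
  apply: cmeasM; first exact: cmeas_pair2 cmeas_adj.
  apply: (@cmeas_comp _ _ _ _ _ _ (fun t : R => (clamp T t, xi)) (cmeas_prop mp)).
  apply/measurable_fun_pairP; split => /=; first exact: measurable_clamp.
  exact: measurable_cst.
move=> t; rewrite /adj_dom indic_itvE; case: ifP => _; last by rewrite n10 mulr0 mul0r.
rewrite mulr1; apply: (le_trans (n1M_le (n1_adj t xi) (n1_prop p0 xi (clamp_ge0 T0 t)))).
by rewrite le_eqVlt; apply/orP; left; apply/eqP; ring.
Qed.

(** The time derivative falls on [theta]; after Fubini in the Duhamel formula only the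
  explicit propagator is left to integrate, by [adj_prop]. *)
Lemma mild_weak xi :
  Cintegral (fun t => if 0 <= t <= T then adj t xi * U (t, xi) else 0) =
  Cintegral (fun t => if 0 <= t <= T then (theta t)%:C * (cc xi * f (t, xi)) else 0).
Proof.
have d0 := bnd_ge0 hf.
have m0 : measurable [set t : R | 0 <= t <= T].
  rewrite (_ : [set t : R | 0 <= t <= T] = `[0, T]%classic); first exact: measurable_itv.
  by apply/seteqP; split => t /=; rewrite in_itv.
pose h (z : R * R) : R[i] := if 0 <= z.1 <= T then adj z.1 xi * duh_integrand T p f z.1 xi z.2 else 0.
have mh : cmeas h.
  apply: (@cmeas_if _ _ _ (fun z : R * R => 0 <= z.1 <= T)).
    by have := @measurable_fst _ _ R R measurableT _ m0; rewrite setTI.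
  apply: cmeasM.
    apply: (@cmeas_comp _ _ _ _ _ _ (fun z : R * R => (z.1, xi)) cmeas_adj).
    by apply/measurable_fun_pairP; split => /=; [exact: measurable_fst|exact: measurable_cst].
  apply: (@cmeas_comp _ _ _ _ _ _ (fun z : R * R => ((z.1, xi), z.2)) (cmeas_duh_integrand T mp mf)).
  apply/measurable_fun_pairP; split => /=; last exact: measurable_snd.
  by apply/measurable_fun_pairP; split => /=; [exact: measurable_fst|exact: measurable_cst].
have hAB t tau : n1 (h (t, tau)) <=
    (adj_dom t * (1 + n1 (symbol xi))) * (2 * d * \1_(`[0, T]) tau).
  rewrite /h /adj_dom /= !indic_itvE; case: ifP => [tT|_]; last by rewrite n10 mulr0 !mul0r.
  rewrite mulr1; apply: (n1M_le (n1_adj t xi)).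
  rewrite /duh_integrand (clamp_id tT); case: ifP => [/andP[t0 tt]|_]; last first.
    by rewrite n10 mulr_ge0// mulr_ge0.
  have /andP[_ tle] := tT.
  rewrite t0 (le_trans tt tle) mulr1; apply: n1M_le; first by rewrite n1_prop// subr_ge0.
  apply: (le_trans (hf _ _)); rewrite ler_piMr//.
  by apply: le_trans (W_lorentz T0 _ _) _; exact: lorentz_le1.
have iA : intg (fun t => adj_dom t * (1 + n1 (symbol xi))) by exact: intgZr intg_adj_dom.
have iB : intg (fun tau => 2 * d * \1_(`[0, T]) tau) by apply: intgZl; exact: intg_indic.
have I1 := adj_cut_int xi.
have I2 := Cintegrable_fubini mh iA iB hAB.
have E t : (if 0 <= t <= T then adj t xi * U (t, xi) else 0) =
   (if 0 <= t <= T then adj t xi * prop p (clamp T t) xi else 0) * k xi +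
   cc xi * Cintegral (fun tau => h (t, tau)).
  rewrite /h /=; case: ifP => tT; last first.
    by rewrite CI0 mul0r mulr0 addr0.
  rewrite CIZ; last exact: (duh_cintegrable T0 mp p0 t xi mf hf).
  by rewrite UE /duhamel /cc /=; ring.
have I1' : Cintegrable (fun t => (if 0 <= t <= T then adj t xi * prop p (clamp T t) xi else 0) * k xi).
  have := CintegrableZ (k xi) I1; congr Cintegrable; apply/funext => t; exact: mulrC.
rewrite (eq_CI E) (CID I1' (CintegrableZ (cc xi) I2)) (CIZr _ I1) (CIZ _ I2).
have -> : Cintegral (fun t => if 0 <= t <= T then adj t xi * prop p (clamp T t) xi else 0) = 0.
  rewrite (@eq_CI _ _ (fun t => if 0 <= t <= T then adj t xi * prop p (t - 0) xi else 0)).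
    by rewrite adj_prop ?lexx// theta0.
  by move=> t; rewrite subr0; case: ifP => // tT; rewrite clamp_id.
rewrite mul0r add0r (CI_fubini mh iA iB hAB) -CIZ; last first.
  apply: (@Cintegrable_fubini _ (fun z => h (z.2, z.1)) (fun tau => 2 * d * \1_(`[0, T]) tau)
    (fun t => adj_dom t * (1 + n1 (symbol xi)))) => //.
    by apply: (@cmeas_comp _ _ _ _ _ h (fun z : R * R => (z.2, z.1)) mh);
      apply/measurable_fun_pairP; split => /=; [exact: measurable_snd|exact: measurable_fst].
  by move=> tau t; rewrite mulrC; exact: hAB.
apply: eq_CI => tau; rewrite /h /=.
have [tauT|tauT] := boolP (0 <= tau <= T); last first.
  rewrite (@eq_CI _ _ (fun=> 0)) ?CI0 ?mulr0// => t.
  case: ifP => // tT; rewrite /duh_integrand (clamp_id tT).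
  case: ifP => [/andP[a b]|_]; last by rewrite mulr0.
  by move: tauT; rewrite a /= (le_trans b)//; case/andP: tT.
rewrite mulrCA; congr (_ * _).
rewrite (@eq_CI _ _ (fun t => (if tau <= t <= T then adj t xi * prop p (t - tau) xi else 0) * f (tau, xi))).
  have J : Cintegrable (fun t => if tau <= t <= T then adj t xi * prop p (t - tau) xi else 0).
    apply: (Cintegrable_dom _ (intgZr (2 * (1 + n1 (symbol xi))) intg_adj_dom)).
      apply: (@cmeas_if _ _ _ (fun t : R => tau <= t <= T)).
        rewrite (_ : [set t : R | tau <= t <= T] = `[tau, T]%classic); first exact: measurable_itv.
        by apply/seteqP; split => t /=; rewrite in_itv.
      apply: cmeasM; first exact: cmeas_pair2 cmeas_adj.
      apply: (@cmeas_comp _ _ _ _ _ _ (fun t : R => (t - tau, xi)) (cmeas_prop mp)).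
      apply/measurable_fun_pairP; split => /=; last exact: measurable_cst.
      exact: measurable_funB.
    move=> t; rewrite /adj_dom indic_itvE; case: ifP => [/andP[a b]|_]; last first.
      by rewrite n10 mulr_ge0 ?mulr_ge0 ?addr_ge0 ?n1_ge0.
    have /andP[tau0 _] := tauT.
    have tt : 0 <= t - tau by rewrite subr_ge0.
    rewrite (le_trans tau0 a) b mulr1; apply: (le_trans (n1M_le (n1_adj t xi) (n1_prop p0 xi tt))).
    by rewrite le_eqVlt; apply/orP; left; apply/eqP; ring.
  by rewrite (CIZr _ J) adj_prop.
move=> t; rewrite /duh_integrand; have /andP[tau0 tauT'] := tauT; rewrite tau0 /=.
have [tT|tT] := boolP (0 <= t <= T).
  rewrite (clamp_id tT); have /andP[_ ->] := tT; rewrite andbT.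
  by case: ifP => _; rewrite ?mulr0 ?mul0r// mulrA.
case: ifP => [/andP[a b]|_]; last by rewrite mul0r.
by move: tT; rewrite (le_trans tau0 a) b.
Qed.

End mild_weak.
End weak_time.

(** * The distributional solution *)

Section curve.
Context {R : realType}.
Notation mu := (@lebesgue_measure R).
Notation Re := complex.Re.
Notation Im := complex.Im.
Variables (T : R) (p : R -> R).
Hypothesis T_gt0 : 0 < T.
Hypothesis mp : measurable_fun setT p.
Hypothesis p0 : forall xi, 0 <= p xi.
Hypothesis p_le : forall xi, p xi <= 1 + xi ^+ 2.
Variables (k : R -> R[i]) (U : R * R -> R[i]) (c : R).
Hypotheses (mU : cmeas U) (hU : bnd T c U) (U_cj : hermitian U).
Hypothesis UE : forall z, U z = prop p (clamp T z.1) z.2 * k z.2 + quad T p U z.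
Implicit Types (t xi x s : R) (psi : schwartz R).

Let T0 : 0 <= T. Proof. exact: ltW. Qed.
Let c0 : 0 <= c. Proof. exact: bnd_ge0 hU. Qed.
Let mUt t : cmeas (fun xi => U (t, xi)). Proof. exact: cmeas_pair1. Qed.

Let U_decay t xi : n1 (U (t, xi)) <= c * (expR (- `|xi|) * lorentz xi).
Proof. by apply: (le_trans (hU t xi)); rewrite ler_wpM2l// W_exp. Qed.

Let U_exp t xi : (1 + xi ^+ 2) * n1 (U (t, xi)) <= c * expR (- `|xi|).
Proof.
have a := oneD_sqr_gt0 xi.
apply: (le_trans (ler_wpM2l (ltW a) (hU t xi))).
by rewrite mulrCA ler_wpM2l// W_exp1.
Qed.

Definition curve t : dist R :=
  fun psi => Re (Cintegral (fun xi => U (t, xi) * inv_fourier psi xi)).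

Lemma Cintegrable_pairing (m : R -> R[i]) (d : R) psi : cmeas m ->
  (forall xi, n1 (m xi) <= d * expR (- `|xi|)) ->
  Cintegrable (fun xi => m xi * inv_fourier psi xi).
Proof.
move=> mm hm; have Ip := intg_schwartz psi; have [C C0 hC] := inv_fourier_bounded Ip.
have d0 : 0 <= d.
  have := le_trans (n1_ge0 _) (hm 0); by rewrite pmulr_lge0// expR_gt0.
apply: (Cintegrable_dom _ (intgZr C (intgZl d (intgZl 2 intg_lorentz)))).
  by apply: cmeasM => //; apply: cmeas_inv_fourier; exact: intg_meas.
move=> xi; apply: n1M_le => //; apply: (le_trans (hm xi)).
by rewrite ler_wpM2l// exp_abs_lorentz.
Qed.

Let U_exp0 t xi : n1 (U (t, xi)) <= c * expR (- `|xi|).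
Proof.
apply: le_trans (U_exp t xi); rewrite ler_peMl ?n1_ge0//.
by rewrite lerDl sqr_ge0.
Qed.

Lemma curve_is_fourier t : is_fourier (curve t) (fun xi => U (t, xi)).
Proof.
split=> [|psi]; first exact: mUt.
split; first exact: (Cintegrable_pairing psi (mUt t) (U_exp0 t)).
exact: (pairing_real (mUt t) (U_decay t) (U_cj t) (intg_schwartz psi)).
Qed.

Let sqnorm_exp (z : R[i]) (d xi : R) : 0 <= d -> n1 z <= d * expR (- `|xi|) ->
  sqnorm z <= d ^+ 2 * expR (- `|xi|).
Proof.
move=> d0 hz; apply: (le_trans (sqnorm_n1 z)).
have e0 := expR_ge0 (- `|xi|).
have e1 : expR (- `|xi|) <= 1 by rewrite -expR0 ler_expR oppr_le0.
apply: (@le_trans _ _ ((d * expR (- `|xi|)) ^+ 2)).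
  by rewrite lerXn2r ?nnegrE ?n1_ge0 ?mulr_ge0.
rewrite exprMn ler_wpM2l ?sqr_ge0// expr2 ler_piMl//.
Qed.

Lemma curve_Hs s t : Hs s (curve t).
Proof.
have [C C0 hC] := weight_exp_lorentz s.
have [] // := @Hs_is_fourier _ s _ _ (curve_is_fourier t).
apply: (intg_dom _ (intgZl (c ^+ 2) (intgZl C intg_lorentz))).
  by apply: measurable_density; exact: mUt.
move=> xi; rewrite ger0_norm ?density_ge0//.
have h := sqnorm_exp c0 (U_exp0 t xi).
apply: (le_trans (ler_wpM2l (ltW (weight_gt0 s xi)) h)).
by rewrite mulrCA ler_wpM2l ?sqr_ge0.
Qed.

Lemma curve_diff_fourier t t' :
  is_fourier (curve t - curve t') (fun xi => U (t, xi) - U (t', xi)).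
Proof.
have F := is_fourier_lin (-1) (curve_is_fourier t') (curve_is_fourier t).
have e1 : -1 *: curve t' + curve t = curve t - curve t' by rewrite scaleN1r addrC.
rewrite e1 in F.
have e2 : (fun xi => (-1)%:C * U (t', xi) + U (t, xi)) = (fun xi => U (t, xi) - U (t', xi)).
  by apply/funext => xi; apply: complex_ext; rewrite !ReImE /=; ring.
by rewrite e2 in F.
Qed.

Let conv_b : bnd T (4 * @lorentz_mass R * (c * c)) (conv U U).
Proof. exact: conv_bnd. Qed.

(** The transform is Lipschitz in time with an exponentially decaying constant, which
  is integrable against any Sobolev weight. *)
Lemma curve_CHs s : CHs s T curve.
Proof.
split=> [t _|t tT e e0]; first exact: curve_Hs.
have [C C0 hC] := weight_exp_lorentz s.
pose L : R := 3 * c + 2 * (4 * @lorentz_mass R * (c * c)).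
have L0 : 0 <= L by rewrite addr_ge0 ?mulr_ge0 ?lorentz_mass_ge0.
pose M : R := L ^+ 2 * C * @lorentz_mass R.
have M0 : 0 <= M by rewrite !mulr_ge0 ?sqr_ge0 ?lorentz_mass_ge0.
have B t' : 0 <= t' <= T -> Hs_norm s (curve t' - curve t) ^+ 2 <= M * `|t' - t| ^+ 2.
  move=> t'T; pose r := `|t' - t|.
  have le xi : weight s xi * sqnorm (U (t', xi) - U (t, xi)) <= (L * r) ^+ 2 * (C * lorentz xi).
    have h := mild_lipschitz T0 mp p0 p_le (cmeas_conv mU mU) conv_b hU UE t' t xi.
    rewrite (clamp_id tT) (clamp_id t'T) -/r -/L in h.
    have h2 := sqnorm_exp (mulr_ge0 L0 (normr_ge0 _)) h.
    apply: (le_trans (ler_wpM2l (ltW (weight_gt0 s xi)) h2)).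
    by rewrite mulrCA ler_wpM2l ?sqr_ge0.
  have Il : intg (fun xi => (L * r) ^+ 2 * (C * lorentz xi)).
    by apply: intgZl; apply: intgZl; exact: intg_lorentz.
  have md : measurable_fun setT (fun xi => weight s xi * sqnorm (U (t', xi) - U (t, xi))).
    by apply: measurable_density; exact: cmeasB.
  have Id : intg (fun xi => weight s xi * sqnorm (U (t', xi) - U (t, xi))).
    by apply: (intg_dom md Il) => xi; rewrite ger0_norm ?density_ge0.
  have [_ ->] := Hs_is_fourier (curve_diff_fourier t' t) Id.
  apply: (@le_trans _ _ (\int[mu]_xi ((L * r) ^+ 2 * (C * lorentz xi)))).
    by apply: le_Rintegral.
  rewrite RintegralZl//; last by apply: intgZl; exact: intg_lorentz.
  rewrite RintegralZl//; last exact: intg_lorentz.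
  by rewrite le_eqVlt; apply/orP; left; apply/eqP; rewrite /M -/(@lorentz_mass R) -/r; ring.
exists (e / (1 + M)); first by rewrite divr_gt0// ltr_wpDr.
move=> t' t'T; rewrite ltr_pdivlMr ?ltr_wpDr// => hd.
have r0 := normr_ge0 (t' - t).
rewrite -(@ltr_pXn2r _ 2)// ?nnegrE ?Hs_norm_ge0 ?(ltW e0)//.
apply: (le_lt_trans (B t' t'T)).
set r := `|t' - t| in hd r0 *.
have h1 : (r * (1 + M)) ^+ 2 < e ^+ 2.
  by rewrite ltr_pXn2r ?nnegrE ?mulr_ge0 ?addr_ge0// ltW.
apply: le_lt_trans h1; rewrite -subr_ge0.
have -> : (r * (1 + M)) ^+ 2 - M * r ^+ 2 = (1 + M + M ^+ 2) * r ^+ 2 by ring.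
by rewrite mulr_ge0 ?sqr_ge0// !addr_ge0 ?sqr_ge0.
Qed.

Definition velocity (z : R * R) : R := profile (fun xi => U (z.1, xi)) z.2.

Lemma measurable_velocity : measurable_fun setT velocity.
Proof.
have [mw _] : cmeas (fun z : R * R => wave (fun xi => U (z.1, xi)) z.2).
  refine (@cmeas_CI_param _ _ _ (fun w : (R * R) * R => U (w.1.1, w.2) * expi (w.1.2 * w.2)) _).
  have m11 : measurable_fun setT (fun z : (R * R) * R => z.1.1).
    exact: (measurableT_comp measurable_fst measurable_fst).
  have m12 : measurable_fun setT (fun z : (R * R) * R => z.1.2).
    exact: (measurableT_comp measurable_snd measurable_fst).
  apply: cmeasM.
    apply: (@cmeas_comp _ _ _ _ _ U (fun z : (R * R) * R => (z.1.1, z.2)) mU).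
    by apply/measurable_fun_pairP; split => //=; exact: measurable_snd.
  by apply: cmeas_expi; apply: measurable_funM => //; exact: measurable_snd.
exact: measurable_funM.
Qed.

Lemma velocity_bounded : exists C : R, forall z, `|velocity z| <= C.
Proof.
exists ((2 * pi)^-1 * \int[mu]_xi (c * lorentz xi * 2)) => -[t x].
rewrite /velocity /profile normrM ger0_norm ?invr_ge0 ?mulr_ge0 ?pi_ge0// ler_wpM2l//.
  by rewrite invr_ge0 mulr_ge0 ?pi_ge0.
apply: (le_trans (Re_n1 _)); apply: n1_CI_dom.
- exact: (Cintegrable_cmeas (Cintegrable_wave (mUt t) (U_decay t) x)).
- by apply: intgZr; apply: intgZl; exact: intg_lorentz.
- move=> xi /=; apply: n1M_le; last exact: n1_expi.
  apply: (le_trans (hU _ _)); rewrite ler_wpM2l//; exact: W_lorentz.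
Qed.

Lemma curve_represented : represented_by T curve velocity.
Proof.
split; first exact: measurable_velocity.
- move=> a b n a0 bT; have [C hC] := velocity_bounded.
  have mD : measurable (`[a, b] `*` `[- n, n] : set (R * R)).
    by apply: measurableX; exact: measurable_itv.
  apply: (@le_lt_trans _ _ (\int[mu \x mu]_(z in `[a, b] `*` `[(- n)%R, n]) (cst ((C ^+ 2)%:E) z))%E).
    apply: ge0_le_integral => //.
    + by move=> z _; rewrite lee_fin sqr_ge0.
    + apply/measurable_EFinP; apply: measurable_funX.
      exact: measurable_funTS measurable_velocity.
    + move=> z _; rewrite lee_fin -[velocity z ^+ 2]real_normK ?num_real//.
      by rewrite lerXn2r ?nnegrE//; exact: le_trans (hC z).
  have E := @product_measure1E _ _ (measurableTypeR R) (measurableTypeR R) R mu mu _ _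
    (measurable_itv `[a, b]%R) (measurable_itv `[(- n)%R, n]%R).
  have F (a' b' : R) : exists r : R, mu `[a', b'] = r%:E.
    rewrite lebesgue_measure_itv /=; case: ifP => _; last by exists 0.
    by exists (b' - a'); rewrite EFinB.
  have [r1 E1] := F a b; have [r2 E2] := F (- n) n.
  rewrite integral_cst// [X in (_ * X)%E]E [X in (_ * (X * _))%E]E1 [X in (_ * (_ * X))%E]E2.
  by rewrite -!EFinM ltry.
- apply: aeW => t _ psi _.
  exact: (profile_pairing (mUt t) (U_decay t) (U_cj t) (intg_schwartz psi)).
Qed.

Lemma multiplier_curve (m : R -> R[i]) t psi : cmeas m ->
  multiplier m (curve t) psi = Re (Cintegral (fun xi => m xi * U (t, xi) * inv_fourier psi xi)).
Proof.
move=> mm; congr (Re _); have Ip := intg_schwartz psi.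
have mi := cmeas_inv_fourier (intg_meas Ip).
have hf : has_fourier (curve t) by exists (fun xi => U (t, xi)); exact: curve_is_fourier.
have [mf _] := fhatP hf.
apply: CI_ae_eq.
- by apply: cmeasM => //; exact: cmeasM.
- by apply: cmeasM => //; exact: cmeasM.
- by apply: ae_imp (fhat_ae (curve_is_fourier t)) => xi ->.
Qed.

Lemma hilbert_dxx_symbol xi :
  hilbert_symbol xi * dx_symbol xi ^+ 2 = 0 +i* (xi * `|xi|).
Proof.
rewrite /hilbert_symbol /dx_symbol expr2 normrEsg.
by apply: complex_ext; rewrite !ReImE /=; ring.
Qed.

Let cc xi : R[i] := 0 -i* (xi / (4 * pi)).

Let mcc : cmeas cc.
Proof.
split => /=; first exact: measurable_cst.
by apply: measurableT_comp => //; apply: measurable_funM.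
Qed.

Let cc_le xi : n1 (cc xi) <= 1 + xi ^+ 2.
Proof.
have pi1 : 1 <= pi :> R by have := pi_ge2 R; lra.
apply: (@le_trans _ _ `|xi|).
  rewrite /n1 /= normr0 add0r normrN normrM normfV ler_piMr// invf_le1 ger0_norm; lra.
rewrite -[xi ^+ 2]real_normK ?num_real//.
by have := sqr_ge0 (`|xi| - 2^-1); nra.
Qed.

Let symbol_le xi : n1 (symbol p xi) <= 2 * (1 + xi ^+ 2).
Proof.
rewrite /n1 /= (ger0_norm (p0 xi)) normrM normr_id -expr2 real_normK ?num_real//.
by have := p_le xi; lra.
Qed.

Let msymbol : cmeas (symbol p).
Proof. by split => //=; apply: measurable_funM => //; exact: measurableT_comp. Qed.

Let f := conv U U.
Let d : R := 4 * @lorentz_mass R * (c * c).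

Let f_exp t xi : (1 + xi ^+ 2) * n1 (f (t, xi)) <= d * expR (- `|xi|).
Proof.
have a := oneD_sqr_gt0 xi; have d0 := bnd_ge0 conv_b.
apply: (le_trans (ler_wpM2l (ltW a) (conv_b t xi))).
by rewrite mulrCA ler_wpM2l// W_exp1.
Qed.

Let n1M_exp (a b : R[i]) (C D xi : R) : 0 <= C -> n1 a <= C * (1 + xi ^+ 2) ->
  (1 + xi ^+ 2) * n1 b <= D * expR (- `|xi|) -> n1 (a * b) <= C * D * expR (- `|xi|).
Proof.
move=> C0 ha hb; apply: (le_trans (n1M a b)).
apply: (le_trans (ler_wpM2r (n1_ge0 b) ha)).
by rewrite -!mulrA ler_wpM2l.
Qed.

Section weak_equation.
Variables (theta : R -> R) (psi : schwartz R).
Hypothesis theta_smooth : smooth theta.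
Hypothesis theta_supp : compactly_supported_in `]0, T[ theta.
Hypothesis psi_supp : compactly_supported_in setT psi.

Let dtheta (t : R) : is_derive t 1 theta (derive1 theta t).
Proof. exact: (derivable_is_derive (@theta_smooth 0%N t)). Qed.

Let cdtheta : continuous (derive1 theta).
Proof.
apply: (@derive_continuous _ _ (derive1 (derive1 theta))) => t.
exact: (derivable_is_derive (@theta_smooth 1%N t)).
Qed.

Let theta_out t : ~ (`]0, T[%classic : set R) t -> theta t = 0.
Proof.
have [a [b [sub zero]]] := theta_supp => nt; apply: zero => /sub; exact: nt.
Qed.

Let theta0 : theta 0 = 0.
Proof. by apply: theta_out; rewrite /= in_itv /= ltxx. Qed.
Let thetaT : theta T = 0.
Proof. by apply: theta_out; rewrite /= in_itv /= ltxx andbF. Qed.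

Let G t xi : R[i] := (adj p theta t xi * U (t, xi) - (theta t)%:C * (cc xi * f (t, xi))).

Let integrandE t : - derive1 theta t * curve t psi + theta t *
    (hilbert_dxx (curve t) psi + multiplier (fun xi => (p xi)%:C) (curve t) psi
     - \int[mu]_x (velocity (t, x) ^+ 2 / 2 * derive1 psi x)) =
  Re (Cintegral (fun xi => G t xi * inv_fourier psi xi)).
Proof.
pose s1 xi : R[i] := 0 +i* (xi * `|xi|).
have ms1 : cmeas s1.
  split => /=; first exact: measurable_cst.
  by apply: measurable_funM => //; exact: measurableT_comp.
have ms2 : cmeas (fun xi => (p xi)%:C) by exact: cmeas_real.
have -> : hilbert_dxx (curve t) psi = multiplier s1 (curve t) psi.
  by rewrite /hilbert_dxx (funext hilbert_dxx_symbol).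
rewrite !multiplier_curve//.
rewrite (profile_flux (mUt t) (U_decay t) (U_cj t) psi_supp).
rewrite -[selfconv _]/(fun xi => f (t, xi)).
have I0 : Cintegrable (fun xi => U (t, xi) * inv_fourier psi xi).
  exact: (Cintegrable_pairing psi (mUt t) (U_exp0 t)).
have I1 : Cintegrable (fun xi => s1 xi * U (t, xi) * inv_fourier psi xi).
  apply: (Cintegrable_pairing psi (d := 1 * c)); first exact: cmeasM.
  move=> xi; apply: n1M_exp (U_exp t xi) => //.
  rewrite mul1r /n1 /= normr0 add0r normrM normr_id -expr2 real_normK ?num_real//.
  by rewrite lerDr.
have I2 : Cintegrable (fun xi => (p xi)%:C * U (t, xi) * inv_fourier psi xi).
  apply: (Cintegrable_pairing psi (d := 1 * c)); first exact: cmeasM.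
  by move=> xi; apply: n1M_exp (U_exp t xi) => //; rewrite n1_real ger0_norm// mul1r.
have I3 : Cintegrable (fun xi => cc xi * f (t, xi) * inv_fourier psi xi).
  apply: (Cintegrable_pairing psi (d := 1 * d)).
    by apply: cmeasM => //; exact: cmeas_pair1 (cmeas_conv mU mU).
  by move=> xi; apply: n1M_exp (f_exp t xi) => //; rewrite mul1r.
have J0 := CintegrableZ (- derive1 theta t)%:C I0.
have J1 := CintegrableZ (theta t)%:C I1.
have J2 := CintegrableZ (theta t)%:C I2.
have J3 := CintegrableZ (theta t)%:C I3.
have E xi : G t xi * inv_fourier psi xi =
   (((- derive1 theta t)%:C * (U (t, xi) * inv_fourier psi xi) +
   (theta t)%:C * (s1 xi * U (t, xi) * inv_fourier psi xi)) +
   (theta t)%:C * ((p xi)%:C * U (t, xi) * inv_fourier psi xi)) -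
   (theta t)%:C * (cc xi * f (t, xi) * inv_fourier psi xi).
  have e : symbol p xi = s1 xi + (p xi)%:C.
    by apply: complex_ext; rewrite !ReImE /=; ring.
  by rewrite /G /adj e; ring.
rewrite (eq_CI E) (CIB (CintegrableD (CintegrableD J0 J1) J2) J3)
  (CID (CintegrableD J0 J1) J2) (CID J0 J1) (CIZ _ I0) (CIZ _ I1) (CIZ _ I2) (CIZ _ I3).
rewrite /curve cReD cReN !cReD !cReM /= !mul0r !subr0.
set X0 := \int[mu]_x _; set X1 := \int[mu]_x _; set X2 := \int[mu]_x _; set X3 := \int[mu]_x _.
ring.
Qed.

(** Fubini in time and frequency reduces the equation to the scalar identities
  [mild_weak], one for each frequency. *)
Lemma curve_weak :
  \int[mu]_(t in `[0, T])
    (- derive1 theta t * curve t psi + theta t *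
    (hilbert_dxx (curve t) psi + multiplier (fun xi => (p xi)%:C) (curve t) psi
     - \int[mu]_x (velocity (t, x) ^+ 2 / 2 * derive1 psi x))) = 0.
Proof.
pose h (z : R * R) : R[i] := (if 0 <= z.1 <= T then G z.1 z.2 else 0) * inv_fourier psi z.2.
have Ip := intg_schwartz psi; have [C C0 hC] := inv_fourier_bounded Ip.
have d0 : 0 <= d := bnd_ge0 conv_b.
have mU_pair (z : R * R) : U (z.1, z.2) = U z by rewrite -surjective_pairing.
have mG : cmeas (fun z : R * R => G z.1 z.2).
  apply: cmeasB.
    apply: cmeasM; first exact: (cmeas_adj mp dtheta cdtheta).
    exact: (cmeas_ext mU_pair mU).
  apply: cmeasM.
    have ct : continuous theta by exact: derive_continuous dtheta.
    by apply: cmeas_real; exact: (measurableT_comp (continuous_meas ct) measurable_fst).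
  apply: cmeasM; first exact: (cmeas_comp mcc measurable_snd).
  by under [X in cmeas X]eq_fun do rewrite -surjective_pairing; exact: cmeas_conv.
have m0 : measurable [set t : R | 0 <= t <= T].
  rewrite (_ : [set t : R | 0 <= t <= T] = `[0, T]%classic); first exact: measurable_itv.
  by apply/seteqP; split => t /=; rewrite in_itv.
have mG' : cmeas (fun z : R * R => if 0 <= z.1 <= T then G z.1 z.2 else 0).
  apply: (@cmeas_if _ _ _ (fun z : R * R => 0 <= z.1 <= T)) => //.
  by have := @measurable_fst _ _ R R measurableT _ m0; rewrite setTI.
have mh : cmeas h.
  apply: cmeasM => //.
  exact: (cmeas_comp (cmeas_inv_fourier (intg_meas Ip)) measurable_snd).
have hAB t xi : n1 (h (t, xi)) <= adj_dom T theta t * ((3 * c + d) * (2 * lorentz xi) * C).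
  rewrite mulrA; apply: n1M_le => //=; rewrite /adj_dom indic_itvE.
  case: ifP => tT; last by rewrite n10 mulr0 mul0r.
  rewrite mulr1; have e := exp_abs_lorentz xi.
  have th0 := normr_ge0 (theta t); have th1 := normr_ge0 (derive1 theta t).
  set D := `|derive1 theta t| + `|theta t|.
  have D0 : 0 <= D by rewrite addr_ge0.
  have a1 : 1 <= 1 + xi ^+ 2 by rewrite lerDl sqr_ge0.
  have A : n1 (adj p theta t xi * U (t, xi)) <= D * 3 * c * expR (- `|xi|).
    apply: n1M_exp (U_exp t xi); first by rewrite mulr_ge0.
    apply: (le_trans (n1_adj p theta t xi)); rewrite -mulrA ler_wpM2l//.
    by have := symbol_le xi; lra.
  have B : n1 ((theta t)%:C * (cc xi * f (t, xi))) <= D * d * expR (- `|xi|).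
    rewrite n1Zl -mulrA; apply: ler_pM => //; rewrite ?n1_ge0//.
      by rewrite /D lerDr.
    rewrite -[d]mul1r; apply: n1M_exp (f_exp t xi) => //; by rewrite mul1r.
  apply: (le_trans (n1B _ _)); apply: (le_trans (lerD A B)).
  have -> : D * 3 * c * expR (- `|xi|) + D * d * expR (- `|xi|) = D * ((3 * c + d) * expR (- `|xi|)) by ring.
  by rewrite ler_wpM2l// ler_wpM2l// addr_ge0// mulr_ge0.
have iA : intg (adj_dom T theta) := intg_adj_dom T dtheta cdtheta.
have iB : intg (fun xi => (3 * c + d) * (2 * lorentz xi) * C).
  by apply: intgZr; apply: intgZl; apply: intgZl; exact: intg_lorentz.
rewrite [LHS]Rintegral_mkcond.
rewrite (eq_Rint (g := fun t => Re (Cintegral (fun xi => h (t, xi))))); last first.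
  move=> t; rewrite patchE; have -> : (t \in `[0, T]%classic) = (0 <= t <= T).
    by apply/idP/idP; rewrite inE /= in_itv.
  case: ifP => tT.
    by rewrite integrandE; congr Re; apply: eq_CI => xi; rewrite /h /= tT.
  by rewrite (@eq_CI _ _ (fun=> 0)) ?CI0// => xi; rewrite /h /= tT mul0r.
rewrite -ReCI (CI_fubini mh iA iB hAB) (@eq_CI _ _ (fun=> 0)) ?CI0// => xi.
have I xi' : Cintegrable (fun t => if 0 <= t <= T then adj p theta t xi' * U (t, xi') else 0).
  apply: (Cintegrable_dom _ (intgZr (1 + n1 (symbol p xi')) (intgZr c iA))).
    apply: (@cmeas_if _ _ _ (fun t : R => 0 <= t <= T)) => //.
    apply: cmeasM; last exact: cmeas_pair2.
    exact: cmeas_pair2 (cmeas_adj mp dtheta cdtheta).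
  move=> t; rewrite /adj_dom indic_itvE; case: ifP => _; last by rewrite n10 mulr0 !mul0r.
  rewrite mulr1 mulrAC; apply: n1M_le; first exact: n1_adj.
  apply: (le_trans (hU t xi')); rewrite ler_piMr//.
  by apply: le_trans (W_lorentz T0 _ _) _; exact: lorentz_le1.
have J xi' : Cintegrable (fun t => if 0 <= t <= T then (theta t)%:C * (cc xi' * f (t, xi')) else 0).
  apply: (Cintegrable_dom _ (intgZr (n1 (cc xi') * d) iA)).
    apply: (@cmeas_if _ _ _ (fun t : R => 0 <= t <= T)) => //.
    apply: cmeasM.
      have ct : continuous theta by exact: derive_continuous dtheta.
      by apply: cmeas_real; exact: continuous_meas.
    by apply: cmeasM; [exact: cmeas_cst|exact: cmeas_pair2 (cmeas_conv mU mU)].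
  move=> t; rewrite /adj_dom indic_itvE; case: ifP => _; last by rewrite n10 mulr0 !mul0r.
  rewrite mulr1 n1Zl; apply: ler_pM; rewrite ?n1_ge0 ?lerDr//.
  apply: n1M_le => //; apply: (le_trans (conv_b t xi')); rewrite ler_piMr//.
  by apply: le_trans (W_lorentz T0 _ _) _; exact: lorentz_le1.
rewrite /h /= CIZr; last first.
  have := CintegrableB (I xi) (J xi); congr Cintegrable; apply/funext => t.
  by case: ifP => _; rewrite ?subr0.
rewrite (@eq_CI _ _ (fun t => (if 0 <= t <= T then adj p theta t xi * U (t, xi) else 0) -
   (if 0 <= t <= T then (theta t)%:C * (cc xi * f (t, xi)) else 0))); last first.
  by move=> t; case: ifP => _; rewrite ?subr0.
rewrite (CIB (I xi) (J xi)) (mild_weak T0 mp p0 dtheta cdtheta theta0 thetaT (cmeas_conv mU mU) conv_b UE).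
by rewrite subrr mul0r.
Qed.

End weak_equation.
End curve.

(** * Second order coefficients, and the symbol of the dissipation *)

Section second_derivative.
Context {R : realType}.

(** The sum [g x + g (- x)] has no linear term: the mean value theorem bounds it by
  [2 M x^2], and the expansion makes it [2 x^2 B] up to [O(x^3)]. *)
Lemma quadratic_coefficient (g D : R -> R) (x1 A B C M : R) : 0 < x1 ->
  (forall x : R, `|x| < x1 -> is_derive x 1 g (D x)) ->
  (forall x : R, `|x| < x1 -> `|D x - D 0| <= M * `|x|) ->
  (forall x : R, `|x| < x1 -> `|g x - (x * A + x ^+ 2 * B)| <= C * `|x| ^+ 3) ->
  `|B| <= M.
Proof.
move=> x10 dg hD hg.
have g0 : g 0 = 0.
  have := hg 0; rewrite normr0 !mul0r expr0n /= mul0r addr0 subr0 exprS !mul0r mulr0.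
  by move=> /(_ x10); rewrite normr_le0 => /eqP.
have key x : 0 < x < x1 -> `|B| <= M + C * x.
  move=> /andP[x0 xx1].
  pose psi y := g y + g (- y).
  have small y : 0 <= y <= x -> `|y| < x1.
    by move=> /andP[y0 yx]; rewrite ger0_norm// (le_lt_trans yx).
  have dpsi y : 0 <= y <= x -> is_derive y 1 psi (D y - D (- y)).
    move=> yx; have d1 := dg y (small y yx).
    have d2 : is_derive (- y) 1 g (D (- y)) by apply: dg; rewrite normrN; exact: small.
    have d3 : is_derive y 1 (fun z : R => - z) (-1) by exact: dN (did y).
    apply: (deq (dD d1 (@is_derive1_comp R g (fun z => - z) y _ _ d2 d3))); ring.
  have cpsi : {within `[0, x], continuous psi}.
    apply: derivable_within_continuous => y; rewrite in_itv /= => yx.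
    exact: is_derive_derivable (dpsi y yx).
  have dpsi' y : (y \in `]0, x[%R) -> is_derive y 1 psi (D y - D (- y)).
    by rewrite in_itv /= => /andP[a b]; apply: dpsi; rewrite !ltW.
  have [z] := @MVT R psi (fun y => D y - D (- y)) 0 x x0 dpsi' cpsi.
  rewrite in_itv /= subr0 => /andP[z0 zx].
  rewrite /psi oppr0 g0 addr0 subr0 => E.
  have zb : `|z| < x1 by apply: small; rewrite !ltW.
  have h1 := hD z zb; have h2 : `|D (- z) - D 0| <= M * `|z|.
    by rewrite -[X in M * X]normrN; apply: hD; rewrite normrN.
  rewrite (gtr0_norm z0) in h1 h2.
  have M0 : 0 <= M by have := le_trans (normr_ge0 _) h1; rewrite pmulr_lge0.
  have h3 : `|g x + g (- x)| <= 2 * M * x ^+ 2.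
    rewrite E normrM (gtr0_norm x0).
    have -> : D z - D (- z) = (D z - D 0) - (D (- z) - D 0) by ring.
    have := ler_normB (D z - D 0) (D (- z) - D 0).
    set n := `|_ - _ - _| => h4.
    apply: (@le_trans _ _ ((2 * M * x) * x)); last by rewrite -mulrA -expr2.
    by rewrite ler_wpM2r ?(ltW x0)//; have := ler_wpM2l M0 (ltW zx); lra.
  have xb : `|x| < x1 by rewrite gtr0_norm.
  have e1 := hg x xb; have e2 := hg (- x); rewrite normrN in e2; have {}e2 := e2 xb.
  rewrite (gtr0_norm x0) in e1 e2.
  have x2 : 0 < x ^+ 2 by rewrite exprn_gt0.
  have h5 : `|2 * x ^+ 2 * B| <= 2 * (M + C * x) * x ^+ 2.
    have -> : 2 * x ^+ 2 * B = (g x + g (- x)) -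
       ((g x - (x * A + x ^+ 2 * B)) + (g (- x) - (- x * A + (- x) ^+ 2 * B))) by ring.
    apply: (le_trans (ler_normB _ _)); apply: (le_trans (lerD h3 (ler_normD _ _))).
    have -> : 2 * (M + C * x) * x ^+ 2 = 2 * M * x ^+ 2 + (C * x ^+ 3 + C * x ^+ 3) by ring.
    by rewrite lerD2l; exact: lerD.
  have x20 : 0 <= 2 * x ^+ 2 by rewrite mulr_ge0 ?(ltW x2).
  move: h5; rewrite normrM (ger0_norm x20).
  have -> : 2 * x ^+ 2 * `|B| = 2 * `|B| * x ^+ 2 by ring.
  by rewrite ler_pM2r// ler_pM2l.
apply/ler_addgt0Pr => e e0.
pose x := Num.min (x1 / 2) (e / (1 + `|C|)).
have C1 : 0 < 1 + `|C| by rewrite ltr_wpDr.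
have x0 : 0 < x by rewrite lt_min !divr_gt0.
have xx1 : x < x1 by rewrite gt_min; apply/orP; left; rewrite ltr_pdivrMr//; lra.
apply: (le_trans (key x _)); first by rewrite x0.
rewrite lerD2l; apply: (@le_trans _ _ ((1 + `|C|) * x)).
  by rewrite ler_wpM2r ?(ltW x0)//; have := ler_norm C; lra.
by rewrite mulrC -ler_pdivlMr// ge_min lexx orbT.
Qed.

End second_derivative.

Section power_symbol.
Context {R : realType}.
Variable alpha : R.
Hypothesis alpha01 : 0 <= alpha < 1.

Definition power_symbol (xi : R) : R := `|xi| `^ alpha.

Lemma measurable_power_symbol : measurable_fun setT power_symbol.
Proof. by apply: (measurableT_comp (measurable_powR alpha)). Qed.
Lemma power_symbol_ge0 xi : 0 <= power_symbol xi.
Proof. exact: powR_ge0. Qed.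
Lemma power_symbol_even xi : power_symbol (- xi) = power_symbol xi.
Proof. by rewrite /power_symbol normrN. Qed.
Lemma power_symbol_le_dilate (N xi : R) : 0 < N -> `|xi| <= 2 * N ->
  power_symbol xi <= 2 * N `^ alpha.
Proof.
move=> N0 h; have /andP[a0 a1] := alpha01.
apply: (@le_trans _ _ ((2 * N) `^ alpha)).
  by apply: ge0_ler_powR => //; rewrite nnegrE// mulr_ge0// ltW.
rewrite powRM ?(ltW N0)// ler_wpM2r ?powR_ge0//.
by rewrite -[leRHS]powRr1// ler_powR ?ler1n// ltW.
Qed.
Lemma power_symbol_le xi : power_symbol xi <= 1 + xi ^+ 2.
Proof.
have /andP[a0 a1] := alpha01.
rewrite /power_symbol -[xi ^+ 2]real_normK ?num_real//.
have n0 := normr_ge0 xi; have [x1|x1] := leP 1 `|xi|.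
  apply: (@le_trans _ _ (`|xi| `^ 1)); first by rewrite ler_powR// ltW.
  by rewrite powRr1//; have := sqr_ge0 (`|xi| - 2^-1); nra.
apply: (@le_trans _ _ (1 `^ alpha)).
  by apply: ge0_ler_powR => //; rewrite ?nnegrE ?ler01// ltW.
by rewrite powR1 lerDl sqr_ge0.
Qed.

End power_symbol.

(** * Scalar functionals of a flow of class C^2 *)

Section flow_functional.
Context {R : realType}.

(** The definition of the derivative in the form in which Frechet differentiability
  supplies it. *)
Lemma is_derive_epsilon (f : R -> R) (x l : R) :
  (forall e : R, 0 < e -> exists2 d : R, 0 < d &
     forall y : R, `|y| < d -> `|f (x + y) - f x - y * l| <= e * `|y|) ->
  is_derive x 1 f l.
Proof.
move=> H.
have C : (fun y : R => y^-1 *: (f (y *: (1 : R) + x) - f x)) y @[y --> 0^'] --> l.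
  apply/cvgrPdist_le => e e0; have [d d0 hd] := H e e0.
  near=> y.
  have y0 : y != 0 by near: y; exact: nbhs_dnbhs_neq.
  have yd : `|y| < d.
    near: y; apply: dnbhs0_lt => //.
  have := hd y yd.
  rewrite -ler_pdivrMr ?normr_gt0// -normfV -normrM => h.
  apply: le_trans h; rewrite le_eqVlt; apply/orP; left; apply/eqP.
  rewrite /GRing.scale /= mulr1 [y + x]addrC -normrN; congr (`|_|); field.
  exact: y0.
have D : derivable f x 1 by apply/cvg_ex; exists l.
apply: DeriveDef => //; exact: (cvg_lim (@Rhausdorff R) C).
Unshelve. all: by end_near.
Qed.

Variables (s T r : R) (flow : dist R -> R -> dist R).
Hypothesis r0 : 0 < r.
Hypothesis flow_C2 :
  class_C2 (Hs s) (Hs_norm s) (CHs s T) (CHs_norm s T) (Hs_ball s r) flow.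

Lemma Hs_ball_scaled (phi : dist R) (x : R) : Hs s phi ->
  `|x| < r / (1 + Hs_norm s phi) -> Hs_ball s r (x *: phi).
Proof.
move=> hp hx; have [h1 h2] := HsZ x hp; split => //=.
have n0 := Hs_norm_ge0 s phi; have n1 : 0 < 1 + Hs_norm s phi by rewrite ltr_wpDr.
rewrite ltr_pdivlMr// in hx.
by rewrite h2; have := normr_ge0 x; nra.
Qed.

(** At the origin the derivative of the flow is Lipschitz because the second derivative
  is bounded there, and a bounded functional preserves this. The constant [C] is chosen
  before the datum, which will vary with [N]. *)
Lemma flow_functional_derivative : exists2 C : R, 0 <= C &
  forall (phi : dist R) (t a b c : R) (lam : R[i]), Hs s phi -> 0 <= t <= T ->
    a <= b -> 0 < c -> n1 lam <= 2 ->
    (forall xi, a <= xi <= b -> c <= weight s xi) ->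
  exists (x1 : R) (D : R -> R), [/\ 0 < x1,
    forall x : R, `|x| < x1 ->
      is_derive x 1 (fun y : R => window a b lam (flow (y *: phi) t)) (D x) &
    forall x : R, `|x| < x1 -> `|D x - D 0| <=
      Num.sqrt (8 * (b - a) / c) * (C * Hs_norm s phi ^+ 2) * `|x|].
Proof.
have [FY [DF [D2F HC]]] := flow_C2.
have B0 : Hs_ball s r 0 by have [h1 h2] := @Hs0 R s; split => //=; rewrite h2.
have [_ [D2Y _ _ [C hC]] _ D2 _] := HC 0 B0.
have [d d0 hd] := D2 1 ltr01.
exists (1 + `|C|) => [|phi t a b c lam hp tT ab c0 lam2 wc]; first by rewrite addr_ge0.
set L := Num.sqrt _; have L0 : 0 <= L by exact: sqrtr_ge0.
pose n := Hs_norm s phi; have n0 : 0 <= n by exact: Hs_norm_ge0.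
have n1 : 0 < 1 + n by rewrite ltr_wpDr.
pose l := window a b lam.
have lB w w' : Hs s w -> Hs s w' -> l (w - w') = l w - l w'.
  move=> hw hw'; have := window_lin lam c0 wc (-1) hw' hw.
  by rewrite scaleN1r mulN1r [- w' + w]addrC [- _ + _ in RHS]addrC.
have l_le w : Hs s w -> `|l w| <= L * Hs_norm s w by move=> hw; exact: window_bound.
have ball x : `|x| < r / (1 + n) -> Hs_ball s r (x *: phi) by exact: Hs_ball_scaled.
pose x1 := Num.min (r / (1 + n)) (d / (1 + n)).
exists x1, (fun x => l (DF (x *: phi) phi t)); split.
- by rewrite lt_min !divr_gt0.
- move=> x; rewrite lt_min => /andP[xr _].
  have [[DY Dlin _] _ F1 _ _] := HC _ (ball x xr).
  apply: is_derive_epsilon => e e0.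
  have [d' d'0 hd'] := F1 (e / (1 + L * n)) (divr_gt0 e0 (ltr_wpDr (mulr_ge0 L0 n0) ltr01)).
  exists (Num.min (r / (1 + n) - `|x|) (d' / (1 + n))).
    by rewrite lt_min subr_gt0 xr divr_gt0.
  move=> y; rewrite lt_min => /andP[y1 y2].
  have [hy ny] := HsZ y hp.
  have xy : `|x + y| < r / (1 + n) by have := ler_normD x y; lra.
  have E1 : Hs_ball s r (x *: phi + y *: phi) by rewrite -scalerDl; exact: ball.
  have E2 : Hs_norm s (y *: phi) < d'.
    rewrite ny -/n; move: y2; rewrite ltr_pdivlMr//; have := normr_ge0 y; nra.
  have := hd' _ hy E1 E2; rewrite -scalerDl ny -/n => h1.
  have DE : DF (x *: phi) (y *: phi) = y *: DF (x *: phi) phi.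
    have -> : y *: phi = (y - 1) *: phi + phi by rewrite -[X in _ + X]scale1r -scalerDl subrK.
    by rewrite Dlin// -[X in _ + X]scale1r -scalerDl subrK.
  have c1 := FY _ (ball _ xy); have c2 := FY _ (ball _ xr).
  have c3 : CHs s T (DF (x *: phi) (y *: phi)) by exact: DY.
  have c4 := CHsB (CHsB c1 c2) c3.
  have h2 := le_trans (CHs_bounded c4 tT) h1.
  have b1 := c1.1 t tT; have b2 := c2.1 t tT; have b3 := c3.1 t tT.
  have b12 := (HsB b1 b2).1; have b4 := c4.1 t tT.
  have E : l (flow ((x + y) *: phi) t) - l (flow (x *: phi) t) - y * l (DF (x *: phi) phi t) =
     l ((flow ((x + y) *: phi) - flow (x *: phi) - DF (x *: phi) (y *: phi)) t).
    rewrite -[RHS]/(l (flow ((x + y) *: phi) t - flow (x *: phi) t - DF (x *: phi) (y *: phi) t)).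
    rewrite (lB _ _ b12 b3) (lB _ _ b1 b2); congr (_ - _).
    have b5 := (DY phi hp).1 t tT.
    have := window_lin lam c0 wc (y - 1) b5 b5.
    rewrite DE -/l -[(y *: DF (x *: phi) phi) t]/(y *: DF (x *: phi) phi t).
    rewrite -[X in _ *: _ + X]scale1r -scalerDl subrK => ->; ring.
  rewrite E; apply: (le_trans (l_le _ b4)); apply: (le_trans (ler_wpM2l L0 h2)).
  have -> : L * (e / (1 + L * n) * (`|y| * n)) = (L * n) / (1 + L * n) * (e * `|y|) by ring.
  rewrite ler_piMl ?mulr_ge0 ?(ltW e0)// ler_pdivrMr ?mul1r ?lerDr//.
  by rewrite ltr_wpDr// mulr_ge0.
- move=> x; rewrite lt_min => /andP[xr xd].
  have [hx nx] := HsZ x hp.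
  have E1 : Hs_ball s r (0 + x *: phi) by rewrite add0r; exact: ball.
  have E2 : Hs_norm s (x *: phi) < d.
    rewrite nx -/n; move: xd; rewrite ltr_pdivlMr//; have := normr_ge0 x; nra.
  have := hd _ hx E1 E2 _ hp; rewrite add0r nx -/n mul1r => h1.
  have h3 := hC _ _ hx hp; rewrite nx -/n in h3.
  have [[DY _ _] _ _ _ _] := HC _ (ball x xr).
  have [[DY0 _ _] _ _ _ _] := HC _ B0.
  have c1 := DY _ hp; have c2 := DY0 _ hp; have c3 := D2Y _ _ hx hp.
  have c4 := CHsB (CHsB c1 c2) c3.
  have h2 := le_trans (CHs_bounded c4 tT) h1; have {}h3 := le_trans (CHs_bounded c3 tT) h3.
  have b1 := c1.1 t tT; have b2 := c2.1 t tT; have b3 := c3.1 t tT.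
  have b12 := (HsB b1 b2).1; have b4 := c4.1 t tT.
  have E : l (DF (x *: phi) phi t) - l (DF 0 phi t) =
     l ((DF (x *: phi) phi - DF 0 phi - D2F 0 (x *: phi) phi) t) + l (D2F 0 (x *: phi) phi t).
    rewrite -[X in _ = X + _]/(l (DF (x *: phi) phi t - DF 0 phi t - D2F 0 (x *: phi) phi t)).
    by rewrite (lB _ _ b12 b3) (lB _ _ b1 b2) subrK.
  rewrite scale0r E; apply: (le_trans (ler_normD _ _)).
  apply: (le_trans (lerD (l_le _ b4) (l_le _ b3))).
  apply: (le_trans (lerD (ler_wpM2l L0 h2) (ler_wpM2l L0 h3))).
  have -> : L * (`|x| * n * n) + L * (C * (`|x| * n) * n) = L * ((1 + C) * n ^+ 2) * `|x| by ring.
  rewrite ler_wpM2r// ler_wpM2l// ler_wpM2r ?sqr_ge0// lerD2l; exact: ler_norm.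
Qed.

End flow_functional.

(** * The second order term of the flow *)

Section flow_expansion.
Context {R : realType}.
Notation mu := (@lebesgue_measure R).
Notation Re := complex.Re.
Notation Im := complex.Im.
Variables (alpha s T : R).
Hypothesis alpha01 : 0 <= alpha < 1.
Hypothesis T_gt0 : 0 < T.
Variables (h : R -> R[i]) (H : R).
Hypothesis mh : cmeas h.
Hypothesis hH : forall xi, n1 (h xi) <= H * W T 0 xi.
Hypothesis h_cj : forall xi, h (- xi) = cj (h xi).

Notation p := (power_symbol alpha).
Let T0 : 0 <= T. Proof. exact: ltW. Qed.
Let mp : measurable_fun setT p := @measurable_power_symbol R alpha.
Let p0 : forall xi, 0 <= p xi := @power_symbol_ge0 R alpha.
Let p_le : forall xi, p xi <= 1 + xi ^+ 2 := power_symbol_le alpha01.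
Let H0 : 0 <= H. Proof. exact: H_ge0 hH. Qed.

Definition datum : dist R :=
  fun psi => Re (Cintegral (fun xi => h xi * inv_fourier psi xi)).

Let h_decay xi : n1 (h xi) <= H * (expR (- `|xi|) * lorentz xi).
Proof. by apply: (le_trans (hH xi)); rewrite ler_wpM2l// W_exp. Qed.

Let Cint_h (psi : schwartz R) : Cintegrable (fun xi => h xi * inv_fourier psi xi).
Proof.
apply: (Cintegrable_pairing psi (d := H) mh) => xi.
apply: (le_trans (h_decay xi)); rewrite ler_wpM2l// ler_piMr ?expR_ge0//.
exact: lorentz_le1.
Qed.

Lemma datum_is_fourier : is_fourier datum h.
Proof.
split=> // psi; split; first exact: Cint_h.
exact: (pairing_real mh h_decay h_cj (intg_schwartz psi)).
Qed.

Notation sol := (sol T p h).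
Notation free := (free T p h).
Notation small := (small H).

Let UE x : small x -> forall z, sol x z =
  prop p (clamp T z.1) z.2 * (x%:C * h z.2) + quad T p (sol x) z.
Proof.
by move=> sx z; rewrite {1}(solE T0 mp p0 mh hH sx) /free mulrCA.
Qed.

Let quad_initial u xi : cmeas u -> quad T p u (0, xi) = 0.
Proof.
move=> mU; rewrite /quad /duhamel (@CI_ae_eq _ _ (fun=> 0)) ?CI0 ?mulr0//.
- by apply: cmeas_duh_integrand1 => //; exact: cmeas_conv.
- apply: ae_imp (ae_neq (0 : R)) => tau tau0; rewrite /duh_integrand clamp_id ?lexx//=.
  by rewrite -eq_le eq_sym (negbTE tau0).
Qed.

Lemma curve_initial x : small x -> curve (sol x) 0 = x *: datum.
Proof.
move=> sx; apply/funext => psi.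
rewrite -[RHS]/(x * datum psi) /curve.
have I := Cint_h psi.
rewrite (@eq_CI _ _ (fun xi => x%:C * (h xi * inv_fourier psi xi))); last first.
  move=> xi; rewrite (UE sx) (quad_initial _ (cmeas_sol T0 mp p0 mh hH sx)) addr0 /=.
  by rewrite clamp_id ?lexx// prop0 mul1r mulrA.
by rewrite (CIZ _ I) cReM /= mul0r subr0.
Qed.

(** Through uniqueness this identifies the flow at small multiples of the datum. *)
Lemma sol_solution x : small x -> solution alpha s T (x *: datum) (curve (sol x)).
Proof.
move=> sx; have ms := cmeas_sol T0 mp p0 mh hH sx.
have bs := sol_bnd T0 mp p0 mh hH sx.
have cs := hermitian_sol T0 mp p0 mh hH (@power_symbol_even R alpha) h_cj sx.
split.
- exact: (@curve_CHs _ _ _ T_gt0 mp p0 p_le (fun xi => x%:C * h xi) _ _ ms bs cs (UE sx)).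
- exact: curve_initial.
exists (velocity (sol x)); first exact: (curve_represented T_gt0 ms bs cs).
move=> theta psi th1 th2 psi1.
have E := @curve_weak _ _ _ T_gt0 mp p0 p_le (fun xi => x%:C * h xi) _ _ ms bs cs (UE sx)
  theta psi th1 th2 psi1.
rewrite -[RHS]E. apply: eq_Rintegral => t _. reflexivity.
Qed.

Lemma datum_Hs : Hs s datum /\
  Hs_norm s datum ^+ 2 = \int[mu]_xi (weight s xi * sqnorm (h xi)).
Proof.
have [C C0 hC] := weight_exp_lorentz s.
apply: (Hs_is_fourier datum_is_fourier).
apply: (intg_dom _ (intgZl (H ^+ 2) (intgZl C intg_lorentz))).
  by apply: measurable_density.
move=> xi; rewrite ger0_norm ?density_ge0//.
have e0 := expR_ge0 (- `|xi|).
have e1 : expR (- `|xi|) <= 1 by rewrite -expR0 ler_expR oppr_le0.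
have l0 := ltW (lorentz_gt0 xi); have l1 := lorentz_le1 xi.
have q : sqnorm (h xi) <= H ^+ 2 * expR (- `|xi|).
  apply: (le_trans (sqnorm_n1 _)).
  apply: (@le_trans _ _ ((H * expR (- `|xi|)) ^+ 2)).
    rewrite lerXn2r ?nnegrE ?n1_ge0 ?mulr_ge0//.
    by apply: (le_trans (h_decay xi)); rewrite ler_wpM2l// ler_piMr.
  by rewrite exprMn ler_wpM2l ?sqr_ge0// expr2 ler_piMl.
apply: (le_trans (ler_wpM2l (ltW (weight_gt0 s xi)) q)).
by rewrite mulrCA ler_wpM2l ?sqr_ge0.
Qed.

(** The second order term of the flow, in the direction of the datum, tested
  against a frequency window. *)
Definition second_iterate (t a b : R) (lam : R[i]) : R :=
  Re (lam * Cintegral (fun xi => (\1_(`[a, b]) xi)%:C * quad T p free (t, xi))).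

Let cint_window (u : R * R -> R[i]) d t (a b : R) : cmeas u -> bnd T d u ->
  Cintegrable (fun xi => (\1_(`[a, b]) xi)%:C * u (t, xi)).
Proof.
move=> mu_ hu; have d0 := bnd_ge0 hu.
apply: (Cintegrable_dom _ (intgZl d intg_lorentz)).
  apply: cmeasM; last exact: cmeas_pair1.
  by apply: cmeas_real; exact: measurable_indic_itv.
move=> xi; rewrite n1Zl -[leRHS]mul1r.
have /andP[i0 i1] := indic_01 `[a, b] xi.
rewrite ger0_norm//; apply: ler_pM; rewrite ?n1_ge0//.
by apply: (le_trans (hu t xi)); rewrite ler_wpM2l// W_lorentz.
Qed.

Let window_sol x t (a b : R) lam : small x ->
  window a b lam (curve (sol x) t) =
  Re (lam * Cintegral (fun xi => (\1_(`[a, b]) xi)%:C * sol x (t, xi))).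
Proof.
move=> sx; have ms := cmeas_sol T0 mp p0 mh hH sx.
have bs := sol_bnd T0 mp p0 mh hH sx.
have cs := hermitian_sol T0 mp p0 mh hH (@power_symbol_even R alpha) h_cj sx.
have F := curve_is_fourier T_gt0 ms bs cs t.
have mi : cmeas (fun xi : R => (\1_(`[a, b]) xi)%:C : R[i]).
  by apply: cmeas_real; exact: measurable_indic_itv.
congr (Re (_ * _)); apply: CI_ae_eq.
- by apply: cmeasM => //; have [] := fhatP (ex_intro _ _ F).
- by apply: cmeasM => //; exact: cmeas_pair1.
- by apply: ae_imp (fhat_ae F) => xi ->.
Qed.

(** The weight is integrable over frequencies, so the pointwise error of [sol_taylor]
  keeps its order in [x]. *)
Lemma window_sol_taylor (t a b : R) lam : n1 lam <= 2 ->
  exists A C : R, forall x, small x ->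
  `|window a b lam (curve (sol x) t) - (x * A + x ^+ 2 * second_iterate t a b lam)| <= C * `|x| ^+ 3.
Proof.
move=> lam2; pose ind xi : R[i] := (\1_(`[a, b]) xi)%:C.
have mf := cmeas_free T mp mh; have bf := free_bnd T0 p0 hH.
have mq := cmeas_quad T mp mf; have bq := quad_bnd T0 mp p0 mf bf.
pose C0 : R := 64 * (@K R) ^+ 2 * H ^+ 3 * 2.
exists (Re (lam * Cintegral (fun xi => ind xi * free (t, xi)))), (2 * (C0 * @lorentz_mass R)).
move=> x sx; rewrite (window_sol _ _ _ _ sx) /second_iterate.
have ms := cmeas_sol T0 mp p0 mh hH sx.
have bs := sol_bnd T0 mp p0 mh hH sx.
have I1 := cint_window t a b ms bs; have I2 := cint_window t a b mf bf.
have I3 := cint_window t a b mq bq.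
have J2 := CintegrableZ x%:C I2; have J3 := CintegrableZ (x ^+ 2)%:C I3.
have E : Re (lam * Cintegral (fun xi => ind xi * sol x (t, xi))) -
   (x * Re (lam * Cintegral (fun xi => ind xi * free (t, xi))) +
    x ^+ 2 * Re (lam * Cintegral (fun xi => ind xi * quad T p free (t, xi)))) =
   Re (lam * Cintegral (fun xi => ind xi * (sol x (t, xi) -
     (x%:C * free (t, xi) + (x ^+ 2)%:C * quad T p free (t, xi))))).
  rewrite (@eq_CI _ (fun xi => ind xi * (sol x (t, xi) - _)) (fun xi => ind xi * sol x (t, xi) -
    (x%:C * (ind xi * free (t, xi)) + (x ^+ 2)%:C * (ind xi * quad T p free (t, xi))))); last first.
    by move=> xi; ring.
  rewrite (CIB I1 (CintegrableD J2 J3)) (CID J2 J3) (CIZ _ I2) (CIZ _ I3).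
  set X1 := Cintegral _; set X2 := Cintegral _; set X3 := Cintegral _.
  rewrite !(cReM, cReD, cReN, cImM, cImD, cImN) /=; ring.
rewrite E; apply: (le_trans (Re_n1 _)).
have -> : 2 * (C0 * @lorentz_mass R) * `|x| ^+ 3 = 2 * (C0 * `|x| ^+ 3 * @lorentz_mass R) by ring.
apply: n1M_le => //.
have B := sol_taylor T0 mp p0 mh hH sx.
have c0 : 0 <= C0 * `|x| ^+ 3 by exact: bnd_ge0 B.
rewrite -RintegralZl//; last exact: intg_lorentz.
apply: n1_CI_dom.
- apply: cmeasM; first by apply: cmeas_real; exact: measurable_indic_itv.
  apply: cmeasB; first exact: cmeas_pair1.
  by apply: cmeasD; apply: cmeasM; do ?[exact: cmeas_cst|exact: cmeas_pair1].
- by apply: intgZl; exact: intg_lorentz.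
- move=> xi; rewrite n1Zl -[leRHS]mul1r.
  have /andP[i0 i1] := indic_01 `[a, b] xi.
  rewrite ger0_norm//; apply: ler_pM; rewrite ?n1_ge0//.
  by apply: (le_trans (B t xi)); rewrite ler_wpM2l// W_lorentz.
Qed.

End flow_expansion.

Section second_iterate_bound.
Context {R : realType}.
Variables (alpha s T r : R) (flow : dist R -> R -> dist R).
Hypothesis alpha01 : 0 <= alpha < 1.
Hypothesis T_gt0 : 0 < T.
Hypothesis r0 : 0 < r.
Hypothesis flow_solves : forall u0, Hs_ball s r u0 -> unique_solution alpha s T u0 (flow u0).
Hypothesis flow_C2 :
  class_C2 (Hs s) (Hs_norm s) (CHs s T) (CHs_norm s T) (Hs_ball s r) flow.

(** By uniqueness the flow along the ray of a datum is the curve with the expansion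
  [window_sol_taylor], and its differentiability bounds the quadratic coefficient. *)
Lemma second_iterate_le : exists2 C : R, 0 <= C &
  forall (h : R -> R[i]) (H t a b c : R) (lam : R[i]),
    cmeas h -> (forall xi, n1 (h xi) <= H * W T 0 xi) ->
    (forall xi, h (- xi) = cj (h xi)) ->
    0 <= t <= T -> a <= b -> 0 < c -> n1 lam <= 2 ->
    (forall xi, a <= xi <= b -> c <= weight s xi) ->
  `|second_iterate alpha T h t a b lam| <=
    Num.sqrt (8 * (b - a) / c) * (C * \int[@lebesgue_measure R]_xi (weight s xi * sqnorm (h xi))).
Proof.
have [C C0 HC] := flow_functional_derivative r0 flow_C2.
exists C => // h H t a b c lam mh hH h_cj tT ab c0 lam2 wc.
have [hs <-] := datum_Hs s T_gt0 mh hH h_cj.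
have [x1 [D [x10 dD hD]]] := HC _ t a b c lam hs tT ab c0 lam2 wc.
have [A [B hB]] := window_sol_taylor alpha T_gt0 mh hH h_cj t a b lam2.
have H0 := H_ge0 hH; have K0 := @K_ge0 R.
have KH0 : 0 <= @K R * H by exact: mulr_ge0.
pose n := Hs_norm s (datum h); have n0 : 0 <= n by exact: Hs_norm_ge0.
(* the second bound makes [x] admissible for the Picard iteration, the third keeps
  [x h] in the domain of the flow *)
pose x2 := Num.min x1 (Num.min (16 * (@K R * H) + 1)^-1 (r / (1 + n))).
have p1 : 0 < 16 * (@K R * H) + 1 by rewrite ltr_wpDl// mulr_ge0.
have x20 : 0 < x2 by rewrite !lt_min x10 invr_gt0 p1 divr_gt0// ltr_wpDr.
apply: (quadratic_coefficient x20 (g := fun x : R => window a b lam (flow (x *: datum h) t))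
  (D := D) (A := A) (C := B)).
- by move=> x; rewrite lt_min => /andP[h1 _]; exact: dD.
- by move=> x; rewrite lt_min => /andP[h1 _]; exact: hD.
- move=> x; rewrite !lt_min => /and3P[_ h2 h3].
  have sx : small H x.
    rewrite /small /radius; have : `|x| * (16 * (@K R * H) + 1) < 1.
      by rewrite -ltr_pdivlMr// div1r.
    by have := normr_ge0 x; nra.
  have [_ uq] := flow_solves (Hs_ball_scaled hs h3).
  rewrite -(uq _ (sol_solution s alpha01 T_gt0 mh hH h_cj sx) t tT).
  exact: hB.
Qed.

End second_iterate_bound.

(** * A resonant interaction of low and high frequencies *)

Section resonant_data.
Context {R : realType}.
Notation mu := (@lebesgue_measure R).
Notation Re := complex.Re.
Notation Im := complex.Im.
Variables (alpha T N gam B t P : R).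
Hypothesis alpha01 : 0 <= alpha < 1.
Hypothesis T_gt0 : 0 < T.
Hypothesis tT : 0 <= t <= T.
Hypothesis gam0 : 0 < gam.
Hypothesis gamN : 4 * gam <= N.
Hypothesis B0 : 0 <= B.
Notation p := (power_symbol alpha).
Hypothesis pP : forall xi, `|xi| <= 2 * N -> p xi <= P.
Hypothesis damping : t * P <= 2.
Hypothesis phase : t * N * gam <= 8^-1.

(** A low frequency bump of height 1 and two symmetric high frequency bumps, whose
  height [B] is chosen later to normalise their Sobolev size. *)
Definition bump (xi : R) : R :=
  if `|xi| <= gam then 1 else if N <= `|xi| <= N + gam then B else 0.

Lemma bump_ge0 xi : 0 <= bump xi.
Proof. by rewrite /bump; case: ifP => // _; case: ifP. Qed.
Lemma bump_even xi : bump (- xi) = bump xi.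
Proof. by rewrite /bump normrN. Qed.
Lemma measurable_bump : measurable_fun setT bump.
Proof.
have mn : measurable_fun setT (fun xi : R => `|xi|) by exact: measurableT_comp.
apply: measurable_fun_ifT => //.
  exact: measurable_fun_ler.
apply: measurable_fun_ifT => //.
by apply: measurable_and; exact: measurable_fun_ler.
Qed.
Lemma bump_low xi : `|xi| <= gam -> bump xi = 1.
Proof. by rewrite /bump => ->. Qed.
Lemma bump_high xi : N <= `|xi| <= N + gam -> bump xi = B.
Proof.
move=> h; rewrite /bump h ifF//; apply/negbTE; rewrite -ltNge; move: h gam0 gamN => /andP[h _].
lra.
Qed.

Definition resonant_datum (xi : R) : R[i] := (bump xi)%:C.
Notation h := resonant_datum.

Lemma cmeas_resonant_datum : cmeas h.
Proof. exact: cmeas_real measurable_bump. Qed.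

Lemma resonant_datum_cj xi : h (- xi) = cj (h xi).
Proof. by rewrite /h bump_even cj_real. Qed.

(** A bounded function of bounded support lies in every weighted space. *)
Lemma resonant_datum_bnd : exists H, forall xi, n1 (h xi) <= H * W T 0 xi.
Proof.
have g0 := gam0; have gN := gamN; have b0 := B0.
pose A := N + gam; pose w := expR (- ((T + 1) * A)) * lorentz A.
have w0 : 0 < w by rewrite mulr_gt0 ?expR_gt0 ?lorentz_gt0.
exists ((1 + B) / w) => xi.
rewrite n1_real ger0_norm ?bump_ge0//.
have W0 := @W_ge0 R T 0 xi; have B1 : 0 <= 1 + B by lra.
have c0 : clamp T 0 = 0 by rewrite clamp_id// lexx ltW.
have key : `|xi| <= A -> w <= W T 0 xi.
  move=> xA; rewrite /W /strip c0 subr0; apply: ler_pM; rewrite ?expR_ge0 ?(ltW (lorentz_gt0 _))//.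
    by rewrite ler_expR lerN2 ler_wpM2l//; move: T_gt0; lra.
  rewrite lef_pV2 ?posrE ?oneD_sqr_gt0// lerD2l -[xi ^+ 2]real_normK ?num_real//.
  by rewrite lerXn2r ?nnegrE//; rewrite /A; lra.
rewrite /bump; case: ifP => [xi1|_].
  apply: (@le_trans _ _ (1 + B)); first lra.
  by rewrite mulrAC ler_pdivlMr// ler_wpM2l// key// /A; lra.
case: ifP => [/andP[_ xi2]|_]; last by rewrite mulr_ge0// divr_ge0// ltW.
apply: (@le_trans _ _ (1 + B)); first lra.
by rewrite mulrAC ler_pdivlMr// ler_wpM2l// key.
Qed.

Notation free := (free T p h).

Let N0 : 0 < N. Proof. by move: gam0 gamN; lra. Qed.
Let T0 : 0 <= T. Proof. exact: ltW. Qed.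

Let prop_free tau eta : 0 <= tau <= t ->
  free (tau, eta) = (expR (- (tau * p eta)) * bump eta)%:C * expi (- (tau * (eta * `|eta|))).
Proof.
move=> /andP[t0 tt]; have /andP[_ tT'] := tT.
by rewrite /free /= clamp_id ?t0 ?(le_trans tt)// /prop real_complexM mulrAC.
Qed.

Let theta tau xi eta : R := t * N ^+ 2 - (t - tau) * (xi * `|xi|)
  - tau * (eta * `|eta|) - tau * ((xi - eta) * `|xi - eta|).

Let damp tau xi eta : R := (t - tau) * p xi + tau * p eta + tau * p (xi - eta).

Let interactionE tau xi eta : 0 <= tau <= t ->
  Re (expi (t * N ^+ 2) * (prop p (t - tau) xi * (free (tau, eta) * free (tau, xi - eta)))) =
  expR (- damp tau xi eta) * (bump eta * bump (xi - eta)) * cos (theta tau xi eta).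
Proof.
move=> tt; rewrite !prop_free// /prop.
have -> : expR (- damp tau xi eta) =
   expR (- ((t - tau) * p xi)) * expR (- (tau * p eta)) * expR (- (tau * p (xi - eta))).
  by rewrite -!expRD /damp !opprD.
have E : expi (theta tau xi eta) = expi (t * N ^+ 2) * expi (- ((t - tau) * (xi * `|xi|))) *
   expi (- (tau * (eta * `|eta|))) * expi (- (tau * ((xi - eta) * `|xi - eta|))).
  by rewrite -!expiD.
set a := expR _; set b := expR _; set c := expR _.
transitivity (Re ((a * b * c * (bump eta * bump (xi - eta)))%:C * expi (theta tau xi eta))).
  congr Re; rewrite E !real_complexM.
  move: (a%:C) (b%:C) (c%:C) (bump eta)%:C (bump (xi - eta))%:C => a' b' c' u v.
  move: (expi (t * N ^+ 2)) (expi (- ((t - tau) * (xi * `|xi|)))) => e1 e2.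
  move: (expi (- (tau * (eta * `|eta|)))) (expi (- (tau * ((xi - eta) * `|xi - eta|)))) => e3 e4.
  ring.
by rewrite cReM /= mul0r subr0.
Qed.

(** The resonance: [N^2 - xi^2], [N^2 - v^2] and [u |u|] are all of size [N gam], since
  [xi] and [v] are within [gam] of [N] and [u] is within [gam] of 0. *)
Let phase_le tau xi u v : 0 <= tau <= t -> N <= xi <= N + gam ->
  `|u| <= gam -> N <= v <= N + gam ->
  `|t * N ^+ 2 - (t - tau) * xi ^+ 2 - tau * (u * `|u|) - tau * v ^+ 2| <= 2^-1.
Proof.
have g0 := gam0; have gN := gamN; have b0 := B0; have n0 := N0.
move=> /andP[t0 tt] /andP[x1 x2] u1 /andP[v1 v2].
have sq (y : R) : N <= y -> y <= N + gam -> 0 <= y ^+ 2 - N ^+ 2 <= 3 * N * gam.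
  by move=> y1 y2; apply/andP; split; nra.
have /andP[a1 a2] := sq _ x1 x2; have /andP[b1 b2] := sq _ v1 v2.
have u2 : `|u * `|u| | <= N * gam.
  by rewrite normrM normr_id; have := normr_ge0 u; nra.
move: u2; rewrite ler_norml => /andP[c1 c2].
have d0 : 0 <= t - tau by lra.
have Ng : 0 <= N * gam by rewrite mulr_ge0// ltW.
set X := xi ^+ 2 - N ^+ 2 in a1 a2; set Y := v ^+ 2 - N ^+ 2 in b1 b2; set Z := u * `|u| in c1 c2 *.
have e1 : 0 <= (t - tau) * X <= (t - tau) * (3 * (N * gam)).
  by rewrite mulr_ge0//= ler_wpM2l// mulrA.
have e2 : 0 <= tau * Y <= tau * (3 * (N * gam)).
  by rewrite mulr_ge0//= ler_wpM2l// mulrA.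
have e3 : - (tau * (N * gam)) <= tau * Z <= tau * (N * gam).
  by rewrite -mulrN !ler_wpM2l.
have -> : t * N ^+ 2 - (t - tau) * xi ^+ 2 - tau * Z - tau * v ^+ 2 =
   - ((t - tau) * X) - tau * Y - tau * Z by rewrite /X /Y; ring.
have e4 : tau * (N * gam) <= t * (N * gam) by rewrite ler_wpM2r.
have e5 : t * (N * gam) <= 8^-1 by rewrite mulrA.
move: e1 e2 e3 => /andP[f1 f2] /andP[g1 g2] /andP[h1 h2].
have e6 : (t - tau) * (3 * (N * gam)) + tau * (3 * (N * gam)) = 3 * (t * (N * gam)) by ring.
by rewrite ler_norml; apply/andP; split; lra.
Qed.

(** Two low frequencies, or two high ones of opposite signs, add up to at most [2 gam],
  and two high ones of equal signs to at least [2 N] in modulus; none of these sums is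
  near [N]. *)
Let interacting xi eta : N <= xi <= N + gam -> bump eta * bump (xi - eta) != 0 ->
  (`|eta| <= gam /\ N <= xi - eta <= N + gam) \/ (`|xi - eta| <= gam /\ N <= eta <= N + gam).
Proof.
have g0 := gam0; have gN := gamN; have b0 := B0; have n0 := N0.
move=> /andP[x1 x2]; rewrite mulf_eq0 negb_or => /andP[].
have cases z : bump z != 0 -> `|z| <= gam \/ N <= `|z| <= N + gam.
  rewrite /bump; case: ifP => [h _|_]; first by left.
  by case: ifP => [h _|_]; [right|rewrite eqxx].
move=> /cases c1 /cases c2.
case: c1 => [l1|/andP[h1 h1']]; case: c2 => [l2|/andP[h2 h2']].
- by move: l1 l2; rewrite !ler_norml => /andP[? ?] /andP[? ?]; lra.
- left; split=> //; move: l1 h2 h2'; rewrite ler_norml => /andP[? ?].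
  by rewrite ger0_norm; [move=> -> ->|lra].
- right; split=> //; move: l2 h1 h1'; rewrite ler_norml => /andP[? ?].
  by rewrite ger0_norm; [move=> -> ->|lra].
- exfalso; move: h1 h1' h2 h2'.
  by case: (ger0P eta) => ?; case: (ger0P (xi - eta)) => ?; lra.
Qed.

(** On the frequencies that interact the cosine of the phase is at least [1 / 2] and the
  damping factor at least [exp (-4)]; elsewhere the product of bumps vanishes. *)
Let interaction_ge tau xi eta : 0 <= tau <= t -> N <= xi <= N + gam ->
  B * expR (- 4) / 2 * \1_(`[xi - N - gam, xi - N]) eta <=
  Re (expi (t * N ^+ 2) * (prop p (t - tau) xi * (free (tau, eta) * free (tau, xi - eta)))).
Proof.
have g0 := gam0; have gN := gamN; have b0 := B0; have n0 := N0.
move=> tt xN; rewrite interactionE//.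
have /andP[t0 tt'] := tt; have /andP[x1 x2] := xN.
have e0 := expR_ge0 (- damp tau xi eta).
have [z0|nz] := eqVneq (bump eta * bump (xi - eta)) 0.
  rewrite z0 mulr0 mul0r indic_itvE.
  have [/andP[h1 h2]|_] := boolP (xi - N - gam <= eta <= xi - N); last by rewrite mulr0.
  have l1 : `|eta| <= gam by rewrite ler_norml; apply/andP; split; lra.
  have h3 : N <= `|xi - eta| <= N + gam by rewrite ger0_norm; lra.
  by move: z0; rewrite bump_low// bump_high// mul1r => ->; rewrite !mul0r.
have bb0 : 0 <= bump eta * bump (xi - eta) by rewrite mulr_ge0 ?bump_ge0.
have cos_ge : 2^-1 <= cos (theta tau xi eta).
  have h : `|theta tau xi eta| <= 2^-1.
    have xx : xi * `|xi| = xi ^+ 2 by rewrite ger0_norm ?expr2//; lra.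
    rewrite /theta xx; case: (interacting xN nz) => -[l hi].
      have := phase_le tt xN l hi.
      by rewrite [`|xi - eta|]ger0_norm ?[(xi - eta) * _]expr2//; move/andP: hi => [? _]; lra.
    have := phase_le tt xN l hi.
    have -> : eta * `|eta| = eta ^+ 2 by rewrite ger0_norm ?expr2//; move/andP: hi => [? _]; lra.
    by rewrite addrAC.
  have := le_trans (norm_cosB1_le (theta tau xi eta)) h; rewrite ler_norml => /andP[? _]; lra.
(* the exponent is at most [(t + tau) P], and [t P <= 2] *)
have damp_le : expR (- 4) <= expR (- damp tau xi eta).
  rewrite ler_expR lerN2.
  have small : `|eta| <= 2 * N /\ `|xi - eta| <= 2 * N.
    by case: (interacting xN nz) => -[l /andP[h1 h2]]; split; [lra|rewrite ger0_norm; lra|rewrite ger0_norm; lra|lra].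
  have q1 : p xi <= P by apply: pP; rewrite ger0_norm; lra.
  have q2 := pP small.1; have q3 := pP small.2.
  have d0 : 0 <= t - tau by lra.
  have P0 : 0 <= P := le_trans (power_symbol_ge0 alpha xi) q1.
  have := ler_wpM2l d0 q1; have := ler_wpM2l t0 q2; have := ler_wpM2l t0 q3.
  have := damping; have := ler_wpM2r P0 tt'; rewrite /damp mulrBl; lra.
have c0 : 0 <= cos (theta tau xi eta) by lra.
have e4 := expR_ge0 (- 4 : R).
rewrite indic_itvE.
have [/andP[h1 h2]|_] := boolP (xi - N - gam <= eta <= xi - N); last first.
  by rewrite mulr0; apply: mulr_ge0 => //; exact: mulr_ge0.
have l1 : `|eta| <= gam by rewrite ler_norml; apply/andP; split; lra.
have h3 : N <= `|xi - eta| <= N + gam by rewrite ger0_norm; lra.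
rewrite mulr1 bump_low// bump_high// mul1r [B * _]mulrC.
apply: ler_pM => //; first exact: mulr_ge0.
by rewrite ler_wpM2r.
Qed.

Let mf : cmeas free := cmeas_free T (@measurable_power_symbol R alpha) cmeas_resonant_datum.
Let mp : measurable_fun setT p := @measurable_power_symbol R alpha.
Let p0 : forall xi, 0 <= p xi := @power_symbol_ge0 R alpha.

Lemma Re_CI_ge (f : R -> R[i]) (m a b : R) : Cintegrable f -> a <= b ->
  (forall x, m * \1_(`[a, b]) x <= Re (f x)) -> m * (b - a) <= Re (Cintegral f).
Proof.
move=> [If _] ab hf; rewrite ReCI -(Rint_indic ab) -RintegralZl//; last exact: intg_indic.
by apply: le_Rintegral => //; apply: intgZl; exact: intg_indic.
Qed.

Let quad_ge xi : N <= xi <= N + gam ->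
  N / (4 * pi) * (B * expR (- 4) / 2 * gam * t) <=
  Re ((0 +i* 1) * expi (t * N ^+ 2) * quad T p free (t, xi)).
Proof.
have g0 := gam0; have gN := gamN; have b0 := B0; have n0 := N0.
move=> xN; have /andP[x1 x2] := xN; have /andP[t0 tT'] := tT.
have [H hH] := resonant_datum_bnd.
have bf := free_bnd T0 p0 hH.
have Id := duh_cintegrable T0 mp p0 t xi (cmeas_conv mf mf) (conv_bnd T0 mf mf bf bf).
rewrite -[quad T p free (t, xi)]/((0 -i* (xi / (4 * pi))) * Cintegral (duh_integrand T p (conv free free) t xi)).
have -> : (0 +i* 1) * expi (t * N ^+ 2) * ((0 -i* (xi / (4 * pi))) * Cintegral (duh_integrand T p (conv free free) t xi)) =
   (xi / (4 * pi))%:C * Cintegral (fun tau => expi (t * N ^+ 2) * duh_integrand T p (conv free free) t xi tau).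
  rewrite (CIZ _ Id).
  have -> : (xi / (4 * pi))%:C = (0 +i* 1) * (0 -i* (xi / (4 * pi))) :> R[i].
    by apply: complex_ext; rewrite ?cReM ?cImM /=; ring.
  ring.
rewrite cReM /= mul0r subr0.
have pi4 : 0 < 4 * pi :> R by rewrite mulr_gt0// pi_gt0.
have e4 := expR_ge0 (- 4 : R).
apply: ler_pM.
- by rewrite divr_ge0 ?ltW.
- by rewrite !mulr_ge0// ltW.
- by rewrite ler_wpM2r// invr_ge0 ltW.
rewrite -[t in X in X <= _]subr0; apply: Re_CI_ge => //; first exact: CintegrableZ.
move=> tau; rewrite indic_itvE /duh_integrand clamp_id//.
case: ifP => tt; last by rewrite !mulr0.
have Ic := Cintegrable_conv T0 tau xi mf mf bf bf.
rewrite mulr1 -[conv free free (tau, xi)]/(Cintegral (fun eta => free (tau, eta) * free (tau, xi - eta))) -(CIZ _ Ic) -CIZ; last exact: CintegrableZ.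
have -> : gam = (xi - N) - (xi - N - gam) by ring.
apply: Re_CI_ge; [|lra|by move=> eta; exact: interaction_ge].
by apply: CintegrableZ; exact: CintegrableZ.
Qed.

(** No cancellation: with the phase [lam] the integrand of the second iterate has
  nonnegative real part on the window, and the interactions of the low bump with the
  high bump add up over the time interval. *)
Lemma second_iterate_ge :
  N / (4 * pi) * (B * expR (- 4) / 2 * gam * t) * gam <=
  second_iterate alpha T h t N (N + gam) ((0 +i* 1) * expi (t * N ^+ 2)).
Proof.
have g0 := gam0.
have [H hH] := resonant_datum_bnd.
have bf := free_bnd T0 p0 hH.
have bq := quad_bnd T0 mp p0 mf bf.
have mq := cmeas_quad T mp mf.
have I : Cintegrable (fun xi => (\1_(`[N, N + gam]) xi)%:C * quad T p free (t, xi)).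
  apply: (Cintegrable_dom _ (intgZl (K * (2 * H) ^+ 2) intg_lorentz)).
    apply: cmeasM; last exact: cmeas_pair1.
    by apply: cmeas_real; exact: measurable_indic_itv.
  move=> xi; rewrite n1Zl -[leRHS]mul1r.
  have /andP[i0 i1] := indic_01 `[N, N + gam] xi.
  rewrite ger0_norm//; apply: ler_pM; rewrite ?n1_ge0//.
  by apply: (le_trans (bq t xi)); rewrite ler_wpM2l ?W_lorentz// (bnd_ge0 bq).
rewrite /second_iterate -(CIZ _ I).
rewrite [X in _ * X <= _](_ : gam = N + gam - N); last by ring.
apply: Re_CI_ge; [exact: CintegrableZ|lra|move=> xi].
rewrite indic_itvE; have [xN|_] := boolP (N <= xi <= N + gam); last by rewrite mulr0 mul0r mulr0.
by rewrite mulr1 mul1r; exact: quad_ge.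
Qed.

End resonant_data.

(** * Growth of the second order term *)

Section sobolev_size.
Context {R : realType}.
Notation mu := (@lebesgue_measure R).
Variable s : R.

Lemma weight_comparable (xi eta : R) : 1 + xi ^+ 2 <= 4 * (1 + eta ^+ 2) ->
  1 + eta ^+ 2 <= 4 * (1 + xi ^+ 2) -> weight s xi <= 4 `^ `|s| * weight s eta.
Proof.
rewrite /weight; have := oneD_sqr_gt0 xi; have := oneD_sqr_gt0 eta.
set a := 1 + xi ^+ 2; set b := 1 + eta ^+ 2 => b0 a0 ab ba.
have [s0|s0] := leP 0 s.
  rewrite ger0_norm// -powRM ?(ltW b0)//.
  by apply: ge0_ler_powR => //; rewrite nnegrE ?mulr_ge0// ltW.
have n0 : 0 <= - s by lra.
rewrite ltr0_norm//.
rewrite -[in leLHS](opprK s) -[X in b `^ X](opprK s) !(powRN _ (- s)).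
rewrite ler_pdivlMr ?powR_gt0// mulrC -ler_pdivlMr ?invr_gt0 ?powR_gt0// invrK.
rewrite -powRM ?(ltW a0)//.
by apply: ge0_ler_powR => //; rewrite nnegrE ?mulr_ge0// ltW.
Qed.

Lemma weight0 : weight s 0 = 1.
Proof. by rewrite /weight expr0n addr0 powR1. Qed.

Variables (N gam : R).
Hypotheses (gam0 : 0 < gam) (gam1 : gam <= 1) (gamN : 4 * gam <= N).
Notation S := (4 `^ `|s| : R).

Lemma weight_high xi : N <= `|xi| <= N + gam ->
  S^-1 * weight s N <= weight s xi <= S * weight s N.
Proof.
move=> /andP[x1 x2]; have g0 := gam0; have gN := gamN.
have S0 : 0 < S by rewrite powR_gt0.
have e : xi ^+ 2 = `|xi| ^+ 2 by rewrite real_normK ?num_real.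
have h1 : 1 + xi ^+ 2 <= 4 * (1 + N ^+ 2) by rewrite e; nra.
have h2 : 1 + N ^+ 2 <= 4 * (1 + xi ^+ 2) by rewrite e; nra.
by rewrite mulrC ler_pdivrMr// mulrC !weight_comparable.
Qed.

(** The height of the high frequency bumps cancels the weight at [N], so that each bump
  contributes a multiple of its width. *)
Lemma resonant_datum_norm_le :
  \int[mu]_xi (weight s xi * sqnorm (resonant_datum N gam (Num.sqrt (weight s N))^-1 xi)) <=
  S * (4 * gam).
Proof.
have g0 := gam0; have gN := gamN; have w0 := weight_gt0 s N.
have S1 : 0 < S by rewrite powR_gt0.
pose d (xi : R) : R := \1_(`[- gam, gam]) xi + (\1_(`[N, N + gam]) xi + \1_(`[- (N + gam), - N]) xi).
have I1 := @intg_indic R (- gam) gam; have I2 := @intg_indic R N (N + gam).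
have I3 := @intg_indic R (- (N + gam)) (- N).
have I23 := intgD I2 I3; have Id := intgZl S (intgD I1 I23).
have le xi : weight s xi * sqnorm (resonant_datum N gam (Num.sqrt (weight s N))^-1 xi) <= S * d xi.
  have d0 : 0 <= d xi by rewrite /d !indic_itvE !addr_ge0// ler0n.
  rewrite sqnorm_real /bump; case: ifP => [x1|_].
    have h : \1_(`[- gam, gam]) xi = 1 :> R by rewrite indic_itvE -ler_norml x1.
    rewrite expr1n mulr1; apply: (@le_trans _ _ S).
      have := @weight_comparable xi 0; rewrite weight0 expr0n addr0 !mulr1.
      have := gam1; have := normr_ge0 xi; rewrite -[xi ^+ 2]real_normK ?num_real// => x0 g1.
      by apply; nra.
    by rewrite ler_peMr ?(ltW S1)// /d h lerDl !indic_itvE addr_ge0// ler0n.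
  case: ifP => [x1|_]; last by rewrite expr0n mulr0 mulr_ge0// ltW.
  have /andP[_ wS] := weight_high x1.
  rewrite exprVn sqr_sqrtr ?(ltW w0)//; apply: (@le_trans _ _ S).
    by rewrite ler_pdivrMr.
  rewrite ler_peMr ?(ltW S1)// /d !indic_itvE; move/andP: x1 => [x1 x2].
  have [x0|x0] := leP 0 xi.
    by move: x1 x2; rewrite ger0_norm// => -> -> /=; rewrite addrCA lerDl addr_ge0// ler0n.
  move: x1 x2; rewrite ltr0_norm// => x1 x2.
  have -> : (- (N + gam) <= xi <= - N) = true by apply/andP; split; lra.
  by rewrite addrA lerDr addr_ge0// ler0n.
have mh := cmeas_resonant_datum N gam (Num.sqrt (weight s N))^-1.
apply: (@le_trans _ _ (\int[mu]_xi (S * d xi))).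
  apply: le_Rintegral => //.
  apply: (intg_dom (measurable_density s mh) Id) => xi.
  by rewrite ger0_norm ?density_ge0.
rewrite RintegralZl//; last exact: intgD.
rewrite RintegralD// RintegralD// !Rint_indic; [|lra..].
by rewrite ler_wpM2l ?(ltW S1)//; lra.
Qed.

End sobolev_size.

Section growth.
Context {R : realType}.
Variables (alpha s T r : R) (flow : dist R -> R -> dist R).
Hypothesis alpha01 : 0 <= alpha < 1.
Hypothesis T_gt0 : 0 < T.
Hypothesis r0 : 0 < r.
Hypothesis flow_solves : forall u0, Hs_ball s r u0 -> unique_solution alpha s T u0 (flow u0).
Hypothesis flow_C2 :
  class_C2 (Hs s) (Hs_norm s) (CHs s T) (CHs_norm s T) (Hs_ball s r) flow.

(** For the resonant datum with [B = (1 + N^2)^(- s/2)] the second iterate is at least of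
  order [t N B gam^2], while the regularity of the flow bounds it by a multiple of
  [B gam^(3/2)]. *)
Lemma resonant_growth_bounded : exists E : R, forall N gam t : R,
  0 <= t <= T -> 0 < gam -> gam <= 1 -> 4 * gam <= N ->
  t * (2 * N `^ alpha) <= 2 -> t * N * gam <= 8^-1 ->
  (t * N) ^+ 2 * gam <= E ^+ 2.
Proof.
have [C C0 HC] := second_iterate_le alpha01 T_gt0 r0 flow_solves flow_C2.
pose S : R := 4 `^ `|s|; have S0 : 0 < S by rewrite powR_gt0.
pose e : R := expR (- 4); have e0 : 0 < e by exact: expR_gt0.
have pi0 := @pi_gt0 R.
exists (8 * pi / e * (Num.sqrt (8 * S) * (C * (S * 4)))).
move=> N gam t tT gam0 gam1 gamN damping phase.
have N0 : 0 < N by lra.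
have w0 := weight_gt0 s N.
pose w := Num.sqrt (weight s N); have ww : 0 < w by rewrite sqrtr_gt0.
pose B := w^-1; have B0 : 0 < B by rewrite invr_gt0.
pose lam : R[i] := (0 +i* 1) * expi (t * N ^+ 2).
have lam2 : n1 lam <= 2.
  rewrite -[leRHS]mul1r; apply: n1M_le; last exact: n1_expi.
  by rewrite /n1 /= normr0 normr1 add0r.
have c0 : 0 < S^-1 * weight s N by rewrite mulr_gt0 ?invr_gt0.
have wc xi : N <= xi <= N + gam -> S^-1 * weight s N <= weight s xi.
  move=> xN; have x0 : 0 <= xi by move/andP: xN => [? _]; lra.
  by have /andP[] : S^-1 * weight s N <= weight s xi <= S * weight s N
    by apply: weight_high gam0 gamN _ _; rewrite ger0_norm.
have [H hH] := resonant_datum_bnd T_gt0 gam0 gamN (ltW B0).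
have Nab : N <= N + gam by lra.
have U := HC _ H t N (N + gam) _ lam (cmeas_resonant_datum N gam B) hH
  (@resonant_datum_cj R N gam B) tT Nab c0 lam2 wc.
have L := second_iterate_ge T_gt0 tT gam0 gamN (ltW B0)
  (fun xi => power_symbol_le_dilate alpha01 N0) damping phase.
have {L U} := le_trans L (le_trans (ler_norm _) U).
have nrm := resonant_datum_norm_le s gam0 gam1 gamN.
rewrite -/w -/B -/S in nrm.
set I := \int[_]_xi _ in nrm * => key.
have sq : Num.sqrt (8 * (N + gam - N) / (S^-1 * weight s N)) = Num.sqrt (8 * S) * Num.sqrt gam * B.
  have -> : 8 * (N + gam - N) / (S^-1 * weight s N) = (8 * S) * gam * B ^+ 2.
    rewrite /B exprVn sqr_sqrtr ?(ltW w0)//.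
    by field; rewrite !gt_eqF.
  rewrite sqrtrM ?mulr_ge0 ?(ltW S0) ?(ltW gam0)// sqrtrM ?mulr_ge0 ?(ltW S0)//.
  by rewrite sqrtr_sqr gtr0_norm.
rewrite sq in key.
set q := Num.sqrt (8 * S) in key *; set g := Num.sqrt gam in key.
have q0 : 0 <= q by exact: sqrtr_ge0.
have g0 : 0 < g by rewrite sqrtr_gt0.
have gg : gam = g ^+ 2 by rewrite sqr_sqrtr// ltW.
have t0 : 0 <= t by case/andP: tT.
have {}key : N / (4 * pi) * (B * e / 2 * gam * t) * gam <= q * g * B * (C * (S * (4 * gam))).
  apply: (le_trans key); rewrite ler_wpM2l ?mulr_ge0 ?(ltW B0) ?(ltW g0)//.
  by rewrite ler_wpM2l.
have k1 : t * N * g <= 8 * pi / e * (q * (C * (S * 4))).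
  have F : 0 < B * g ^+ 3 * e / (8 * pi) by rewrite !mulr_gt0 ?exprn_gt0 ?invr_gt0 ?mulr_gt0.
  rewrite -(ler_pM2l F); move: key; rewrite gg.
  have -> : N / (4 * pi) * (B * e / 2 * g ^+ 2 * t) * g ^+ 2 = B * g ^+ 3 * e / (8 * pi) * (t * N * g).
    by have := lt0r_neq0 pi0; move: (pi : R) => P P0; field.
  have -> : q * g * B * (C * (S * (4 * g ^+ 2))) =
     B * g ^+ 3 * e / (8 * pi) * (8 * pi / e * (q * (C * (S * 4)))).
    by have := lt0r_neq0 pi0; have := lt0r_neq0 e0; move: (pi : R) (e : R) => P e' P0 e'0; field; rewrite P0.
  by [].
have k0 : 0 <= t * N * g by rewrite !mulr_ge0 ?(ltW N0) ?(ltW g0).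
by rewrite gg -exprMn; apply: lerXn2r => //; rewrite nnegrE//; exact: le_trans k1.
Qed.

End growth.

(** A time [t = t0 N^(- alpha)] keeps the damping bounded and the width
  [gam = 1 / (8 t N)] keeps the phases aligned. Then [(t N)^2 gam = t N / 8] is of order
  [N^(1 - alpha)], which is unbounded because [alpha < 1]. *)
Lemma resonant_parameters (R : realType) (alpha T E : R) : 0 <= alpha < 1 -> 0 < T ->
  exists N gam t : R, [/\ 0 <= t <= T, 0 < gam <= 1, 4 * gam <= N,
    t * (2 * N `^ alpha) <= 2 & t * N * gam <= 8^-1 /\ E < (t * N) ^+ 2 * gam].
Proof.
move=> /andP[a0 a1] T0.
pose t0 := Num.min 1 T; have t00 : 0 < t0 by rewrite lt_min ltr01.
have t01 : t0 <= 1 by rewrite ge_min lexx.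
have t0T : t0 <= T by rewrite ge_min lexx orbT.
pose Y := 4 + (2 + 8 * `|E|) / t0.
have E0 := normr_ge0 E.
have Y4 : 4 <= Y by rewrite lerDl divr_ge0 ?(ltW t00)//; lra.
have tY : t0 * Y = 4 * t0 + 2 + 8 * `|E| by rewrite /Y; field; rewrite gt_eqF.
have a2 : 0 < 1 - alpha by lra.
pose N := Y `^ (1 - alpha)^-1.
have N4 : 4 <= N.
  apply: (le_trans Y4); rewrite -[leLHS]powRr1; last by lra.
  by rewrite ler_powR; [|lra|rewrite invf_ge1//; lra].
have N0 : 0 < N by lra.
have Na : 1 <= N `^ alpha by rewrite -(powRr0 N) ler_powR//; lra.
have Na0 : 0 < N `^ alpha by lra.
have NY : N = N `^ alpha * Y.
  have e : Y = N `^ (1 - alpha) by rewrite /N -powRrM mulVf ?lt0r_neq0// powRr1//; lra.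
  rewrite e -powRD; last by rewrite (gt_eqF N0) implybT.
  by rewrite addrC subrK powRr1// ltW.
pose t := t0 / N `^ alpha.
have tN : t * N = t0 * Y.
  by rewrite /t {2}NY; field; rewrite gt_eqF.
have tY2 : 2 <= t0 * Y by rewrite tY; lra.
exists N, (8 * (t0 * Y))^-1, t; split.
- rewrite divr_ge0 ?(ltW t00) ?(ltW Na0)//= (le_trans _ t0T)// ler_pdivrMr//.
  by rewrite ler_peMr// ltW.
- by rewrite invr_gt0 invf_le1; lra.
- have : (8 * (t0 * Y))^-1 <= 1 by rewrite invf_le1; lra.
  lra.
- have -> : t * (2 * N `^ alpha) = 2 * t0 by rewrite /t; field; rewrite gt_eqF.
  lra.
- rewrite tN; split.
    by rewrite le_eqVlt; apply/orP; left; apply/eqP; field; rewrite !gt_eqF//; lra.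
  have -> : (t0 * Y) ^+ 2 / (8 * (t0 * Y)) = (t0 * Y) / 8 by field; rewrite !gt_eqF//; lra.
  by rewrite ltr_pdivlMr// tY; have := ler_norm E; lra.
Qed.

Theorem theorem1p3 (R : realType) (alpha s : R) :
  0 <= alpha < 1 ->
  ~ exists T : R, 0 < T /\ C2_flow_near_origin alpha s T.
Proof.
move=> alpha01 [T [T0 [r r0 [flow flow_solves flow_C2]]]].
have [E bounded] := resonant_growth_bounded alpha01 T0 r0 flow_solves flow_C2.
have [N [gam [t [tT /andP[gam0 gam1] gamN damping [phase large]]]]] :=
  resonant_parameters (E ^+ 2) alpha01 T0.
have := lt_le_trans large (bounded N gam t tT gam0 gam1 gamN damping phase).
by rewrite ltxx.
Qed.
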